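(* Let $X$ be a continuous semimartingale in $\mathbb{R}^N$ on $[0,T]$ whose quadratic covariations have a density matrix $g_t$ with $cI_N\le g_t\le CI_N$ for a.e. $(t,\omega)$, for some constants $C>c>0$. Let $\Gamma$ be an $(N-1)$-dimensional orientable manifold of class $C^2$, closed and without boundary, embedded in $\mathbb{R}^N$. If $f\in L^1_{loc}(\Gamma^\perp)$, then $$P\left(\int_0^T|f(X_t)|\,dt<\infty\right)=1.$$
   Context: $N\ge 1$ is an integer and $T>0$ is fixed. The density matrix $g_t$ is the matrix-valued adapted process with $\langle X^j,X^k\rangle_t=\int_0^t g_s^{jk}\,ds$ for all $j,k$; $I_N$ is the identity matrix, and inequalities are in the sense of quadratic forms. ''Closed'' means closed as a subset of $\mathbb{R}^N$. For a measurable $f:\mathbb{R}^N\setminus\Gamma\to\mathbb{R}$ and $a,R>0$ let $M_{a,R}(|f|)=\sup_{x\in\Gamma^d_{a,R}}|f(x)|$, where $\Gamma^d_{a,R}=\{x\in B(0,R): d(x,\Gamma)=a\}$, $B(0,R)$ is the ball of radius $R$ centred at the origin, $d(\cdot,\Gamma)$ is the Euclidean distance to $\Gamma$, and the supremum over the empty set is $0$. One says $f\in L^1_{loc}(\Gamma^\perp)$ if $\int_0^1 M_{a,R}(|f|)\,da<\infty$ for every $R>0$ and $f$ is bounded on every compact subset of $\mathbb{R}^N\setminus\Gamma$. The integral $\int_0^T|f(X_t)|\,dt$ is understood for such an $f$, undefined on $\Gamma$, because almost surely $X_t\notin\Gamma$ for a.e. $t\in[0,T]$ (equivalently, extend $f$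 arbitrarily to $\Gamma$ as a measurable function). *)

(* Defs.v *)
From HB Require Import structures.
From mathcomp Require Import all_boot all_order all_algebra.
From mathcomp Require Import all_classical all_reals all_analysis.

Set Implicit Arguments.
Unset Strict Implicit.
Unset Printing Implicit Defensive.

Import Order.TTheory GRing.Theory Num.Theory.
Import numFieldNormedType.Exports.

Local Open Scope classical_set_scope.
Local Open Scope ring_scope.

(** * Euclidean geometry *)

(* The norm [`|x|] of the library on ['rV_N] is the sup norm; it is only used
   through the topology that it induces. *)
Definition enorm (R : realType) (N : nat) (x : 'rV[R]_N) : R :=
  Num.sqrt (\sum_i x 0 i ^+ 2).

(* [+oo] when [G] is empty. *)
Definition edist_to (R : realType) (N : nat) (G : set 'rV[R]_N)
    (x : 'rV[R]_N) : \bar R :=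
  ereal_inf [set (enorm (x - y))%:E | y in G].

Definition loewner_le (R : realType) (N : nat) (A B : 'M[R]_N) : Prop :=
  forall v : 'rV[R]_N, (v *m A *m v^T) 0 0 <= (v *m B *m v^T) 0 0.

(** * C^2 hypersurfaces *)

Definition pderiv (R : realType) (N : nat) (i : 'I_N) (h : 'rV[R]_N -> R) :
    'rV[R]_N -> R :=
  fun x => 'D_(delta_mx 0 i) h x.

Definition pderivable (R : realType) (N : nat) (i : 'I_N)
    (h : 'rV[R]_N -> R) (x : 'rV[R]_N) : Prop :=
  derivable h x (delta_mx 0 i).

Definition continuous_on_open (R : realType) (N : nat) (U : set 'rV[R]_N)
    (h : 'rV[R]_N -> R) : Prop :=
  forall x, U x -> {for x, continuous h}.

(* Meant for an open [U], as derivatives at [x] look at a neighbourhood. *)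
Definition C2_on (R : realType) (N : nat) (U : set 'rV[R]_N)
    (h : 'rV[R]_N -> R) : Prop :=
  [/\ continuous_on_open U h,
      forall i, (forall x, U x -> pderivable i h x) /\
                continuous_on_open U (pderiv i h)
    & forall i j, (forall x, U x -> pderivable j (pderiv i h) x) /\
                  continuous_on_open U (pderiv j (pderiv i h))].

Record chart (R : realType) (N : nat) := Chart {
  chart_dom : set 'rV[R]_N;
  chart_im : set 'rV[R]_N;
  chart_map : 'rV[R]_N -> 'rV[R]_N;
  chart_inv : 'rV[R]_N -> 'rV[R]_N }.

(* A C^2 diffeomorphism between open sets of R^(n+1) that straightens [G] to
   the hyperplane where the last coordinate vanishes. *)
Definition slice_chart (R : realType) (n : nat) (G : set 'rV[R]_n.+1)
    (k : chart R n.+1) : Prop :=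
  [/\ open (chart_dom k) /\ open (chart_im k),
      forall x, chart_dom k x ->
        chart_im k (chart_map k x) /\ chart_inv k (chart_map k x) = x,
      forall y, chart_im k y ->
        chart_dom k (chart_inv k y) /\ chart_map k (chart_inv k y) = y,
      (forall i, C2_on (chart_dom k) (fun x => chart_map k x 0 i)) /\
      (forall i, C2_on (chart_im k) (fun y => chart_inv k y 0 i))
    & forall x, chart_dom k x -> (G x <-> chart_map k x 0 ord_max = 0)].

Definition C2_hypersurface (R : realType) (n : nat) (G : set 'rV[R]_n.+1) :
    Prop :=
  forall p, G p -> exists k, slice_chart G k /\ chart_dom k p.

(* Jacobian determinant at [p] of the change of coordinates from [k] to [l] on
   the hypersurface, in the first n coordinates of the two charts. *)
Definition transition_det (R : realType) (n : nat) (k l : chart R n.+1)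
    (p : 'rV[R]_n.+1) : R :=
  \det (row' ord_max (col' ord_max
    (jacobian (chart_map l \o chart_inv k) (chart_map k p)))).

Definition orientable (R : realType) (n : nat) (G : set 'rV[R]_n.+1) : Prop :=
  exists Atl : set (chart R n.+1),
    [/\ forall k, Atl k -> slice_chart G k,
        forall p, G p -> exists k, Atl k /\ chart_dom k p
      & forall k l p, Atl k -> Atl l -> G p ->
          chart_dom k p -> chart_dom l p -> 0 < transition_det k l p].

(** * The class L^1_loc(Gamma^perp) *)

Definition parallel_slice (R : realType) (N : nat) (G : set 'rV[R]_N)
    (a r : R) : set 'rV[R]_N :=
  [set x | enorm x < r /\ edist_to G x = a%:E].

(* The supremum in [0, +oo], whence 0 on the empty set. *)
Definition slice_sup (R : realType) (N : nat) (G : set 'rV[R]_N)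
    (f : 'rV[R]_N -> R) (a r : R) : \bar R :=
  ereal_sup ([set 0%E] `|` [set `|f x|%:E | x in parallel_slice G a r]).

(* Only the values of [f] off [G] matter.  [a |-> slice_sup G f a r] is
   Lebesgue measurable, though not necessarily Borel measurable; the integral
   of the library, a supremum over Borel simple minorants, is its Lebesgue
   integral. *)
Definition L1loc_perp (R : realType) (N : nat) (G : set 'rV[R]_N)
    (f : 'rV[R]_N -> R) : Prop :=
  (forall r : R, 0 < r ->
     (\int[lebesgue_measure]_(a in `]0%R, 1%R]) slice_sup G f a r < +oo)%E) /\
  (forall K : set 'rV[R]_N, compact K -> K `<=` ~` G ->
     exists m : R, forall x, K x -> `|f x| <= m).

Definition borel_fun (R : realType) (N : nat) (f : 'rV[R]_N -> R) : Prop :=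
  measurable_fun [set: g_sigma_algebraType (@open 'rV[R]_N)] f.

(** * Stochastic processes on [0, T] *)

Definition filtration (R : realType) (d : measure_display)
    (Omega : measurableType d) (T : R) (F : R -> set_system Omega) : Prop :=
  [/\ forall t, 0 <= t <= T -> sigma_algebra setT (F t),
      forall t, 0 <= t <= T -> F t `<=` measurable
    & forall s t, 0 <= s -> s <= t -> t <= T -> F s `<=` F t].

Definition adapted (R : realType) (Omega : Type) (T : R)
    (F : R -> set_system Omega) (Y : R -> Omega -> R) : Prop :=
  forall t, 0 <= t <= T ->
    forall B : set R, measurable B -> F t (Y t @^-1` B).

Definition continuous_paths (R : realType) (Omega : Type) (T : R)
    (Y : R -> Omega -> R) : Prop :=
  forall w, {within `[0, T], continuous (fun t => Y t w)}.

Definition bv_paths (R : realType) (Omega : Type) (T : R)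
    (Y : R -> Omega -> R) : Prop :=
  forall w, bounded_variation 0 T (fun t => Y t w).

(* The third clause says E[Y_t | F_s] = Y_s. *)
Definition martingale (R : realType) (d : measure_display)
    (Omega : measurableType d) (P : probability Omega R) (T : R)
    (F : R -> set_system Omega) (Y : R -> Omega -> R) : Prop :=
  [/\ adapted T F Y,
      forall t, 0 <= t <= T -> P.-integrable setT (fun w => (Y t w)%:E)
    & forall s t, 0 <= s -> s <= t -> t <= T -> forall B, F s B ->
        (\int[P]_(w in B) (Y t w)%:E = \int[P]_(w in B) (Y s w)%:E)%E].

Definition stopping_time (R : realType) (Omega : Type) (T : R)
    (F : R -> set_system Omega) (tau : Omega -> R) : Prop :=
  (forall w, 0 <= tau w <= T) /\
  (forall t, 0 <= t <= T -> F t [set w | tau w <= t]).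

(* On the closed interval [0, T] a localizing sequence eventually equals T. *)
Definition local_martingale (R : realType) (d : measure_display)
    (Omega : measurableType d) (P : probability Omega R) (T : R)
    (F : R -> set_system Omega) (Y : R -> Omega -> R) : Prop :=
  adapted T F Y /\
  exists tau : nat -> Omega -> R,
    [/\ forall k, stopping_time T F (tau k),
        forall k w, tau k w <= tau k.+1 w,
        {ae P, forall w, \forall k \near \oo, tau k w = T}
      & forall k, martingale P T F
          (fun t w => Y (Num.min t (tau k w)) w - Y 0 w)].

(* X = X_0 + M + A, with M a continuous local martingale and A a continuous
   adapted process of finite variation, both null at time 0. *)
Definition canonical_decomposition (R : realType) (d : measure_display)
    (Omega : measurableType d) (P : probability Omega R) (T : R)
    (F : R -> set_system Omega) (X M A : R -> Omega -> R) : Prop :=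
  [/\ adapted T F X,
      [/\ continuous_paths T M, local_martingale P T F M
        & forall w, M 0 w = 0],
      [/\ continuous_paths T A, adapted T F A, bv_paths T A
        & forall w, A 0 w = 0]
    & forall t w, 0 <= t <= T -> X t w = X 0 w + M t w + A t w].

Definition coord (R : realType) (Omega : Type) (N : nat)
    (X : R -> Omega -> 'rV[R]_N) (i : 'I_N) : R -> Omega -> R :=
  fun t w => X t w 0 i.

Definition entry (R : realType) (Omega : Type) (N : nat)
    (g : R -> Omega -> 'M[R]_N) (j k : 'I_N) : R -> Omega -> R :=
  fun t w => g t w j k.

Definition continuous_semimartingale (R : realType) (d : measure_display)
    (Omega : measurableType d) (P : probability Omega R) (T : R)
    (F : R -> set_system Omega) (N : nat) (X : R -> Omega -> 'rV[R]_N) :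
    Prop :=
  exists M A : R -> Omega -> 'rV[R]_N,
    forall i, canonical_decomposition P T F (coord X i) (coord M i) (coord A i).

(* [Q] is the bracket <M, M'> of the continuous local martingales [M], [M']. *)
Definition bracket (R : realType) (d : measure_display)
    (Omega : measurableType d) (P : probability Omega R) (T : R)
    (F : R -> set_system Omega) (M M' Q : R -> Omega -> R) : Prop :=
  [/\ continuous_paths T Q, adapted T F Q, bv_paths T Q,
      forall w, Q 0 w = 0
    & local_martingale P T F (fun t w => M t w * M' t w - Q t w)].

(* <X^j, X^k> is the bracket of the local martingale parts of X^j and X^k,
   which are unique up to indistinguishability. *)
Definition quadratic_covariations (R : realType) (d : measure_display)
    (Omega : measurableType d) (P : probability Omega R) (T : R)
    (F : R -> set_system Omega) (N : nat) (X : R -> Omega -> 'rV[R]_N)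
    (Q : R -> Omega -> 'M[R]_N) : Prop :=
  exists M A : R -> Omega -> 'rV[R]_N,
    (forall i,
       canonical_decomposition P T F (coord X i) (coord M i) (coord A i)) /\
    (forall j k, bracket P T F (coord M j) (coord M k) (entry Q j k)).

Definition density_matrix (R : realType) (d : measure_display)
    (Omega : measurableType d) (P : probability Omega R) (T : R)
    (F : R -> set_system Omega) (N : nat) (X : R -> Omega -> 'rV[R]_N)
    (g : R -> Omega -> 'M[R]_N) : Prop :=
  [/\ forall j k, adapted T F (entry g j k),
      forall j k, measurable_fun (`[0, T] `*` [set: Omega])
        (fun p : R * Omega => entry g j k p.1 p.2)
    & exists Q : R -> Omega -> 'M[R]_N,
        quadratic_covariations P T F X Q /\
        {ae P, forall w, forall j k,
           lebesgue_measure.-integrable `[0, T]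
             (fun s => (entry g j k s w)%:E) /\
           forall t, 0 <= t <= T ->
             entry Q j k t w =
             \int[lebesgue_measure]_(s in `[0, t]) entry g j k s w}].

(* Main.v *)
Require Import Defs.
From HB Require Import structures.
From mathcomp Require Import all_boot all_order all_algebra.
From mathcomp Require Import all_classical all_reals all_analysis.
From mathcomp Require Import measurable_realfun.
From mathcomp Require Import ring lra.

Set Implicit Arguments.
Unset Strict Implicit.
Unset Printing Implicit Defensive.

Import Order.TTheory GRing.Theory Num.Theory.
Import numFieldNormedType.Exports.

Local Open Scope classical_set_scope.
Local Open Scope ring_scope.

(** For a continuous semimartingale with elliptic brackets the time spent at
    distance at most [a] from [G] is, after localization, at most a constant
    times [a]; more precisely the occupation measure has under the distance to
    [G] an image with bounded density near 0, and it does not charge [G].  Hence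
    near [G] the integral of [|f (X t)|] is dominated in mean by the integral of
    the suprema of [|f|] over the parallel slices, which is finite by
    hypothesis; away from [G] the function [f] is bounded along a path.

    The occupation bound is [occupation_estimate].  Let [h] be a bounded function
    that has at each [x] a quadratic minorant with gradient [p x] and Hessian
    [v^T v - 2 kap I].  Sum the minorants over the steps of a partition of [0, T].  The increments of
    [h (X t)] telescope and are bounded by [h]; products of increments of the
    martingale part are increments of brackets up to martingale increments,
    which have mean 0; the finite variation part costs its variation.  By
    ellipticity what remains bounds from below, up to constants, the expected
    integral of [|v (X t)|^2], so the expected time that [X] spends where [v]
    has norm at least 1 is bounded by the bounds for [h], [p] and [kap].  The
    sums stop at the first point of the partition where one of the localizing
    bounds fails; the increment of a martingale over that last step tends to 0
    in mean with the mesh ([exit_jump_cvg0]).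

    The test functions are functions of the distance [d] to [G].  A hypersurface
    of class C^2 is touched at each of its points by two balls, on the two
    sides, with a radius that is uniform on bounded sets; therefore
    [d y >= |d x + e . (y - x)| - K |y - x|^2] for a unit vector [e] if [x] is
    near [G] ([two_sided]).  If [phi] is nondecreasing and its second derivative
    is 1 on [[al, al + del]] and at least [- del / r] elsewhere, then [phi (d x)]
    has the required minorants with constants of order [del], whence the bound
    for the time spent in [{al <= d <= al + del}] ([tube_estimate]).  The same
    function with [al = 0], with the unit normal of [G] as [v] on [G] itself,
    shows that no time is spent on [G] ([surface_null]).

    The bound for intervals extends to Borel sets of distances by coverings
    ([density_bound]).  The supremum of [|f|] over a slice need not be a Borel
    function of the distance, but by inner regularity of the occupation measure
    it has a Borel minorant that still dominates [|f|] almost everywhere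
    ([slice_minorant]). *)

(** * Expectations of real random variables *)

Section RealExpectation.
Context (R : realType) (d : measure_display) (Omega : measurableType d)
  (P : probability Omega R).
Implicit Types f g : Omega -> R.

Definition L1 f := P.-integrable setT (EFin \o f).
Definition Ex f : R := \int[P]_w f w.

Lemma L1_measurable f : L1 f -> measurable_fun setT f.
Proof. by move=> /measurable_int/measurable_EFinP. Qed.

Lemma L1D f g : L1 f -> L1 g -> L1 (fun w => f w + g w).
Proof. exact: integrableD. Qed.

Lemma L1B f g : L1 f -> L1 g -> L1 (fun w => f w - g w).
Proof. exact: integrableB. Qed.

Lemma L1Z k f : L1 f -> L1 (fun w => k * f w).
Proof. exact: integrableZl. Qed.

Lemma L1cst k : L1 (fun=> k).
Proof. exact: finite_measure_integrable_cst. Qed.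

Lemma L1sum (I : Type) (s : seq I) (p : pred I) (h : I -> Omega -> R) :
  (forall i, p i -> L1 (h i)) -> L1 (fun w => \sum_(i <- s | p i) h i w).
Proof.
move=> L1h; elim: s => [|i s ih].
  by under eq_fun do rewrite big_nil; exact: L1cst.
under eq_fun do rewrite big_cons.
by case pi : (p i) => //; apply: L1D => //; exact: L1h.
Qed.

Lemma L1_norm f : L1 f -> L1 (fun w => `|f w|).
Proof. exact: integrable_norm. Qed.

Lemma L1_le f g : measurable_fun setT f -> L1 g ->
  (forall w, `|f w| <= g w) -> L1 f.
Proof.
move=> mf L1g fg; apply: le_integrable L1g => //; first exact/measurable_EFinP.
by move=> w _; rewrite /= lee_fin (le_trans (fg w))// ler_norm.
Qed.

Lemma L1_bounded f K : measurable_fun setT f -> (forall w, `|f w| <= K) -> L1 f.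
Proof. by move=> mf fK; exact: L1_le mf (L1cst K) fK. Qed.

Lemma indic_norm_le1 (B : set Omega) w : `|\1_B w| <= 1 :> R.
Proof. by rewrite indicE; case: (_ \in _); rewrite ?normr1 ?normr0. Qed.

Lemma L1indicM (B : set Omega) f : measurable B -> L1 f ->
  L1 (fun w => \1_B w * f w).
Proof.
move=> mB L1f; apply: (L1_le _ (L1_norm L1f)).
  by apply: measurable_funM (L1_measurable L1f); exact: measurable_indic.
by move=> w; rewrite normrM ler_piMl// indic_norm_le1.
Qed.

Lemma L1Mbounded (xi f : Omega -> R) K : measurable_fun setT xi -> (forall w, `|xi w| <= K) ->
  L1 f -> L1 (fun w => xi w * f w).
Proof.
move=> mxi xiK L1f; apply: (L1_le _ (L1Z K (L1_norm L1f))).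
  exact: measurable_funM mxi (L1_measurable L1f).
by move=> w; rewrite normrM ler_wpM2r.
Qed.

Lemma ExD f g : L1 f -> L1 g -> Ex (fun w => f w + g w) = Ex f + Ex g.
Proof. exact: RintegralD. Qed.

Lemma ExB f g : L1 f -> L1 g -> Ex (fun w => f w - g w) = Ex f - Ex g.
Proof. exact: RintegralB. Qed.

Lemma ExZ k f : L1 f -> Ex (fun w => k * f w) = k * Ex f.
Proof. exact: RintegralZl. Qed.

Lemma Ex_cst k : Ex (fun=> k) = k.
Proof.
rewrite /Ex Rintegral_cst// -[RHS]mulr1; congr (_ * _).
exact: (congr1 fine (probability_setT P)).
Qed.

Lemma Ex_sum (I : Type) (s : seq I) (p : pred I) (h : I -> Omega -> R) :
  (forall i, p i -> L1 (h i)) ->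
  Ex (fun w => \sum_(i <- s | p i) h i w) = \sum_(i <- s | p i) Ex (h i).
Proof.
move=> L1h; elim: s => [|i s ih].
  by under eq_fun do rewrite big_nil; rewrite Ex_cst big_nil.
under eq_fun do rewrite big_cons.
rewrite big_cons; case pi : (p i) => //.
by rewrite ExD ?ih//; [exact: L1h|exact: L1sum].
Qed.

Lemma le_Ex f g : L1 f -> L1 g -> (forall w, f w <= g w) -> Ex f <= Ex g.
Proof. by move=> L1f L1g fg; apply: le_Rintegral. Qed.

Lemma le_norm_Ex f : L1 f -> `|Ex f| <= Ex (fun w => `|f w|).
Proof. exact: le_normr_Rintegral. Qed.

Lemma eq_Ex f g : (forall w, f w = g w) -> Ex f = Ex g.
Proof. by move=> fg; congr Ex; apply/funext. Qed.

Lemma ae_le_Ex f g : L1 f -> L1 g -> {ae P, forall w, f w <= g w} ->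
  Ex f <= Ex g.
Proof.
move=> L1f L1g fg; rewrite -subr_ge0 -ExB//.
have L1gf := L1B L1g L1f.
rewrite /Ex /Rintegral.
have -> : (\int[P]_w (g w - f w)%:E = \int[P]_w `|g w - f w|%:E)%E.
  apply: ae_eq_integral => //.
  - exact: measurable_int L1gf.
  - exact: measurable_int (L1_norm L1gf).
  - by apply: filterS fg => w fgw _; rewrite ger0_norm// subr_ge0.
by apply: fine_ge0; apply: integral_ge0 => w _; rewrite lee_fin.
Qed.

Lemma Ex_dominated (h : nat -> Omega -> R) f g :
  (forall n, measurable_fun setT (h n)) -> measurable_fun setT f -> L1 g ->
  (forall n w, `|h n w| <= g w) -> (forall w, h ^~ w @ \oo --> f w) ->
  (fun n => Ex (h n)) @ \oo --> Ex f.
Proof.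
move=> mh mf L1g hg hf.
have [] := @dominated_convergence _ _ _ P setT measurableT
  (fun n => EFin \o h n) (EFin \o f) (EFin \o g).
- by move=> n; exact/measurable_EFinP.
- exact/measurable_EFinP.
- by apply: aeW => w _; apply: cvg_EFin => //; [exact: nearW|exact: hf].
- exact: L1g.
- by apply: aeW => w n _; rewrite /= lee_fin.
move=> if_ _ cv; apply: fine_cvg.
rewrite fineK//.
exact: integrable_fin_num.
Qed.

End RealExpectation.

(** * Measurability with respect to a sub-sigma-algebra *)

Section SubSigmaAlgebra.
Context (R : realType) (d : measure_display) (Omega : measurableType d).

(** The type [g_sigma_algebraType S] carries the sigma-algebra generated by [S],
    so the general lemmas on measurable functions apply to a sigma-algebra of a
    filtration. *)
Definition fmeas (S : set_system Omega) (xi : Omega -> R) : Prop :=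
  measurable_fun [set: g_sigma_algebraType S] (xi : g_sigma_algebraType S -> R).

Lemma fmeasP (S : set_system Omega) (xi : Omega -> R) : sigma_algebra setT S ->
  fmeas S xi <-> (forall B, measurable B -> S (xi @^-1` B)).
Proof.
move=> sS; split=> [mxi B mB|SB].
  have := mxi measurableT B mB; rewrite setTI.
  by rewrite measurable_g_measurableTypeE.
move=> _ B mB; rewrite setTI measurable_g_measurableTypeE//; exact: SB.
Qed.

Lemma fmeas_le (S S' : set_system Omega) (xi : Omega -> R) :
  S `<=` S' -> fmeas S xi -> fmeas S' xi.
Proof.
move=> SS' mxi _ B mB.
by apply: (sub_sigma_algebra2 SS'); exact: mxi.
Qed.

Lemma fmeas_measurable (S : set_system Omega) (xi : Omega -> R) :
  S `<=` measurable -> fmeas S xi -> measurable_fun setT xi.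
Proof.
move=> SM mxi _ B mB.
have := sub_sigma_algebra2 SM (mxi measurableT B mB).
by rewrite (sigma_algebra_id (sigma_algebra_measurable _)).
Qed.

Lemma fmeas_indic (S : set_system Omega) (B : set Omega) :
  S B -> fmeas S (\1_B).
Proof.
move=> SB; apply: (@measurable_indic _ (g_sigma_algebraType S) R setT B).
exact: sub_sigma_algebra.
Qed.

End SubSigmaAlgebra.

(** * Martingales *)

(** Layers of a bounded function: this is what makes it a uniform limit of
    combinations of indicators. *)
Lemma staircase (R : realType) (n : nat) (x : R) : 0 <= x <= n%:R ->
  \sum_(k < n) (k.+1%:R <= x)%R%:R <= x <= \sum_(k < n) (k.+1%:R <= x)%R%:R + 1.
Proof.
elim: n x => [|n ih] x.
  by move=> /andP[x0 xn]; rewrite big_ord0 x0/= (le_trans xn)// add0r ler01.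
move=> /andP[x0 xn1]; rewrite big_ord_recr/=.
have [xn|nx] := leP x n%:R.
  have -> : (n.+1%:R <= x)%R = false.
    by apply/negbTE; rewrite -ltNge (le_lt_trans xn)// ltr_nat.
  by rewrite addr0; apply: ih; rewrite x0.
have -> : \sum_(i < n) (i.+1%:R <= x)%R%:R = n%:R :> R.
  rewrite (eq_bigr (fun=> 1)); first by rewrite sumr_const card_ord.
  by move=> i _; rewrite (le_trans _ (ltW nx))// ler_nat.
rewrite -(@natr1 R n) in xn1 *.
case: (leP (n%:R + 1) x) => /= h.
  by rewrite h/= (le_trans xn1)// lerDl ler01.
by rewrite addr0 (ltW nx) xn1.
Qed.

Section Martingale.
Context (R : realType) (d : measure_display) (Omega : measurableType d)
  (P : probability Omega R) (T : R) (F : R -> set_system Omega).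
Hypothesis hF : filtration T F.
Variables (Y : R -> Omega -> R).
Hypothesis hY : martingale P T F Y.

Lemma martingale_L1 t : 0 <= t <= T -> L1 P (Y t).
Proof. by case: hY => _ + _; exact. Qed.

Lemma martingale_fmeas t : 0 <= t <= T -> fmeas (F t) (Y t).
Proof.
case: hY => aY _ _ tT; apply/fmeasP; first by case: hF => + _ _; exact.
exact: aY.
Qed.

Lemma martingale_indic (s t : R) (B : set Omega) : 0 <= s -> s <= t -> t <= T -> F s B ->
  Ex P (fun w => \1_B w * (Y t w - Y s w)) = 0.
Proof.
move=> s0 st tT FB.
have sT : 0 <= s <= T by rewrite s0 (le_trans st).
have tT' : 0 <= t <= T by rewrite (le_trans s0)//=.
have mB : measurable B by case: hF => _ + _; apply; [exact: sT|].
have iE r : 0 <= r <= T ->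
    Ex P (fun w => \1_B w * Y r w) = fine (\int[P]_(w in B) (Y r w)%:E)%E.
  move=> rT; rewrite /Ex /Rintegral [in RHS]integral_mkcond; congr fine.
  apply: eq_integral => w _; rewrite patchE indicE.
  by case: ifPn => _; rewrite ?mul1r ?mul0r.
have L1I r : 0 <= r <= T -> L1 P (fun w => \1_B w * Y r w).
  by move=> rT; apply: L1indicM => //; exact: martingale_L1.
under eq_Ex do rewrite mulrBr.
rewrite ExB; [|exact: L1I..].
rewrite !iE//; case: hY => _ _ /(_ s t s0 st tT B FB) ->.
by rewrite subrr.
Qed.

(** The defining identity, on events of [F s], extends to bounded factors [xi]
    because these are uniform limits of combinations of indicators. *)
Lemma martingale_orthogonal (s t : R) (xi : Omega -> R) (K : R) : 0 <= s -> s <= t -> t <= T ->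
  fmeas (F s) xi -> (forall w, `|xi w| <= K) ->
  Ex P (fun w => xi w * (Y t w - Y s w)) = 0.
Proof.
move=> s0 st tT mxi xiK.
have sT : 0 <= s <= T by rewrite s0 (le_trans st).
have tT' : 0 <= t <= T by rewrite (le_trans s0)//=.
have sF : sigma_algebra setT (F s) by case: hF => + _ _; exact.
have mF : F s `<=` measurable by case: hF => _ + _; exact.
have K0 : 0 <= K.
  by rewrite (le_trans (normr_ge0 _) (xiK point)).
have L1D : L1 P (fun w => Y t w - Y s w) by apply: L1B; exact: martingale_L1.
pose e := Ex P (fun w => `|Y t w - Y s w|).
have mxi' := fmeas_measurable mF mxi.
suff bnd (m : nat) : `|Ex P (fun w => xi w * (Y t w - Y s w))| <= m.+1%:R^-1 * e.
  apply/eqP; rewrite -normr_le0; apply/ler_addgt0Pl => eps eps0.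
  rewrite addr0.
  have e0 : 0 <= e by apply: Rintegral_ge0.
  pose m := `|Num.ceil (e / eps)|%N.
  apply: le_trans (bnd m) _; rewrite mulrC ler_pdivrMr// -ler_pdivrMl// mulrC.
  rewrite (le_trans (ceil_ge _))// /m -natr1.
  apply: le_trans (_ : `|Num.ceil (e / eps)|%N%:R <= _); last by rewrite lerDl.
  by rewrite natr_absz ler_int ler_norm.
pose N := `|Num.ceil (2 * K * m.+1%:R)|%N.
have KN : 2 * K * m.+1%:R <= N%:R.
  by rewrite (le_trans (ceil_ge _))// natr_absz ler_int ler_norm.
pose B (k : nat) := [set w | k.+1%:R <= m.+1%:R * (xi w + K)].
have FB k : F s (B k).
  have -> : B k = xi @^-1` `[k.+1%:R / m.+1%:R - K, +oo[%classic.
    apply/seteqP; split => w /=; rewrite in_itv/= andbT lerBlDr ler_pdivrMr//;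
      by rewrite mulrC.
  by apply/(fmeasP _ sF).1 => //; exact: measurable_itv.
pose xi' w := m.+1%:R^-1 * \sum_(k < N) \1_(B k) w - K.
have xiE w : `|xi w - xi' w| <= m.+1%:R^-1.
  have := @staircase R N (m.+1%:R * (xi w + K)).
  have /andP[xi1 xi2] : - K <= xi w <= K by rewrite -ler_norml.
  have m0 : 0 < m.+1%:R :> R by [].
  rewrite mulr_ge0 ?ler0n//=; last by lra.
  move=> /(_ _)/wrap[].
    apply: le_trans KN; rewrite mulrC ler_pM2r//; lra.
  set sm := (X in X <= _ <= _) => /andP[h1 h2].
  have smE : sm = \sum_(k < N) \1_(B k) w.
    apply: eq_bigr => k _; rewrite indicE; congr (nat_of_bool _)%:R.
    by apply/idP/idP => [/mem_set|]; rewrite ?inE.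
  rewrite /xi' -smE.
  have -> : xi w - (m.+1%:R^-1 * sm - K) =
      m.+1%:R^-1 * (m.+1%:R * (xi w + K) - sm).
    by field; rewrite addrC natr1 pnatr_eq0.
  rewrite normrM (ger0_norm (_ : 0 <= m.+1%:R^-1)) ?invr_ge0//.
  rewrite ler_piMr ?invr_ge0// ler_norml; move: h1 h2.
  by rewrite -/sm; set a := m.+1%:R * _; lra.
have mB k : measurable (B k) by exact/mF/FB.
have xi'0 : Ex P (fun w => xi' w * (Y t w - Y s w)) = 0.
  have L1k k : L1 P (fun w => \1_(B k) w * (Y t w - Y s w)).
    exact: L1indicM.
  have -> : Ex P (fun w => xi' w * (Y t w - Y s w)) =
      Ex P (fun w => m.+1%:R^-1 * (\sum_(k < N) \1_(B k) w * (Y t w - Y s w))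
        - K * (\1_setT w * (Y t w - Y s w))).
    apply: eq_Ex => w.
    by rewrite /xi' indicE in_setT mul1r mulrBl -mulrA mulr_suml.
  have L1s : L1 P (fun w => \sum_(k < N) \1_(B k) w * (Y t w - Y s w)).
    exact: L1sum.
  have L1T : L1 P (fun w => \1_setT w * (Y t w - Y s w)) by exact: L1indicM.
  rewrite ExB; [|exact: L1Z..].
  rewrite !ExZ// Ex_sum// martingale_indic//; last first.
    by case: sF => s1 /(_ _ s1); rewrite setD0.
  rewrite mulr0 subr0 big1 ?mulr0// => k _.
  exact: martingale_indic.
have mxi'' : measurable_fun setT xi'.
  apply: measurable_funB => //; apply: measurable_funM => //.
  by apply: measurable_sum => k; exact: measurable_indic.
have xi'K w : `|xi' w| <= K + m.+1%:R^-1.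
  have -> : xi' w = xi w - (xi w - xi' w) by ring.
  by rewrite (le_trans (ler_normB _ _))// lerD.
have -> : Ex P (fun w => xi w * (Y t w - Y s w)) =
    Ex P (fun w => (xi w - xi' w) * (Y t w - Y s w)).
  under [RHS]eq_Ex do rewrite mulrBl.
  rewrite ExB ?xi'0 ?subr0//.
  - exact: L1Mbounded xiK L1D.
  - exact: L1Mbounded xi'K L1D.
have md : measurable_fun setT (fun w => xi w - xi' w) by exact: measurable_funB.
have L1d := L1Mbounded md xiE L1D.
apply: le_trans (le_norm_Ex L1d) _.
rewrite -ExZ//; last exact: L1_norm.
apply: le_Ex; [exact: L1_norm|by apply: L1Z; exact: L1_norm|].
by move=> w; rewrite normrM ler_wpM2r.
Qed.

(** [|Y|] is a submartingale: split [B] according to the sign of [Y s]. *)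
Lemma martingale_norm (s t : R) (B : set Omega) : 0 <= s -> s <= t -> t <= T -> F s B ->
  Ex P (fun w => \1_B w * `|Y s w|) <= Ex P (fun w => \1_B w * `|Y t w|).
Proof.
move=> s0 st tT FB.
have sT : 0 <= s <= T by rewrite s0 (le_trans st).
have tT' : 0 <= t <= T by rewrite (le_trans s0)//=.
have sF : sigma_algebra setT (F s) by case: hF => + _ _; exact.
have mF : F s `<=` measurable by case: hF => _ + _; exact.
pose xi w : R := \1_B w * (1 - 2 * \1_[set v | Y s v < 0] w).
have Fneg : F s [set v | Y s v < 0].
  have -> : [set v | Y s v < 0] = Y s @^-1` `]-oo, 0[%classic.
    by apply/seteqP; split => w /=; rewrite in_itv.
  by case: hY => + _ _; apply => //; exact: measurable_itv.
have mxi : fmeas (F s) xi.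
  have i1 : fmeas (F s) (\1_B : Omega -> R) by exact: fmeas_indic.
  have i2 : fmeas (F s) (\1_[set v | Y s v < 0] : Omega -> R).
    exact: fmeas_indic.
  apply: (@measurable_funM _ (g_sigma_algebraType (F s))) => //.
  apply: (@measurable_funB _ (g_sigma_algebraType (F s))) => //.
  exact: (@measurable_funM _ (g_sigma_algebraType (F s))).
have xi1 w : `|xi w| <= 1.
  rewrite /xi !indicE; case: (_ \in _); case: (_ \in _) => /=;
    rewrite ?mul0r ?mul1r ?normr0 ?mulr1 ?mulr0 ?subr0 ?normr1//.
  by rewrite (_ : 1 - 2 = -1 :> R) ?normrN1//; ring.
have xiY w : \1_B w * `|Y s w| = xi w * Y s w.
  rewrite /xi -mulrA; congr (_ * _); rewrite indicE.
  have [Y0|Y0] := ltP (Y s w) 0.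
    by rewrite mem_set//= ltr0_norm//; ring.
  by rewrite memNset/= ?ger0_norm ?mulr0 ?subr0 ?mul1r// => /=; rewrite ltNge Y0.
under eq_Ex do rewrite xiY.
have mxi' := fmeas_measurable mF mxi.
have L1xi r : 0 <= r <= T -> L1 P (fun w => xi w * Y r w).
  by move=> rT; apply: (L1Mbounded mxi' xi1); exact: martingale_L1.
(* [xi] is the sign of [Y s] on [B] *)
have h : Ex P (fun w => xi w * Y s w) = Ex P (fun w => xi w * Y t w).
  apply/eqP; rewrite eq_sym -subr_eq0 -ExB; [|exact: L1xi..].
  apply/eqP; rewrite -[RHS](martingale_orthogonal s0 st tT mxi xi1).
  by apply: eq_Ex => w; rewrite mulrBr.
rewrite h; apply: le_Ex; first exact: L1xi.
  by apply: L1indicM; [exact: mF|apply: L1_norm; exact: martingale_L1].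
move=> w; rewrite (le_trans (ler_norm _))// /xi -mulrA normrM.
rewrite (ger0_norm (_ : 0 <= \1_B w)) ?indicE// ler_wpM2l// normrM.
rewrite ler_piMl//; case: (_ \in _) => /=.
  by rewrite (_ : 1 - 2 * 1 = -1 :> R) ?normrN1//; ring.
by rewrite mulr0 subr0 normr1.
Qed.

End Martingale.

(** * Partitions of [0, T] *)

Section Grid.
Context (R : realType).
Variables (T : R).
Hypothesis hT : 0 < T.

(** The partition has [m + 1] intervals, so the mesh makes sense for all [m]. *)
Definition grid (m i : nat) : R := T * i%:R / m.+1%:R.

Lemma grid0 m : grid m 0 = 0.
Proof. by rewrite /grid mulr0 mul0r. Qed.

Lemma gridT m : grid m m.+1 = T.
Proof. by rewrite /grid mulfK. Qed.

Lemma gridS m i : grid m i.+1 - grid m i = T / m.+1%:R.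
Proof. by rewrite /grid -mulrBl -mulrBr -natrB// subSnn mulr1. Qed.

Lemma le_grid m i j : (i <= j)%N -> grid m i <= grid m j.
Proof. by move=> ij; rewrite /grid ler_pM2r// ler_pM2l// ler_nat. Qed.

Lemma grid_ge0 m i : 0 <= grid m i.
Proof. by rewrite -(grid0 m) le_grid. Qed.

Lemma grid_leT m i : (i <= m.+1)%N -> grid m i <= T.
Proof. by move=> im; rewrite -(gridT m) le_grid. Qed.

Lemma grid_itv m i : (i <= m.+1)%N -> 0 <= grid m i <= T.
Proof. by move=> im; rewrite grid_ge0 grid_leT. Qed.

Lemma mesh_cvg0 e : 0 < e -> \forall m \near \oo, T / m.+1%:R < e.
Proof.
move=> e0; have := @cvg_harmonic R.
move=> /cvgrPdist_lt/(_ (e / T)) [|N _ hN]; first exact: divr_gt0.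
exists N => // m Nm; have := hN m Nm; rewrite sub0r normrN/= ger0_norm//.
by rewrite ltr_pdivlMr// mulrC.
Qed.

(** Heine's theorem on the segment. *)
Lemma within_unif_continuous (f : R -> R) : {within `[0, T], continuous f} ->
  forall e, 0 < e -> exists2 del, 0 < del &
    forall s t, 0 <= s <= T -> 0 <= t <= T -> `|t - s| < del ->
      `|f t - f s| < e.
Proof.
move=> cf e e0.
have /compact_near_coveringP/(_ _ (0^'+)
  (fun del s => 0 <= s <= T -> forall t, 0 <= t <= T -> `|t - s| < del ->
      `|f t - f s| < e)) := @segment_compact R 0 T.
case=> [x x0T|del /= del0 hdel].
  have /subspace_continuousP/(_ x x0T)/cvgrPdist_lt/(_ (e / 2)) := cf.
  move=> /(_ _)/wrap[]; first exact: divr_gt0.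
  rewrite near_withinE => /nbhs_ballP[r /= r0 hr].
  exists (ball x (r / 2), [set del | 0 < del] `&` [set del | del < r / 2]).
    split => /=; first by apply: nbhsx_ballx; exact: divr_gt0.
    apply: filterI; first exact: nbhs_right_gt.
    by apply: nbhs_right_lt; exact: divr_gt0.
  move=> [s del] /= [xs [del0 delr]] s0T t t0T ts.
  have hs : `|f x - f s| < e / 2.
    apply: hr; last by rewrite /= in_itv.
    by apply: le_ball xs; rewrite ler_pdivrMr// ler_pMr// ler1n.
  have ht : `|f x - f t| < e / 2.
    apply: hr; last by rewrite /= in_itv.
    move: xs; rewrite /ball/= => xs.
    have -> : x - t = (x - s) - (t - s) by ring.
    by rewrite (le_lt_trans (ler_normB _ _))// [ltRHS]splitr ltrD// (lt_trans ts).
  have -> : f t - f s = (f x - f s) - (f x - f t) by ring.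
  by rewrite (le_lt_trans (ler_normB _ _))// [ltRHS]splitr ltrD.
exists (del / 2); first exact: divr_gt0.
move=> s t s0T t0T ts; apply: (hdel (del / 2)) => //.
- rewrite /ball/= sub0r normrN gtr0_norm ?divr_gt0//.
  by rewrite ltr_pdivrMr// ltr_pMr// ltr1n.
- by rewrite divr_gt0.
Qed.

Lemma grid_osc (f : R -> R) : {within `[0, T], continuous f} ->
  forall e, 0 < e -> \forall m \near \oo, forall i s, (i < m.+1)%N ->
    grid m i <= s <= grid m i.+1 -> `|f s - f (grid m i)| < e.
Proof.
move=> cf e e0; have [del del0 hdel] := within_unif_continuous cf e0.
have := mesh_cvg0 del0; apply: filterS => m hm i s im /andP[s1 s2].
apply: hdel.
- exact/grid_itv/ltnW.
- by rewrite (le_trans _ s1) ?grid_ge0//= (le_trans s2)// grid_leT.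
rewrite ger0_norm ?subr_ge0//; apply: le_lt_trans hm.
by rewrite -(gridS m i) lerD2r.
Qed.

End Grid.

(** * Overshoot at the exit from a decreasing sequence of events *)

Section Overshoot.
Context (R : realType) (d : measure_display) (Omega : measurableType d)
  (P : probability Omega R) (T : R) (F : R -> set_system Omega).
Hypothesis hT : 0 < T.
Hypothesis hF : filtration T F.
Variable E : nat -> nat -> set Omega.
Hypothesis FE : forall m i, (i <= m.+1)%N -> F (grid T m i) (E m i).
Hypothesis E_decr : forall m i, E m i.+1 `<=` E m i.

Let sF t : 0 <= t <= T -> sigma_algebra setT (F t).
Proof. by case: hF => + _ _; exact. Qed.

Let mF t : 0 <= t <= T -> F t `<=` measurable.
Proof. by case: hF => _ + _; exact. Qed.

Lemma indicE_le m i w : \1_(E m i.+1) w <= \1_(E m i) w :> R.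
Proof.
rewrite !indicE ler_nat; case: (boolP (w \in E m i.+1)) => // h.
by rewrite (mem_set (E_decr (set_mem h))).
Qed.

Lemma sum_exit_le1 m n w :
  \sum_(i < n) (\1_(E m i) w - \1_(E m i.+1) w) <= 1 :> R.
Proof.
rewrite (_ : \sum_(i < n) _ = \1_(E m 0) w - \1_(E m n) w).
  by rewrite !indicE; case: (_ \in _); case: (_ \in _); rewrite /= ?mulr1n ?mulr0n; lra.
elim: n => [|n ih]; first by rewrite big_ord0 subrr.
by rewrite big_ord_recr/= ih; ring.
Qed.

Variables (Y : R -> Omega -> R) (b : R).
Hypothesis hY : martingale P T F Y.

(** The difference of indicators is the indicator of the exit during the step
    [i]: this is the mean size of the increment of [Y] in the exit step. *)
Definition exit_jump m : R := Ex P (fun w => \sum_(i < m.+1)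
  (\1_(E m i) w - \1_(E m i.+1) w) *
    `|Y (grid T m i.+1) w - Y (grid T m i) w|).

Let L1Y m i : (i <= m.+1)%N -> L1 P (Y (grid T m i)).
Proof. by move=> im; apply: martingale_L1 hY _ _; exact: grid_itv. Qed.

Let mE m i : (i <= m.+1)%N -> measurable (E m i).
Proof. by move=> im; apply: (mF (grid_itv hT im)); exact: FE. Qed.

Let L1dY m i : (i < m.+1)%N -> 
  L1 P (fun w => Y (grid T m i.+1) w - Y (grid T m i) w).
Proof. by move=> im; apply: L1B; apply: L1Y => //; exact: ltnW. Qed.

Let L1exit m i : (i < m.+1)%N -> forall f, L1 P f ->
  L1 P (fun w => (\1_(E m i) w - \1_(E m i.+1) w) * f w).
Proof.
move=> im f L1f; under eq_fun do rewrite mulrBl.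
by apply: L1B; apply: L1indicM => //; apply: mE => //; exact: ltnW.
Qed.

(** The event [E m i.+1] is not known at the beginning of the step [i].  With
    [E m i] in its place the sum has mean 0; the difference is concentrated on
    the exit step. *)
Lemma exit_jump_bound m (xi : nat -> Omega -> R) K : 0 <= K ->
  (forall i, (i < m.+1)%N -> fmeas (F (grid T m i)) (xi i)) ->
  (forall i w, (i < m.+1)%N -> `|xi i w| <= K) ->
  - (K * exit_jump m) <= Ex P (fun w => \sum_(i < m.+1)
     \1_(E m i.+1) w * (xi i w * (Y (grid T m i.+1) w - Y (grid T m i) w))).
Proof.
move=> K0 mxi xiK.
have mxi' i : (i < m.+1)%N -> measurable_fun setT (xi i).
  by move=> im; apply: fmeas_measurable (mxi i im); apply: mF; exact/grid_itv/ltnW.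
have L1xi (i : 'I_m.+1) :
    L1 P (fun w => xi i w * (Y (grid T m i.+1) w - Y (grid T m i) w)).
  apply: (L1Mbounded _ (fun w => xiK i w (ltn_ord i))); last exact: L1dY.
  exact: mxi'.
have stop0 (i : 'I_m.+1) : Ex P (fun w =>
    \1_(E m i) w * (xi i w * (Y (grid T m i.+1) w - Y (grid T m i) w))) = 0.
  have im := ltn_ord i.
  under eq_Ex do rewrite mulrA.
  apply: (martingale_orthogonal hF hY (K := K)).
  - exact: grid_ge0.
  - exact: le_grid.
  - exact: grid_leT.
  - apply: (@measurable_funM _ (g_sigma_algebraType (F (grid T m i)))).
      by apply: fmeas_indic; apply: FE; exact: ltnW.
    exact: mxi.
  - move=> w; rewrite normrM (le_trans _ (xiK i w im))// ler_piMl//.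
    exact: indic_norm_le1.
have -> : Ex P (fun w => \sum_(i < m.+1)
     \1_(E m i.+1) w * (xi i w * (Y (grid T m i.+1) w - Y (grid T m i) w))) =
   - Ex P (fun w => \sum_(i < m.+1) (\1_(E m i) w - \1_(E m i.+1) w) *
      (xi i w * (Y (grid T m i.+1) w - Y (grid T m i) w))).
  apply/eqP; rewrite -subr_eq0 opprK -ExD; last 2 first.
  - by apply: L1sum => i _; apply: L1indicM => //; exact: mE.
  - by apply: L1sum => i _; exact: L1exit.
  under eq_Ex => w.
    rewrite -big_split/=.
    under eq_bigr do rewrite -mulrDl addrC subrK.
    over.
  rewrite Ex_sum ?big1// => i _.
  by apply: L1indicM => //; apply: mE; exact: ltnW.
rewrite lerN2 -ExZ; last first.
  by apply: L1sum => i _; apply: L1exit => //; apply: L1_norm; exact: L1dY.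
apply: le_Ex.
- by apply: L1sum => i _; exact: L1exit.
- apply: L1Z.
  by apply: L1sum => i _; apply: L1exit => //; apply: L1_norm; exact: L1dY.
move=> w; rewrite mulr_sumr; apply: ler_sum => i _.
rewrite [leRHS]mulrCA ler_wpM2l ?subr_ge0 ?indicE_le//.
by rewrite (le_trans (ler_norm _))// normrM ler_wpM2r// xiK.
Qed.

Hypothesis cY : continuous_paths T Y.
Hypothesis Yb : forall m i w, (i <= m.+1)%N -> E m i w ->
  `|Y (grid T m i) w| <= b.

(** Stopping along the partition overshoots by an amount that tends to 0 in
    mean: on the event that some increment of [Y] is not small, which becomes
    negligible, the value of [Y] after the last step is dominated by the
    terminal value [Y T] since [|Y|] is a submartingale. *)
Lemma exit_jump_cvg0 : exit_jump @ \oo --> 0.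
Proof.
apply/cvgrPdist_le => e e0.
have e20 : 0 < e / 2 by exact: divr_gt0.
pose J m i := [set w | e / 2 < `|Y (grid T m i.+1) w - Y (grid T m i) w|].
pose B m := \big[setU/set0]_(i < m.+1) J m i.
have FJ m i : (i < m.+1)%N -> F (grid T m i.+1) (J m i).
  move=> im; have i1T := grid_itv hT im; have iT := grid_itv hT (ltnW im).
  have ii1 := le_grid hT m (leqnSn i).
  have mYi : fmeas (F (grid T m i.+1)) (Y (grid T m i)).
    apply: fmeas_le (martingale_fmeas hF hY iT).
    case: hF => _ _; apply => //; first by case/andP : iT.
    by case/andP : i1T.
  have mYi1 := martingale_fmeas hF hY i1T.
  have mYn : fmeas (F (grid T m i.+1))
      (fun w => `|Y (grid T m i.+1) w - Y (grid T m i) w|).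
    apply: (@measurableT_comp _ _ _ (g_sigma_algebraType _)) => //.
    exact: (@measurable_funB _ (g_sigma_algebraType _)).
  have -> : J m i = (fun w => `|Y (grid T m i.+1) w - Y (grid T m i) w|) @^-1`
      `]e / 2, +oo[%classic.
    by apply/seteqP; split => w /=; rewrite in_itv/= andbT.
  by apply/(fmeasP _ (sF i1T)).1 => //; exact: measurable_itv.
have mJ m i : (i < m.+1)%N -> measurable (J m i).
  by move=> im; apply: (mF (grid_itv hT im)); exact: FJ.
have mB m : measurable (B m) by apply: bigsetU_measurable => i _; exact: mJ.
have L1YT : L1 P (Y T) by apply: martingale_L1 hY _ _; rewrite ltW//=.
pose g w := `|Y T w| + `|b|.
have L1g : L1 P g by apply: L1D; [exact: L1_norm|exact: L1cst].

(* either the jump is at most [e / 2], or the exit occurs in [D i], where [Y] is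
   bounded by [b] before the jump *)
have main m : exit_jump m <= e / 2 + Ex P (fun w => \1_(B m) w * g w).
  pose D i := (E m i `\` E m i.+1) `&` J m i.
  have FD i : (i < m.+1)%N -> F (grid T m i.+1) (D i).
    move=> im; have i1T := grid_itv hT im; have iT := grid_itv hT (ltnW im).
    have FF : F (grid T m i) `<=` F (grid T m i.+1).
      case: hF => _ _; apply.
      - by case/andP : iT.
      - exact: le_grid.
      - by case/andP : i1T.
    rewrite -(measurable_g_measurableTypeE (sF i1T)).
    apply: measurableI; first apply: measurableD.
    - by apply: sub_sigma_algebra; apply: FF; apply: FE; exact: ltnW.
    - by apply: sub_sigma_algebra; exact: FE.
    - by apply: sub_sigma_algebra; exact: FJ.
  have mD i : (i < m.+1)%N -> measurable (D i).
    by move=> im; apply: (mF (grid_itv hT im)); exact: FD.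
  have DE i w : \1_(D i) w <= \1_(E m i) w - \1_(E m i.+1) w :> R.
    have := indicE_le m i w.
    rewrite !indicE; have [wD|wD] := boolP (w \in D i); last first.
      by rewrite subr_ge0.
    move/set_mem : wD => [[wE wE1] _].
    by rewrite (mem_set wE) (memNset wE1) subr0.
  have DB w : \sum_(i < m.+1) \1_(D i) w <= \1_(B m) w :> R.
    have [wB|wB] := pselect (B m w).
      rewrite indicE mem_set//; apply: le_trans (sum_exit_le1 m m.+1 w).
      by apply: ler_sum => i _; exact: DE.
    rewrite [leRHS]indicE memNset// big1// => i _.
    rewrite indicE memNset// => -[_ Jw]; apply: wB.
    by rewrite /B -bigcup_mkord; exists i => /=.
  pose u i w := (\1_(E m i) w - \1_(E m i.+1) w) * (e / 2) +
    \1_(D i) w * (`|Y (grid T m i.+1) w| + `|b|).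
  have L1exit1 (i : 'I_m.+1) :
      L1 P (fun w => (\1_(E m i) w - \1_(E m i.+1) w) * (e / 2)).
    by apply: L1exit => //; exact: L1cst.
  have L1y i : (i <= m.+1)%N -> L1 P (fun w => `|Y (grid T m i) w| + `|b|).
    by move=> im; apply: L1D; [apply: L1_norm; exact: L1Y|exact: L1cst].
  have L1u (i : 'I_m.+1) : L1 P (u i).
    by apply: L1D => //; apply: L1indicM; [exact: mD|exact: L1y].
  have L1Dg (i : 'I_m.+1) : L1 P (fun w => \1_(D i) w * g w).
    by apply: L1indicM => //; exact: mD.
  apply: (@le_trans _ _ (Ex P (fun w => \sum_(i < m.+1) u i w))).
    apply: le_Ex.
    - by apply: L1sum => i _; apply: L1exit => //; apply: L1_norm; exact: L1dY.
    - exact: L1sum.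
    move=> w; apply: ler_sum => i _; rewrite /u.
    have IE := indicE_le m i w.
    have [Jw|Jw] := pselect (J m i w); last first.
      apply: (@le_trans _ _ ((\1_(E m i) w - \1_(E m i.+1) w) * (e / 2))).
        by rewrite ler_wpM2l ?subr_ge0// leNgt; apply/negP.
      by rewrite lerDl mulr_ge0// addr_ge0.
    have -> : \1_(D i) w = \1_(E m i) w - \1_(E m i.+1) w :> R.
      apply/eqP; rewrite eq_le DE/=.
      have [Ew|Ew] := pselect (E m i w); last first.
        rewrite !indicE (memNset Ew) (_ : (w \in E m i.+1) = false).
          by rewrite subrr ler0n.
        by apply: memNset => /E_decr.
      have [Ew1|Ew1] := pselect (E m i.+1 w).
        by rewrite !indicE (mem_set Ew) (mem_set Ew1) subrr ler0n.
      rewrite !indicE (mem_set Ew) (memNset Ew1) subr0 (_ : (w \in D i) = true)//.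
      exact/mem_set.
    rewrite -mulrDr.
    have [Ew|Ew] := pselect (E m i w); last first.
      have -> : \1_(E m i) w - \1_(E m i.+1) w = 0 :> R.
        rewrite !indicE (memNset Ew) memNset ?subrr//.
        by move=> /E_decr.
      by rewrite !mul0r.
    rewrite ler_wpM2l ?subr_ge0// -[leLHS]add0r; apply: lerD; first exact: ltW.
    rewrite (le_trans (ler_normB _ _))// lerD2l.
    by rewrite (le_trans (Yb _ Ew)) ?ler_norm// ltnW.
  rewrite Ex_sum// (eq_bigr (fun i : 'I_m.+1 =>
    Ex P (fun w => (\1_(E m i) w - \1_(E m i.+1) w) * (e / 2)) +
    Ex P (fun w => \1_(D i) w * (`|Y (grid T m i.+1) w| + `|b|)))); last first.
    by move=> i _; rewrite ExD//; apply: L1indicM; [exact: mD|exact: L1y].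
  rewrite big_split/= lerD//.
    rewrite -Ex_sum// -[leRHS](Ex_cst P); apply: le_Ex.
    - exact: L1sum.
    - exact: L1cst.
    by move=> w; rewrite -mulr_suml ler_piMl ?(ltW e20)// sum_exit_le1.
  apply: (@le_trans _ _ (\sum_(i < m.+1) Ex P (fun w => \1_(D i) w * g w))).
    apply: ler_sum => i _.
    have im := ltn_ord i.
    have L1a j : (j <= m.+1)%N -> L1 P (fun w => \1_(D i) w * `|Y (grid T m j) w|).
      by move=> jm; apply: L1indicM; [exact: mD|apply: L1_norm; exact: L1Y].
    have L1b : L1 P (fun w => \1_(D i) w * `|b|).
      by apply: L1indicM; [exact: mD|exact: L1cst].
    have L1c : L1 P (fun w => \1_(D i) w * `|Y T w|).
      by apply: L1indicM; [exact: mD|apply: L1_norm].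
    rewrite /g; under eq_Ex do rewrite mulrDr.
    under [leRHS]eq_Ex do rewrite mulrDr.
    rewrite !ExD//; last exact: L1a.
    rewrite lerD2r; apply: (martingale_norm hF hY) => //.
    - exact: grid_ge0.
    - exact: grid_leT.
    - exact: FD.
  rewrite -Ex_sum//; apply: le_Ex; [exact: L1sum|exact: L1indicM|].
  by move=> w; rewrite -mulr_suml ler_wpM2r ?DB// addr_ge0.
have cv : (fun m => Ex P (fun w => \1_(B m) w * g w)) @ \oo --> (0 : R).
  rewrite -(Ex_cst P 0); apply: (Ex_dominated (g := g)) => //.
  - by move=> m; apply: (@L1_measurable _ _ _ P); exact: L1indicM.
  - move=> m w; rewrite normrM (ger0_norm (_ : 0 <= g w)) ?addr_ge0//.
    by rewrite ler_piMl ?addr_ge0// indic_norm_le1.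
  move=> w; apply: cvg_near_cst.
  have cYw : {within `[0, T], continuous (Y^~ w)} by exact: cY.
  have := grid_osc hT cYw e20; apply: filterS => m hm.
  rewrite indicE memNset ?mul0r// /B -bigcup_mkord => -[i /= im].
  rewrite /J/= ltNge => /negP; apply; apply/ltW/hm => //.
  by rewrite lexx le_grid.
have := cv => /cvgrPdist_le/(_ _ e20); apply: filterS => m.
rewrite !sub0r !normrN => hm.
rewrite ger0_norm; last first.
  apply: Rintegral_ge0 => w _; apply: sumr_ge0 => i _.
  by rewrite mulr_ge0// subr_ge0 indicE_le.
by rewrite (le_trans (main m))// [leRHS]splitr lerD2l (le_trans (ler_norm _)).
Qed.

End Overshoot.

(** * Closure properties of sigma-algebras *)

Section SigmaAlgebraSets.
Context (R : realType) (d : measure_display) (Omega : measurableType d).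
Variables (S : set_system Omega).
Hypothesis sS : sigma_algebra setT S.

Lemma sigma_algebraT : S setT.
Proof. by case: sS => S0 SD _; have := SD _ S0; rewrite setD0. Qed.

Lemma sigma_algebra_compl B : S B -> S (~` B).
Proof. by case: sS => _ SD _ /SD; rewrite setTD. Qed.

Lemma sigma_algebra_forall (I : countType) (B : I -> set Omega) :
  (forall i, S (B i)) -> S [set w | forall i, B i w].
Proof.
move=> SB.
have -> : [set w | forall i, B i w] = ~` (\bigcup_k
    (if unpickle k is Some i then ~` B i else set0)).
  apply/seteqP; split => w /=.
    by move=> Bw [k _]; case: unpickle => // i; apply.
  move=> h i; apply: contrapT => nB; apply: h; exists (pickle i) => //.
  by rewrite pickleK.
apply: sigma_algebra_compl; case: sS => S0 _; apply=> k.
by case: unpickle => // i; exact: sigma_algebra_compl.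
Qed.

Lemma sigma_algebra_and B C : S B -> S C -> S [set w | B w /\ C w].
Proof.
move=> SB SC.
have -> : [set w | B w /\ C w] = [set w | forall i : bool, (if i then B else C) w].
  apply/seteqP; split => w /=; first by move=> [? ?] [].
  by move=> h; split; [exact: (h true)|exact: (h false)].
by apply: sigma_algebra_forall => -[].
Qed.

Lemma sigma_algebra_imp (p : bool) B : (p -> S B) -> S [set w | p -> B w].
Proof.
move=> SB; have -> : [set w | p -> B w] = if p then B else setT.
  by apply/seteqP; case: p {SB}; split => w //=; exact.
by case: p SB => // SB; [exact: SB|exact: sigma_algebraT].
Qed.

Lemma sigma_algebra_ler (f : Omega -> R) (b : R) : fmeas S f ->
  S [set w | f w <= b].
Proof.
move=> mf.
have -> : [set w | f w <= b] = f @^-1` `]-oo, b]%classic.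
  by apply/seteqP; split => w /=; rewrite in_itv.
by apply: (fmeasP _ sS).1 => //; exact: measurable_itv.
Qed.

Lemma fmeas_norm (f : Omega -> R) : fmeas S f -> fmeas S (fun w => `|f w|).
Proof. by move=> mf; apply: (@measurableT_comp _ _ _ (g_sigma_algebraType S)). Qed.

Lemma fmeasB (f g : Omega -> R) : fmeas S f -> fmeas S g ->
  fmeas S (fun w => f w - g w).
Proof. exact: (@measurable_funB _ (g_sigma_algebraType S)). Qed.

Lemma fmeasD (f g : Omega -> R) : fmeas S f -> fmeas S g ->
  fmeas S (fun w => f w + g w).
Proof. exact: (@measurable_funD _ (g_sigma_algebraType S)). Qed.

Lemma fmeasM (f g : Omega -> R) : fmeas S f -> fmeas S g ->
  fmeas S (fun w => f w * g w).
Proof. exact: (@measurable_funM _ (g_sigma_algebraType S)). Qed.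

Lemma fmeas_cst (k : R) : fmeas S (fun=> k).
Proof. exact: (@measurable_cst _ _ (g_sigma_algebraType S)). Qed.

Lemma fmeas_sum (I : Type) (s : seq I) (p : pred I) (h : I -> Omega -> R) :
  (forall i, p i -> fmeas S (h i)) ->
  fmeas S (fun w => \sum_(i <- s | p i) h i w).
Proof.
move=> mh; elim: s => [|i s ih].
  by under eq_fun do rewrite big_nil; exact: fmeas_cst.
under eq_fun do rewrite big_cons.
by case pi : (p i) => //; apply: fmeasD => //; exact: mh.
Qed.

End SigmaAlgebraSets.

(** * Borel functions of vectors *)

Definition borelV (R : realType) (N : nat) :=
  g_sigma_algebraType (@open 'rV[R]_N).

Section BorelVector.
Context (R : realType) (N : nat).

(** The rational boxes form a countable base of the topology. *)
Definition rat_box (a : {ffun 'I_N -> rat * rat}) : set 'rV[R]_N :=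
  [set x | forall i, ratr (a i).1 < x 0 i < ratr (a i).2].

Lemma open_rV_box (O : set 'rV[R]_N) : open O -> O =
  \bigcup_a (if `[< rat_box a `<=` O >] then rat_box a else set0).
Proof.
move=> oO; apply/seteqP; split => x; last first.
  by move=> [a _]; case: asboolP => // aO; exact: aO.
move=> Ox; have /nbhs_ballP[r /= r0 rO] : nbhs x O by exact: open_nbhs_nbhs.
have lo i : exists q : rat, (ratr q : R) \in `](x 0 i - r), (x 0 i)[.
  by apply: rat_in_itvoo; rewrite ltrBlDr ltrDl.
have hi i : exists q : rat, (ratr q : R) \in `](x 0 i), (x 0 i + r)[.
  by apply: rat_in_itvoo; rewrite ltrDl.
exists [ffun i => (projT1 (cid (lo i)), projT1 (cid (hi i)))] => //.
case: asboolP => [_ /= i|].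
  rewrite ffunE/=; case: cid => q1 /=; case: cid => q2 /=.
  by rewrite !in_itv/= => /andP[-> _] /andP[_ ->].
case; move=> y /= hy; apply: rO; split=> // i j.
have := hy j; rewrite ffunE/=; case: cid => q1 /=; case: cid => q2 /=.
rewrite !in_itv/= (ord1 i) => /andP[h1 h2] /andP[h3 h4] /andP[h5 h6].
by rewrite /ball/= ltr_norml; apply/andP; split; lra.
Qed.

Lemma measurable_rV d (U : measurableType d) (X : U -> 'rV[R]_N) :
  (forall i, measurable_fun setT (fun u => X u 0 i)) ->
  measurable_fun [set: U] (X : U -> borelV R N).
Proof.
move=> mX; apply: (@measurability _ _ U (borelV R N) setT X (@open 'rV[R]_N)) => //.
move=> _ [V oV <-]; rewrite setTI (open_rV_box oV) preimage_bigcup.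
apply: countable_bigcupT_measurable; first exact: countableP.
move=> a.
case: asboolP => _; last by rewrite preimage_set0.
rewrite (_ : _ @^-1` _ = \bigcap_(i : 'I_N)
    ((fun u => X u 0 i) @^-1` `]ratr (a i).1, ratr (a i).2[%classic)).
  apply: fin_bigcap_measurable => // i _.
  by rewrite -[X in measurable X]setTI; apply: mX => //; exact: measurable_itv.
apply/seteqP; split => u /=.
  by move=> h i _ /=; rewrite in_itv/=; exact: h.
by move=> h i; have := h i I; rewrite /= in_itv.
Qed.

Lemma fmeas_rV d (Omega : measurableType d) (S : set_system Omega)
    (X : Omega -> 'rV[R]_N) (p : 'rV[R]_N -> R) : 
  (forall i, fmeas S (fun w => X w 0 i)) -> borel_fun p ->
  fmeas S (fun w => p (X w)).
Proof.
move=> mX mp; apply: (@measurableT_comp _ _ _ (g_sigma_algebraType S) (borelV R N) _ p) => //.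
exact: (@measurable_rV _ (g_sigma_algebraType S)).
Qed.

Lemma continuous_borel_fun (h : 'rV[R]_N -> R) : continuous h -> borel_fun h.
Proof.
move=> /continuousP ch; apply: (measurability _ (@RGenOpens.measurableE R)).
move=> _ [_ [a [b ->] <-]].
rewrite setTI; apply: sub_sigma_algebra.
exact/ch/interval_open.
Qed.

End BorelVector.

(** * Quadratic minorants along one step *)

Section TaylorStep.
Context (R : realType) (N : nat).
Variables (p v dM dA M : 'I_N -> R) (dQ dW : 'I_N -> 'I_N -> R).
Variables (kap eps Pm : R).
Hypothesis kap0 : 0 <= kap.
Hypothesis hp : forall j, `|p j| <= Pm.
Hypothesis hv : forall j, `|v j| <= 1.
Hypothesis hdM : forall j, `|dM j| <= eps.
Hypothesis hdA : forall j, `|dA j| <= eps.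
Hypothesis hW : forall j k,
  dM j * dM k = dW j k + dQ j k - M j * dM k - M k * dM j.

(** The quadratic form [(v . z)^2 / 2 - 2 kap |z|^2].  Compared with the minorant
    [kap] is doubled, since [|dM + dA|^2 <= 2 |dM|^2 + 2 |dA|^2]. *)
Definition qcoef j k : R := 2^-1 * (v j * v k) - 2 * kap * (j == k)%:R.

Lemma qcoef_bound j k : `|qcoef j k| <= 2^-1 + 2 * kap.
Proof.
rewrite /qcoef (le_trans (ler_normB _ _))// lerD//.
  rewrite normrM gtr0_norm// ler_piMr// normrM.
  by rewrite -[leRHS]mulr1 ler_pM.
rewrite normrM ger0_norm ?mulr_ge0// ler_piMr ?mulr_ge0//.
by case: (j == k); rewrite ?normr1 ?normr0.
Qed.

Lemma qcoefE (z : 'I_N -> 'I_N -> R) : \sum_j \sum_k qcoef j k * z j k =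
  2^-1 * (\sum_j \sum_k v j * v k * z j k) - 2 * kap * \sum_j z j j.
Proof.
rewrite !mulr_sumr -sumrB; apply: eq_bigr => j _.
have -> : 2 * kap * z j j = \sum_k 2 * kap * (j == k)%:R * z j k.
  rewrite (bigD1 j)//= eqxx mulr1 big1 ?addr0// => k kj.
  by rewrite eq_sym (negbTE kj) mulr0 mul0r.
by rewrite mulr_sumr -sumrB; apply: eq_bigr => k _; rewrite /qcoef; ring.
Qed.

(** The minorant for a step [dM + dA], in terms of martingale increments [dM] and
    [dW] and of bracket increments [dQ]: [hW] is the product rule for [M j M k],
    whose bracket-compensated increment is [dW j k].  All terms with [dA] are
    bounded by a multiple of its norm. *)
Lemma taylor_step :
  \sum_j (p j - 2 * \sum_k qcoef j k * M k) * dM j +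
  \sum_j \sum_k qcoef j k * dW j k +
  2^-1 * (\sum_j \sum_k v j * v k * dQ j k) - 2 * kap * (\sum_j dQ j j) <=
  \sum_j p j * (dM j + dA j) + 2^-1 * (\sum_j v j * (dM j + dA j)) ^+ 2
  - kap * (\sum_j (dM j + dA j) ^+ 2)
  + (Pm + (N%:R + 2 * kap) * eps) * \sum_j `|dA j|.
Proof.
set a := \sum_j `|dA j|.
have a0 : 0 <= a by apply: sumr_ge0.
have hq : \sum_j \sum_k qcoef j k * (dM j * dM k) =
    2^-1 * (\sum_j v j * dM j) ^+ 2 - 2 * kap * \sum_j dM j ^+ 2.
  rewrite qcoefE expr2; congr (_ * _ - _).
  rewrite mulr_suml; apply: eq_bigr => j _; rewrite mulr_sumr.
  by apply: eq_bigr => k _; ring.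
have hq2 : \sum_j \sum_k qcoef j k * (dM j * dM k) =
    \sum_j \sum_k qcoef j k * dW j k + \sum_j \sum_k qcoef j k * dQ j k
    - 2 * \sum_j (\sum_k qcoef j k * M k) * dM j.
  have -> : 2 * \sum_j (\sum_k qcoef j k * M k) * dM j =
      \sum_j \sum_k qcoef j k * (M j * dM k) +
      \sum_j \sum_k qcoef j k * (M k * dM j).
    rewrite mulr_natl mulr2n; congr (_ + _).
      rewrite [RHS]exchange_big/=; apply: eq_bigr => j _.
      rewrite mulr_suml; apply: eq_bigr => k _.
      by rewrite /qcoef (eq_sym k j); ring.
    by apply: eq_bigr => j _; rewrite mulr_suml; apply: eq_bigr => k _; ring.
  rewrite -big_split/= -big_split/= -sumrB; apply: eq_bigr => j _.
  rewrite -big_split/= -big_split/= -sumrB; apply: eq_bigr => k _.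
  by rewrite hW; ring.
have hpA : \sum_j p j * dM j - Pm * a <= \sum_j p j * (dM j + dA j).
  rewrite mulr_sumr -sumrB; apply: ler_sum => j _.
  rewrite mulrDr lerD2l lerNl (le_trans (ler_norm _))// normrN normrM.
  by rewrite ler_wpM2r.
have hvM : `|\sum_j v j * dM j| <= N%:R * eps.
  rewrite (le_trans (ler_norm_sum _ _ _))//.
  apply: (@le_trans _ _ (\sum_(j < N) eps)).
    by apply: ler_sum => j _; rewrite normrM -[leRHS]mul1r ler_pM.
  by rewrite sumr_const card_ord mulr_natl.
have hvA : `|\sum_j v j * dA j| <= a.
  rewrite (le_trans (ler_norm_sum _ _ _))//.
  by apply: ler_sum => j _; rewrite normrM ler_piMl.
have hsq : (\sum_j v j * dM j) ^+ 2 - 2 * (N%:R * eps * a) <=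
    (\sum_j v j * (dM j + dA j)) ^+ 2.
  have -> : \sum_j v j * (dM j + dA j) =
      \sum_j v j * dM j + \sum_j v j * dA j.
    by rewrite -big_split/=; apply: eq_bigr => j _; rewrite mulrDr.
  rewrite sqrrD -addrA lerD2l.
  apply: (@le_trans _ _ ((\sum_j v j * dM j) * (\sum_j v j * dA j) *+ 2)); last first.
    by rewrite lerDl sqr_ge0.
  rewrite lerNl -mulNrn mulr_natl lerMn2r/= (le_trans (ler_norm _))//.
  by rewrite normrN normrM ler_pM.
have hsum : \sum_j (dM j + dA j) ^+ 2 <= 2 * (\sum_j dM j ^+ 2) + 2 * eps * a.
  rewrite !mulr_sumr -big_split/=; apply: ler_sum => j _.
  have := sqr_ge0 (dM j - dA j).
  have : dA j ^+ 2 <= eps * `|dA j|.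
    by rewrite -real_normK ?num_real// expr2 ler_wpM2r.
  rewrite !expr2; lra.
have := ler_wpM2l kap0 hsum.
have -> : \sum_j (p j - 2 * \sum_k qcoef j k * M k) * dM j =
   \sum_j p j * dM j - 2 * \sum_j (\sum_k qcoef j k * M k) * dM j.
  by rewrite mulr_sumr -sumrB; apply: eq_bigr => j _; ring.
move: hq2; rewrite hq [in X in _ = _ + X - _]qcoefE; lra.
Qed.

End TaylorStep.

(** * Sums stopped at an exit time *)

Section Telescope.
Context (R : realType).

(** Summation by parts: [I] is nonincreasing with total decrease at most 1. *)
Lemma telescope_stopped (I h : nat -> R) Bh n : 
  (forall i, 0 <= I i.+1 <= I i) -> I 0 <= 1 -> (forall i, 0 <= h i <= Bh) ->
  \sum_(i < n) I i.+1 * (h i.+1 - h i) <= Bh.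
Proof.
move=> hI I0 hh.
have I1 i : I i <= 1.
  by elim: i => // i; apply: le_trans; have /andP[] := hI i.
have I00 i : 0 <= I i.
  by have /andP[h1 h2] := hI i; exact: le_trans h1 h2.
have : \sum_(i < n) I i.+1 * (h i.+1 - h i) <= Bh * (1 - I n) + I n * h n.
  elim: n => [|n ih].
    rewrite big_ord0 addr_ge0// mulr_ge0 ?subr_ge0//.
      by have /andP[h1 h2] := hh 0; exact: le_trans h1 h2.
    by case/andP: (hh 0).
  rewrite big_ord_recr/= (le_trans (lerD ih (lexx _)))//.
  have /andP[h1 h2] := hI n; have /andP[h3 h4] := hh n.
  have : (I n - I n.+1) * h n <= (I n - I n.+1) * Bh.
    by rewrite ler_wpM2l// subr_ge0.
  lra.
move/le_trans; apply.
have /andP[h3 h4] := hh n.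
have := ler_wpM2l (I00 n) h4; lra.
Qed.

(** The sum stops at the last index where [E] holds. *)
Lemma sum_stopped (E : nat -> bool) (a : nat -> R) (b : R) n : 0 <= b ->
  (forall i, E i.+1 -> E i) ->
  (forall i, E i -> \sum_(l < i) a l <= b) ->
  \sum_(i < n) (E i.+1)%:R * a i <= b.
Proof.
move=> b0 hE ha.
have Edown k : E k -> forall i, (i < k)%N -> E i.+1.
  elim: k => // k ih Ek i.
  by rewrite ltnS leq_eqVlt => /predU1P[->//|]; apply: ih; exact: hE.
have Esum k : E k -> \sum_(i < k) (E i.+1)%:R * a i <= b.
  move=> Ek; rewrite (le_trans _ (ha k Ek))//; apply: ler_sum => i _.
  by rewrite (Edown k Ek _ (ltn_ord i)) mul1r.
elim: n => [|n ih]; first by rewrite big_ord0.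
have [/Esum//|En] := boolP (E n.+1).
by rewrite big_ord_recr/= (negbTE En) mul0r addr0.
Qed.

End Telescope.

(** * The semimartingale along a partition *)

Lemma stopping_time_ge (R : realType) (Omega : Type) (T : R)
    (F : R -> set_system Omega) (tau : Omega -> R) t :
  (forall t, 0 <= t <= T -> sigma_algebra setT (F t)) ->
  (forall s t, 0 <= s -> s <= t -> t <= T -> F s `<=` F t) ->
  stopping_time T F tau -> 0 <= t <= T -> F t [set w | t <= tau w].
Proof.
move=> sF iF [tau01 htau] /[dup] tT /andP[t0 tleT].
have [F0 FD FU] := sF t tT.
pose B n := [set w | 0 <= t - n.+1%:R^-1 /\ tau w <= t - n.+1%:R^-1].
have -> : [set w | t <= tau w] = setT `\` \bigcup_n B n.
  apply/seteqP; split => w /=.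
    move=> tw; split=> // -[n _ [_ h]]; have := le_trans tw h.
    by rewrite lerBrDr gerDl leNgt invr_gt0 ltr0n.
  move=> [_ h]; rewrite leNgt; apply/negP => tw; apply: h.
  have [n hn] : exists n, n.+1%:R^-1 < t - tau w.
    have := @cvg_harmonic R => /cvgrPdist_lt/(_ (t - tau w)).
    rewrite subr_gt0 => /(_ tw)[n _ /(_ n (leqnn n))].
    by rewrite sub0r normrN/= ger0_norm// => hn; exists n.
  have /andP[tau0 _] := tau01 w.
  exists n => //; move: hn; rewrite /B/=; set x := _^-1 => hn; split; lra.
apply: FD; apply: FU => n.
have [tn|tn] := leP 0 (t - n.+1%:R^-1); last first.
  rewrite (_ : B n = set0)//; apply/seteqP; split => // w [].
  by rewrite leNgt tn.
rewrite (_ : B n = [set w | tau w <= t - n.+1%:R^-1]); last first.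
  by apply/seteqP; split => w //= [].
have tnt : t - n.+1%:R^-1 <= t by rewrite gerBl invr_ge0.
apply: (iF (t - n.+1%:R^-1)) => //.
by apply: htau; rewrite tn (le_trans tnt).
Qed.

Lemma within_continuousW (R : realType) (T : R) (f : R -> R) :
  (forall e, 0 < e -> exists2 del, 0 < del &
    forall s t, 0 <= s <= T -> 0 <= t <= T -> `|t - s| < del ->
      `|f t - f s| < e) -> {within `[0, T], continuous f}.
Proof.
move=> h; apply/subspace_continuousP => x; rewrite /= in_itv/= => xT.
apply/cvgrPdist_lt => e /h[del del0 hdel].
rewrite near_withinE; apply/nbhs_ballP; exists del => // y /= xy.
by rewrite in_itv/= => yT; exact: hdel.
Qed.

Section WithinContinuous.
Context (R : realType) (D : set R) (f g : R -> R).
Hypotheses (cf : {within D, continuous f}) (cg : {within D, continuous g}).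

Lemma within_continuousD : {within D, continuous (fun t => f t + g t)}.
Proof. by move=> x; apply: cvgD; [exact: cf|exact: cg]. Qed.

Lemma within_continuousB : {within D, continuous (fun t => f t - g t)}.
Proof. by move=> x; apply: cvgB; [exact: cf|exact: cg]. Qed.

Lemma within_continuousM : {within D, continuous (fun t => f t * g t)}.
Proof. by move=> x; apply: cvgM; [exact: cf|exact: cg]. Qed.

End WithinContinuous.

Lemma continuous_stopped (R : realType) (T : R) (f : R -> R) (tau : R) :
  0 <= tau <= T -> {within `[0, T], continuous f} ->
  {within `[0, T], continuous (fun t => f (Num.min t tau))}.
Proof.
move=> /andP[tau0 tauT] cf; apply: within_continuousW => e e0.
have [del del0 hdel] := within_unif_continuous cf e0.
have minT s : 0 <= s <= T -> 0 <= Num.min s tau <= T.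
  by move=> /andP[s0 sT]; rewrite le_min s0 tau0 ge_min sT.
exists del => // s t sT tT st; apply: hdel; [exact: minT..|].
apply: le_lt_trans st.
have [h1|h1] := leP t tau; have [h2|h2] := leP s tau => //.
- rewrite distrC ger0_norm ?subr_ge0// distrC ger0_norm; lra.
- rewrite ger0_norm ?subr_ge0// ger0_norm; lra.
- by rewrite subrr normr0.
Qed.

Local Notation coord := Defs.coord.

Section Localized.
Context (R : realType) (d : measure_display) (Omega : measurableType d)
  (P : probability Omega R) (T : R) (F : R -> set_system Omega) (N : nat).
Variables (X M A : R -> Omega -> 'rV[R]_N) (Q : R -> Omega -> 'M[R]_N).
Hypothesis hT : 0 < T.
Hypothesis hF : filtration T F.
Hypothesis hcan : forall i,
  canonical_decomposition P T F (coord X i) (coord M i) (coord A i).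
Hypothesis hbr : forall j k,
  bracket P T F (coord M j) (coord M k) (entry Q j k).

(** The local martingales at hand: the coordinates of [M] and the processes
    [M^j M^k - <M^j, M^k>]. *)
Definition locmart (a : 'I_N + 'I_N * 'I_N) : R -> Omega -> R :=
  match a with
  | inl j => coord M j
  | inr jk => fun t w => coord M jk.1 t w * coord M jk.2 t w
                         - entry Q jk.1 jk.2 t w
  end.

Lemma locmart_local a : local_martingale P T F (locmart a).
Proof.
case: a => [j|[j k]] /=; first by have [_ [_ + _] _ _] := hcan j.
by have [_ _ _ _] := hbr j k.
Qed.

Lemma locmart0 a w : locmart a 0 w = 0.
Proof.
case: a => [j|[j k]] /=; first by have [_ [_ _ +] _ _] := hcan j; apply.
have [_ [_ _ ->] _ _] := hcan j; have [_ _ _ -> _] := hbr j k.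
by rewrite mul0r subrr.
Qed.

Lemma M_paths j : continuous_paths T (coord M j).
Proof. by have [_ [+ _ _] _ _] := hcan j. Qed.

Lemma A_paths j : continuous_paths T (coord A j).
Proof. by have [_ _ [+ _ _ _] _] := hcan j. Qed.

Lemma Q_paths j k : continuous_paths T (entry Q j k).
Proof. by have [] := hbr j k. Qed.

Lemma locmart_paths a : continuous_paths T (locmart a).
Proof.
case: a => [j|[j k]] /=; first exact: M_paths.
move=> w; apply: within_continuousB; last exact: Q_paths.
by apply: within_continuousM; exact: M_paths.
Qed.

Lemma XE i t w : 0 <= t <= T -> X t w 0 i = X 0 w 0 i + M t w 0 i + A t w 0 i.
Proof. by have [_ _ _ +] := hcan i; apply. Qed.

Lemma X_paths j : continuous_paths T (coord X j).
Proof.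
move=> w; apply: within_continuousW => e e0.
have MA : {within `[0, T], continuous (fun t => M t w 0 j + A t w 0 j)}.
  by apply: within_continuousD; [exact: M_paths|exact: A_paths].
have [del del0 hdel] := within_unif_continuous MA e0.
exists del => // s t sT tT st; have := hdel s t sT tT st.
rewrite /Defs.coord (XE _ _ tT) (XE _ _ sT); congr (`|_| < _); ring.
Qed.

Section Stopped.
Variables (tau : 'I_N + 'I_N * 'I_N -> Omega -> R).
Hypothesis htau : forall a, stopping_time T F (tau a).

Definition stopped a : R -> Omega -> R :=
  fun t w => locmart a (Num.min t (tau a w)) w - locmart a 0 w.

Hypothesis mart_stopped : forall a, martingale P T F (stopped a).

Lemma stopped_paths a : continuous_paths T (stopped a).
Proof.
move=> w; have -> : (fun t => stopped a t w) =
    (fun t => locmart a (Num.min t (tau a w)) w).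
  by apply/funext => t; rewrite /stopped locmart0 subr0.
apply: (@continuous_stopped _ _ (fun t => locmart a t w)).
  by case: (htau a).
exact: locmart_paths.
Qed.

Lemma stoppedE a t w : t <= tau a w -> stopped a t w = locmart a t w.
Proof. by move=> tt; rewrite /stopped locmart0 subr0 min_l. Qed.

Local Notation gr := (grid T).

(** The localization looks at the points of the partition only, so that it is an
    event of the sigma-algebra of the [i]-th point. *)
Definition bounded_at (b : R) (m i : nat) (w : Omega) : Prop :=
  [/\ forall a, gr m i <= tau a w,
      forall j, `|M (gr m i) w 0 j| <= b,
      forall j, `|X (gr m i) w 0 j| <= b,
      forall jk : 'I_N * 'I_N, `|Q (gr m i) w jk.1 jk.2| <= b
    & \sum_(l < i) \sum_j `|A (gr m l.+1) w 0 j - A (gr m l) w 0 j| <= b].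

(** The step that ends at the [i]-th point; for [i = 0] the condition is empty. *)
Definition small_step (eps : R) (m i : nat) (w : Omega) : Prop :=
  forall j, `|M (gr m i) w 0 j - M (gr m i.-1) w 0 j| <= eps /\
            `|A (gr m i) w 0 j - A (gr m i.-1) w 0 j| <= eps.

Definition running (b eps : R) (m i : nat) : set Omega :=
  [set w | forall l, (l <= i)%N -> bounded_at b m l w /\ small_step eps m l w].

(** The steps of a continuous path are small along fine partitions; what remains
    of [running] are the bounds. *)
Definition tame (b : R) (m : nat) : set Omega :=
  [set w | forall l, (l <= m.+1)%N -> bounded_at b m l w].

Let sF t : 0 <= t <= T -> sigma_algebra setT (F t).
Proof. by case: hF => + _ _; exact. Qed.

Let mF t : 0 <= t <= T -> F t `<=` measurable.
Proof. by case: hF => _ + _; exact. Qed.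

Let FF m i l : (l <= i)%N -> (i <= m.+1)%N -> F (gr m l) `<=` F (gr m i).
Proof.
move=> li im; case: hF => _ _; apply; first exact: grid_ge0.
  exact: le_grid.
exact: grid_leT.
Qed.

Let fmeas_adapted Y m i l : adapted T F Y -> (l <= i)%N -> (i <= m.+1)%N ->
  fmeas (F (gr m i)) (Y (gr m l)).
Proof.
move=> aY li im; apply: (fmeas_le (FF li im)).
have lT := grid_itv hT (leq_trans li im).
by apply/fmeasP; [exact: sF|exact: aY].
Qed.

Lemma adaptedM j : adapted T F (coord M j).
Proof. by have [_ [_ [+ _] _] _ _] := hcan j. Qed.

Lemma adaptedA j : adapted T F (coord A j).
Proof. by have [_ _ [_ + _ _] _] := hcan j. Qed.

Lemma adaptedX j : adapted T F (coord X j).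
Proof. by have [] := hcan j. Qed.

Lemma adaptedQ j k : adapted T F (entry Q j k).
Proof. by have [] := hbr j k. Qed.

Lemma F_bounded_at b m i l : (l <= i)%N -> (i <= m.+1)%N ->
  F (gr m i) (bounded_at b m l).
Proof.
move=> li im; have iT := grid_itv hT im.
have lT := grid_itv hT (leq_trans li im).
have sS := sF iT.
have -> : bounded_at b m l = [set w | (forall a, gr m l <= tau a w) /\
   ((forall j, `|M (gr m l) w 0 j| <= b) /\
   ((forall j, `|X (gr m l) w 0 j| <= b) /\
   ((forall jk : 'I_N * 'I_N, `|Q (gr m l) w jk.1 jk.2| <= b) /\
   \sum_(i0 < l) \sum_j `|A (gr m i0.+1) w 0 j - A (gr m i0) w 0 j| <= b)))].
  by apply/seteqP; split => w [] // ? [? [? [? ?]]].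
apply: sigma_algebra_and => //.
  apply: sigma_algebra_forall => // a; apply: (FF li im).
  by apply: stopping_time_ge => //; case: hF.
apply: sigma_algebra_and => //.
  apply: sigma_algebra_forall => // j; apply: sigma_algebra_ler => //.
  by apply: fmeas_norm; exact: (fmeas_adapted (@adaptedM j)).
apply: sigma_algebra_and => //.
  apply: sigma_algebra_forall => // j; apply: sigma_algebra_ler => //.
  by apply: fmeas_norm; exact: (fmeas_adapted (@adaptedX j)).
apply: sigma_algebra_and => //.
  apply: sigma_algebra_forall => // -[j k]; apply: sigma_algebra_ler => //.
  by apply: fmeas_norm; exact: (fmeas_adapted (@adaptedQ j k)).
apply: sigma_algebra_ler => //.
apply: fmeas_sum => i0 _; apply: fmeas_sum => j _; apply: fmeas_norm.
apply: fmeasB; apply: (fmeas_adapted (@adaptedA j)) => //.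
  exact: leq_trans (ltn_ord i0) li.
exact: leq_trans (ltnW (ltn_ord i0)) li.
Qed.

Lemma F_small_step eps m i l : (l <= i)%N -> (i <= m.+1)%N ->
  F (gr m i) (small_step eps m l).
Proof.
move=> li im; have sS := sF (grid_itv hT im).
have li' : (l.-1 <= i)%N by exact: leq_trans (leq_pred _) li.
apply: sigma_algebra_forall => // j.
apply: sigma_algebra_and => //; apply: sigma_algebra_ler => //;
  apply: fmeas_norm; apply: fmeasB.
- exact: (fmeas_adapted (@adaptedM j)).
- exact: (fmeas_adapted (@adaptedM j)).
- exact: (fmeas_adapted (@adaptedA j)).
- exact: (fmeas_adapted (@adaptedA j)).
Qed.

Lemma F_running b eps m i : (i <= m.+1)%N -> F (gr m i) (running b eps m i).
Proof.
move=> im; have sS := sF (grid_itv hT im).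
apply: (sigma_algebra_forall sS
  (B := fun l => [set w | (l <= i)%N -> bounded_at b m l w /\
                                        small_step eps m l w])) => l.
apply: (sigma_algebra_imp sS (B := [set w | bounded_at b m l w /\
                                            small_step eps m l w])) => li.
by apply: sigma_algebra_and => //; [exact: F_bounded_at|exact: F_small_step].
Qed.

Lemma measurable_tame b m : measurable (tame b m).
Proof.
have TT : 0 <= gr m m.+1 <= T by exact: grid_itv.
apply: (mF TT); apply: (sigma_algebra_forall (sF TT)
  (B := fun l => [set w | (l <= m.+1)%N -> bounded_at b m l w])) => l.
apply: (sigma_algebra_imp (sF TT) (B := bounded_at b m l)) => lm.
exact: F_bounded_at.
Qed.

Lemma running_decr b eps m i : running b eps m i.+1 `<=` running b eps m i.
Proof. by move=> w h l li; apply: h; exact: leqW. Qed.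

Lemma stopped_bounded a b eps m i w : 0 <= b -> (i <= m.+1)%N ->
  running b eps m i w -> `|stopped a (gr m i) w| <= b * b + b.
Proof.
move=> b0 im /(_ i (leqnn i))[[h1 h2 _ h4 _] _].
rewrite stoppedE//; case: a => [j|[j k]] /=.
  by rewrite (le_trans (h2 j))// lerDr mulr_ge0.
rewrite (le_trans (ler_normB _ _))// lerD//; last exact: (h4 (j, k)).
by rewrite normrM ler_pM// h2.
Qed.

Lemma exit_jump_stopped a b eps : 0 <= b ->
  exit_jump P T (running b eps) (stopped a) @ \oo --> (0 : R).
Proof.
move=> b0; apply: (@exit_jump_cvg0 _ _ _ P T F hT hF _ _ _ _ (b * b + b)).
- exact: F_running.
- exact: running_decr.
- exact: mart_stopped.
- exact: stopped_paths.
- by move=> m i w; exact: stopped_bounded.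
Qed.

Section OccupationSum.
Variables (c C : R) (hC : 0 <= C).
Hypothesis hell : {ae P, forall w s t, 0 <= s -> s <= t -> t <= T ->
  (forall v : 'I_N -> R, c * (\sum_j v j ^+ 2) * (t - s) <=
     \sum_j \sum_k v j * v k * (Q t w j k - Q s w j k)) /\
  \sum_j (Q t w j j - Q s w j j) <= N%:R * C * (t - s)}.
Variables (h : 'rV[R]_N -> R) (p v : 'I_N -> 'rV[R]_N -> R).
Variables (Bh Pm kap e0 b : R).
Hypotheses (Pm0 : 0 <= Pm) (kap0 : 0 <= kap) (e00 : 0 < e0) (b0 : 0 <= b).
Hypothesis hh : forall x, 0 <= h x <= Bh.
Hypothesis mp : forall j, borel_fun (p j).
Hypothesis mv : forall j, borel_fun (v j).
Hypothesis hp : forall j x, `|p j x| <= Pm.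
Hypothesis hv : forall j x, `|v j x| <= 1.
Hypothesis hineq : forall x y : 'rV[R]_N,
  (forall j, `|x 0 j| <= b) -> (forall j, `|y 0 j - x 0 j| <= e0) ->
  h x + \sum_j p j x * (y 0 j - x 0 j)
  + 2^-1 * (\sum_j v j x * (y 0 j - x 0 j)) ^+ 2
  - kap * (\sum_j (y 0 j - x 0 j) ^+ 2) <= h y.

Let eps := e0 / 2.
Let E := running b eps.

(** Riemann sum, stopped at the exit from [running], for the integral of
    [|v (X t)|^2]. *)
Definition occ_sum m w : R := \sum_(i < m.+1) \1_(E m i.+1) w *
  ((\sum_j v j (X (gr m i) w) ^+ 2) * (T / m.+1%:R)).

(** The coefficients of the martingale increments in [taylor_step]; they are
    known at the beginning of the step. *)
Definition mart_coef m (a : 'I_N + 'I_N * 'I_N) i w : R :=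
  \1_(E m i) w * let q j k := qcoef (v ^~ (X (gr m i) w)) kap j k in
  match a with
  | inl j => p j (X (gr m i) w) - 2 * \sum_k q j k * M (gr m i) w 0 k
  | inr jk => q jk.1 jk.2
  end.

Definition mart_coef_bound : R :=
  Pm + 2 * (N%:R * ((2^-1 + 2 * kap) * b)) + (2^-1 + 2 * kap).

Definition occ_bound : R :=
  Bh + (Pm + (N%:R + 2 * kap) * eps) * b + 2 * kap * (N%:R * C * T).

Lemma mart_coef_bound_ge0 : 0 <= mart_coef_bound.
Proof. by rewrite /mart_coef_bound !(addr_ge0, mulr_ge0). Qed.

Lemma mart_coef_le m a i w : `|mart_coef m a i w| <= mart_coef_bound.
Proof.
have k0 : 0 <= 2^-1 + 2 * kap by rewrite addr_ge0// mulr_ge0.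
rewrite /mart_coef; have [Ew|Ew] := pselect (E m i w); last first.
  by rewrite indicE memNset// mul0r normr0 mart_coef_bound_ge0.
have [[_ Mb _ _ _] _] := Ew i (leqnn i).
rewrite indicE mem_set// mul1r; case: a => [j|[j k]] /=; last first.
  rewrite (le_trans (qcoef_bound kap0 (fun j => hv j _) _ _))//.
  by rewrite lerDr addr_ge0// !mulr_ge0.
rewrite (le_trans (ler_normB _ _))// /mart_coef_bound -[leLHS]addr0 lerD// lerD//.
rewrite normrM ger0_norm// ler_wpM2l//.
rewrite (le_trans (ler_norm_sum _ _ _))//.
apply: (@le_trans _ _ (\sum_(k < N) (2^-1 + 2 * kap) * b)).
  apply: ler_sum => k _; rewrite normrM ler_pM//.
  exact: (qcoef_bound kap0 (fun j => hv j _)).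
by rewrite sumr_const card_ord -[leLHS]mulr_natl.
Qed.

Let fmeasX f m i : borel_fun f -> (i <= m.+1)%N ->
  fmeas (F (gr m i)) (fun w => f (X (gr m i) w)).
Proof.
by move=> mf im; apply: fmeas_rV => // j; exact: (fmeas_adapted (@adaptedX j)).
Qed.

Lemma mart_coef_fmeas m a i : (i < m.+1)%N ->
  fmeas (F (gr m i)) (mart_coef m a i).
Proof.
move=> /ltnW im; apply: fmeasM.
  by apply: fmeas_indic; exact: F_running.
have mq j k : fmeas (F (gr m i))
    (fun w => qcoef (v ^~ (X (gr m i) w)) kap j k).
  apply: fmeasB; last exact: fmeas_cst.
  apply: fmeasM; first exact: fmeas_cst.
  by apply: fmeasM; exact: fmeasX.
case: a => [j|[j k]] //=.
apply: fmeasB; first exact: fmeasX.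
apply: fmeasM; first exact: fmeas_cst.
apply: fmeas_sum => k _; apply: fmeasM => //.
exact: (fmeas_adapted (@adaptedM k)).
Qed.

Definition mart_sum m w : R := \sum_a \sum_(i < m.+1) \1_(E m i.+1) w *
  (mart_coef m a i w * (stopped a (gr m i.+1) w - stopped a (gr m i) w)).

Let mE m i : (i <= m.+1)%N -> measurable (E m i).
Proof. by move=> im; apply: (mF (grid_itv hT im)); exact: F_running. Qed.

Let L1mart m a (i : 'I_m.+1) : L1 P (fun w => \1_(E m i.+1) w *
  (mart_coef m a i w * (stopped a (gr m i.+1) w - stopped a (gr m i) w))).
Proof.
have im := ltn_ord i.
apply: L1indicM; first exact: mE.
apply: (L1Mbounded _ (fun w => mart_coef_le m a i w)).
  apply: fmeas_measurable (mart_coef_fmeas a im).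
  by apply: mF; exact: (grid_itv hT (ltnW im)).
apply: L1B; apply: (martingale_L1 (mart_stopped a)).
  exact: grid_itv.
exact: (grid_itv hT (ltnW im)).
Qed.

Lemma L1_mart_sum m : L1 P (mart_sum m).
Proof. by apply: L1sum => a _; apply: L1sum => i _; exact: L1mart. Qed.

Lemma Ex_mart_sum m : - (mart_coef_bound *
  \sum_a exit_jump P T (running b eps) (stopped a) m) <= Ex P (mart_sum m).
Proof.
rewrite /mart_sum Ex_sum; last by move=> a _; apply: L1sum => i _; exact: L1mart.
rewrite mulr_sumr -sumrN; apply: ler_sum => a _.
apply: (exit_jump_bound hT hF _ _ (mart_stopped a)).
- by move=> m' i im; exact: F_running.
- by move=> m' i; exact: running_decr.
- exact: mart_coef_bound_ge0.
- by move=> i im; exact: mart_coef_fmeas.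
- by move=> i w im; exact: mart_coef_le.
Qed.

(** [taylor_step] along the path, with the ellipticity bounds for the increments
    of the brackets. *)
Lemma occ_step m i w : (i < m.+1)%N -> E m i.+1 w ->
  (forall u : 'I_N -> R, c * (\sum_j u j ^+ 2) * (T / m.+1%:R) <=
     \sum_j \sum_k u j * u k * (Q (gr m i.+1) w j k - Q (gr m i) w j k)) ->
  \sum_j (Q (gr m i.+1) w j j - Q (gr m i) w j j) <= N%:R * C * (T / m.+1%:R) ->
  2^-1 * c * ((\sum_j v j (X (gr m i) w) ^+ 2) * (T / m.+1%:R)) +
  \sum_a (mart_coef m a i w * (stopped a (gr m i.+1) w - stopped a (gr m i) w))
  <= h (X (gr m i.+1) w) - h (X (gr m i) w) +
     (Pm + (N%:R + 2 * kap) * eps) *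
        (\sum_j `|A (gr m i.+1) w 0 j - A (gr m i) w 0 j|) +
     2 * kap * (N%:R * C * (T / m.+1%:R)).
Proof.
move=> im E1 ell tr.
have E0 : E m i w by exact: running_decr E1.
have [[tau0 Mb Xb _ _] _] := E0 i (leqnn i).
have [[tau1 _ _ _ _] step1] := E1 i.+1 (leqnn _).
have sE a : stopped a (gr m i.+1) w - stopped a (gr m i) w =
    locmart a (gr m i.+1) w - locmart a (gr m i) w.
  by rewrite !stoppedE.
have iT := grid_itv hT (ltnW im); have i1T := grid_itv hT im.
have XD j : X (gr m i.+1) w 0 j - X (gr m i) w 0 j =
    (M (gr m i.+1) w 0 j - M (gr m i) w 0 j) +
    (A (gr m i.+1) w 0 j - A (gr m i) w 0 j).
  by rewrite (XE _ _ iT) (XE _ _ i1T); ring.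
have := @hineq (X (gr m i) w) (X (gr m i.+1) w) Xb.
move=> /(_ _)/wrap[].
  move=> j; rewrite XD (le_trans (ler_normD _ _))//.
  by have [h1 h2] := step1 j; rewrite [leRHS]splitr lerD.
under eq_bigr do rewrite XD.
under [X in _ + 2^-1 * X ^+ 2]eq_bigr do rewrite XD.
under [X in _ - kap * X]eq_bigr do rewrite XD.
pose dW j k := locmart (inr (j, k)) (gr m i.+1) w
               - locmart (inr (j, k)) (gr m i) w.
have := @taylor_step R N (p ^~ (X (gr m i) w)) (v ^~ (X (gr m i) w))
  (fun j => M (gr m i.+1) w 0 j - M (gr m i) w 0 j)
  (fun j => A (gr m i.+1) w 0 j - A (gr m i) w 0 j)
  (fun j => M (gr m i) w 0 j)
  (fun j k => Q (gr m i.+1) w j k - Q (gr m i) w j k)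
  dW kap eps Pm kap0 (fun j => hp j _) (fun j => hv j _)
  (fun j => (step1 j).1) (fun j => (step1 j).2).
move=> /(_ _)/wrap[].
  by move=> j k; rewrite /dW /= /Defs.coord /entry; ring.
have -> : \sum_a mart_coef m a i w *
    (stopped a (gr m i.+1) w - stopped a (gr m i) w) =
  \sum_j (p j (X (gr m i) w) - 2 * \sum_k qcoef (v ^~ (X (gr m i) w)) kap j k *
      M (gr m i) w 0 k) * (M (gr m i.+1) w 0 j - M (gr m i) w 0 j) +
  \sum_j \sum_k qcoef (v ^~ (X (gr m i) w)) kap j k * dW j k.
  rewrite big_sumType/=; congr (_ + _).
    apply: eq_bigr => j _; rewrite sE /mart_coef indicE mem_set// mul1r//.
  rewrite pair_bigA/=; apply: eq_bigr => -[j k] _.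
  by rewrite sE /mart_coef indicE mem_set// mul1r.
have := ell (v ^~ (X (gr m i) w)).
have := ler_wpM2l kap0 tr.
cbv beta; set dt := T / _.
lra.
Qed.

Lemma occ_sum_le m : {ae P, forall w,
  2^-1 * c * occ_sum m w + mart_sum m w <= occ_bound}.
Proof.
apply: filterS hell => w ell.
rewrite /mart_sum exchange_big/=.
rewrite /occ_sum mulr_sumr -big_split/=.
pose e i : bool := w \in E m i.
have eE i : \1_(E m i) w = (e i)%:R :> R by rewrite indicE.
have e1 i : e i.+1 -> e i.
  by rewrite /e => /set_mem/running_decr/mem_set.
pose dA i := \sum_j `|A (gr m i.+1) w 0 j - A (gr m i) w 0 j|.
have tel : \sum_(i < m.+1) (e i.+1)%:R *
    (h (X (gr m i.+1) w) - h (X (gr m i) w)) <= Bh.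
  apply: (telescope_stopped (I := fun i => (e i)%:R)
                            (h := fun i => h (X (gr m i) w))).
  - move=> i; rewrite ler0n/= ler_nat.
    by have := e1 i; case: (e i.+1) => // ->.
  - by case: (e 0%N); rewrite ?ler01.
  - by move=> i; exact: hh.
have varA : \sum_(i < m.+1) (e i.+1)%:R * dA i <= b.
  apply: sum_stopped => // i /set_mem/(_ i (leqnn i))[[_ _ _ _ + _]].
  exact.
have cst0 : 0 <= Pm + (N%:R + 2 * kap) * eps.
  by rewrite addr_ge0// mulr_ge0 ?addr_ge0// ?mulr_ge0// /eps ltW.
apply: (@le_trans _ _ (\sum_(i < m.+1) ((e i.+1)%:R *
    (h (X (gr m i.+1) w) - h (X (gr m i) w)) +
    (Pm + (N%:R + 2 * kap) * eps) * ((e i.+1)%:R * dA i) +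
    2 * kap * (N%:R * C * (T / m.+1%:R))))).
  apply: ler_sum => i _; have im := ltn_ord i.
  have [Ei|Ei] := boolP (e i.+1); last first.
    rewrite eE (negbTE Ei) mulr0n [X in _ + X <= _]big1; last first.
      by move=> a _; rewrite mul0r.
    rewrite !mul0r !mulr0 !add0r !mulr_ge0// ?invr_ge0//.
    exact: ltW.
  rewrite eE Ei mulr1n !mul1r.
  under [X in _ + X <= _]eq_bigr do rewrite mul1r.
  have [ell1 ell2] := ell (gr m i) (gr m i.+1) (grid_ge0 hT _ _)
    (le_grid hT m (leqnSn i)) (grid_leT hT im).
  apply: occ_step => //.
  - exact: set_mem Ei.
  - by move=> u; have := ell1 u; rewrite gridS.
  - by move: ell2; rewrite gridS.
rewrite !big_split/= /occ_bound; apply: lerD; first apply: lerD => //.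
  by rewrite -mulr_sumr ler_wpM2l.
rewrite sumr_const card_ord -mulr_natr.
rewrite le_eqVlt; apply/orP; left; apply/eqP; field.
by rewrite addrC natr1 pnatr_eq0.
Qed.

Lemma occ_sum_ge0 m w : 0 <= occ_sum m w.
Proof.
apply: sumr_ge0 => i _; rewrite !mulr_ge0//.
  by apply: sumr_ge0 => j _; exact: sqr_ge0.
exact: ltW.
Qed.

Lemma L1_occ_sum m : L1 P (occ_sum m).
Proof.
apply: L1sum => i _; have im := ltn_ord i.
apply: L1indicM; first exact: mE.
under eq_fun do rewrite mulr_suml.
apply: L1sum => j _.
apply: (@L1_bounded _ _ _ _ _ (T / m.+1%:R)).
  apply: measurable_funM => //; apply: measurable_funX.
  apply: fmeas_measurable (fmeasX (mv j) (ltnW im)).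
  by apply: mF; exact: (grid_itv hT (ltnW im)).
move=> w; rewrite normrM [`|T / _|]ger0_norm ?divr_ge0 ?(ltW hT)//.
rewrite ler_piMl ?divr_ge0 ?(ltW hT)// normrX.
by rewrite exprn_ile1.
Qed.

(** In mean the martingale terms only contribute through the exit step. *)
Lemma Ex_occ_sum m : 2^-1 * c * Ex P (occ_sum m) <= occ_bound +
  mart_coef_bound * \sum_a exit_jump P T (running b eps) (stopped a) m.
Proof.
rewrite -lerBlDr; apply: (@le_trans _ _
  (2^-1 * c * Ex P (occ_sum m) + Ex P (mart_sum m))).
  by rewrite lerD2l Ex_mart_sum.
have L1o := L1_occ_sum m; have L1s := L1_mart_sum m.
rewrite -ExZ// -ExD//; last exact: L1Z.
rewrite -(Ex_cst P occ_bound); apply: ae_le_Ex.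
- by apply: L1D => //; exact: L1Z.
- exact: L1cst.
exact: occ_sum_le.
Qed.

End OccupationSum.

End Stopped.
End Localized.

(** * Joint measurability of continuous processes *)

(** The projection on [0, T]: with it a path on [0, T] is extended to a
    continuous path on the line. *)
Definition clamp (R : realType) (T t : R) : R := Num.max 0 (Num.min t T).

Lemma clamp_id (R : realType) (T t : R) : 0 <= t <= T -> clamp T t = t.
Proof. by move=> /andP[t0 tT]; rewrite /clamp min_l// max_r. Qed.

Lemma clamp_itv (R : realType) (T t : R) : 0 <= T -> 0 <= clamp T t <= T.
Proof. by move=> T0; rewrite /clamp le_max lexx/= ge_max T0 ge_min lexx orbT. Qed.

Lemma clamp_lipschitz (R : realType) (T s t : R) :
  `|clamp T t - clamp T s| <= `|t - s|.
Proof.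
have h1 := ler_norm (t - s); have h2 := ler_norm (s - t).
rewrite distrC in h2; move: h1 h2; set e := `|t - s| => h1 h2.
rewrite ler_norml /clamp /Num.max /Num.min.
by case: (ltP t T) => ?; case: (ltP s T) => ?; case: ltP => ?; case: ltP => ?;
  apply/andP; split; lra.
Qed.

Lemma continuous_clamp (R : realType) (T : R) (f : R -> R) : 0 <= T ->
  {within `[0, T], continuous f} -> continuous (fun t => f (clamp T t)).
Proof.
move=> T0 cf t; apply/cvgrPdist_lt => e e0.
have [del del0 hdel] := within_unif_continuous cf e0.
apply/nbhs_ballP; exists del => // s /= ts.
apply: hdel; [exact: clamp_itv..|].
by rewrite (le_lt_trans (clamp_lipschitz _ _ _)).
Qed.

Lemma le_lebesgue (R : realType) (A B : set R) : measurable A -> measurable B ->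
  A `<=` B -> (lebesgue_measure A <= lebesgue_measure B)%E.
Proof. by move=> mA mB AB; apply: le_measure; rewrite ?inE. Qed.

Section JointMeasurable.
Context (R : realType) (d : measure_display) (Omega : measurableType d).

(** A process that is continuous in time is the limit of the processes that
    are constant on the intervals [[k / n, (k + 1) / n[]. *)
Lemma measurable_joint (Y : R -> Omega -> R) :
  (forall w, continuous (Y ^~ w)) -> (forall t, measurable_fun setT (Y t)) ->
  measurable_fun [set: R * Omega] (fun p => Y p.1 p.2).
Proof.
move=> cY mY.
pose h n (p : R * Omega) :=
  Y ((Num.floor (p.1 * n.+1%:R))%:~R / n.+1%:R) p.2.
apply: (@measurable_fun_cvg _ _ _ _ h) => [n _ B mB|[t w] _]; last first.
  have n0 n : 0 < n.+1%:R :> R by [].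
  apply: (@cvg_comp _ _ _ (fun n => (Num.floor (t * n.+1%:R))%:~R / n.+1%:R)
    (fun t => Y t w) \oo (nbhs t)); last exact: cY.
  apply/cvgrPdist_lt => e e0; have := @cvg_harmonic R.
  move=> /cvgrPdist_lt/(_ _ e0); apply: filterS => n.
  rewrite sub0r normrN /harmonic/= ger0_norm ?invr_ge0// => ne; apply: le_lt_trans ne => /=.
  have := floor_le (t * n.+1%:R); have := floorD1_gt (t * n.+1%:R).
  set z := (Num.floor _)%:~R => h1 h2.
  have h3 : z / n.+1%:R <= t by rewrite ler_pdivrMr.
  rewrite ger0_norm ?subr_ge0// lerBlDr -(ler_pM2r (n0 n)) mulrDl mulVf ?gt_eqF//.
  by rewrite divfK ?gt_eqF// addrC ltW// (lt_le_trans h1)// intrD.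
rewrite setTI.
have -> : h n @^-1` B = \bigcup_(k : int)
    (`[k%:~R / n.+1%:R, (k + 1)%:~R / n.+1%:R[%classic `*`
     (Y (k%:~R / n.+1%:R) @^-1` B)).
  have n0 : 0 < n.+1%:R :> R by [].
  apply/seteqP; split => -[t w] /=.
    move=> Bh; exists (Num.floor (t * n.+1%:R)) => //; split => //=.
    by rewrite in_itv/= ler_pdivrMr// ltr_pdivlMr// floor_le floorD1_gt.
  move=> [k _ [/=]]; rewrite in_itv/= ler_pdivrMr// ltr_pdivlMr// => kt.
  by rewrite /h /= (floor_def kt).
apply: countable_bigcupT_measurable; first exact: countableP.
move=> k; apply: measurableX; first exact: measurable_itv.
by rewrite -[X in measurable X]setTI; exact: mY.
Qed.

End JointMeasurable.

Section Occupation.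
Context (R : realType) (d : measure_display) (Omega : measurableType d)
  (P : probability Omega R) (T : R) (F : R -> set_system Omega) (N : nat).
Variables (X : R -> Omega -> 'rV[R]_N).
Hypothesis hT : 0 < T.
Hypothesis hF : filtration T F.
Hypothesis cX : forall i, continuous_paths T (coord X i).
Hypothesis aX : forall i, adapted T F (coord X i).

Definition clamped (t : R) (w : Omega) : 'rV[R]_N := X (clamp T t) w.

Lemma measurable_clamped :
  measurable_fun [set: R * Omega]
    ((fun p => clamped p.1 p.2) : R * Omega -> borelV R N).
Proof.
apply: measurable_rV => i.
apply: (@measurable_joint _ _ _ (fun t w => X (clamp T t) w 0 i)).
  move=> w; apply: (@continuous_clamp _ T (fun t => X t w 0 i)); first exact: ltW.
  exact: cX.
move=> t; have tT := clamp_itv t (ltW hT).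
apply: (@fmeas_measurable _ _ _ (F (clamp T t))).
  by case: hF => _ + _; exact.
apply/fmeasP; first by case: hF => + _ _; exact.
exact: aX.
Qed.

Definition occ (S : set 'rV[R]_N) (w : Omega) : \bar R :=
  lebesgue_measure (`[0, T]%classic `&` [set t | S (clamped t w)]).

Lemma measurable_occ_graph (S : set (borelV R N)) : measurable S ->
  measurable [set p : R * Omega | 0 <= p.1 <= T /\ S (clamped p.1 p.2)].
Proof.
move=> mS.
have -> : [set p : R * Omega | 0 <= p.1 <= T /\ S (clamped p.1 p.2)] =
    (`[0, T]%classic `*` setT) `&`
    ((fun p => clamped p.1 p.2) @^-1` S).
  by apply/seteqP; split => -[t w] /=; rewrite in_itv/= => -[]// [].
apply: measurableI; first by apply: measurableX => //; exact: measurable_itv.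
by rewrite -[X in measurable X]setTI; exact: measurable_clamped.
Qed.

Lemma occE S w : occ S w = lebesgue_measure
  (ysection [set p : R * Omega | 0 <= p.1 <= T /\ S (clamped p.1 p.2)] w).
Proof.
congr (lebesgue_measure _); apply/seteqP; split => t /=.
  by rewrite in_itv/= /ysection/= => -[tT St]; rewrite inE.
by rewrite /ysection/= inE/= in_itv.
Qed.

Lemma measurable_fun_occ (S : set (borelV R N)) : measurable S ->
  measurable_fun setT (occ S).
Proof.
move=> mS; rewrite (_ : occ S = fun w => lebesgue_measure (ysection
    [set p : R * Omega | 0 <= p.1 <= T /\ S (clamped p.1 p.2)] w)).
  by apply: measurable_fun_ysection; exact: measurable_occ_graph.
by apply/funext => w; exact: occE.
Qed.

Lemma measurable_time (S : set (borelV R N)) w : measurable S ->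
  measurable [set t | S (clamped t w)].
Proof.
move=> mS; have := measurable_clamped measurableT mS; rewrite setTI => mg.
rewrite (_ : [set t | _] =
  ysection ((fun p => clamped p.1 p.2) @^-1` S) w).
  exact: measurable_ysection.
by apply/seteqP; split => t /=; rewrite /ysection /= inE.
Qed.

Lemma occ_leT (S : set (borelV R N)) w : measurable S -> (occ S w <= T%:E)%E.
Proof.
move=> mS; apply: (@le_trans _ _ (lebesgue_measure `[0, T]%classic)).
  apply: le_lebesgue => //.
  by apply: measurableI; [exact: measurable_itv|exact: measurable_time].
by rewrite lebesgue_measure_itv/= lte_fin hT sube0.
Qed.

Lemma occ_ge0 S w : (0 <= occ S w)%E.
Proof. exact: measure_ge0. Qed.

Lemma occ_fin (S : set (borelV R N)) w : measurable S ->
  occ S w = (fine (occ S w))%:E.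
Proof.
move=> mS; rewrite fineK// ge0_fin_numE ?occ_ge0//.
by rewrite (le_lt_trans (occ_leT w mS))// ltry.
Qed.

(** The intervals of the partition where [a i] is at least 1 cover the time that
    the path spends in [S]. *)
Lemma occ_le_sum (S : set (borelV R N)) (w : Omega) (m : nat) (a : nat -> R) :
  measurable S -> (forall i, (i < m.+1)%N -> 0 <= a i) ->
  (forall i t, (i < m.+1)%N -> grid T m i <= t <= grid T m i.+1 ->
     S (X t w) -> 1 <= a i) ->
  (occ S w <= (\sum_(i < m.+1) a i * (T / m.+1%:R))%:E)%E.
Proof.
move=> mS a0 ha.
pose B t0 t1 := `[t0, t1]%classic `&` [set t | S (clamped t w)].
have mB t0 t1 : measurable (B t0 t1).
  by apply: measurableI; [exact: measurable_itv|exact: measurable_time].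
have T0 := ltW hT.
suff H n : (n <= m.+1)%N -> (lebesgue_measure (B 0%R (grid T m n)) <=
    (\sum_(i < n) a i * (T / m.+1%:R))%:E)%E.
  by have := H m.+1 (leqnn _); rewrite gridT.
elim: n => [_|n ih nm].
  rewrite big_ord0 grid0.
  apply: (@le_trans _ _ (lebesgue_measure [set 0 : R])); last first.
    by rewrite lebesgue_measure_set1.
  apply: le_lebesgue => //.
  by move=> t []/=; rewrite in_itv/= => /andP[t0 t1] _; apply/le_anti/andP.
rewrite big_ord_recr/= EFinD.
apply: (@le_trans _ _ (lebesgue_measure (B 0%R (grid T m n) `|`
    B (grid T m n) (grid T m n.+1)))).
  apply: le_lebesgue => //; first exact: measurableU.
  move=> t [/= tn St]; move: tn; rewrite in_itv/= => /andP[t0 tn].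
  have [tn'|tn'] := leP t (grid T m n).
    by left; split => //=; rewrite in_itv/= t0.
  by right; split => //=; rewrite in_itv/= ltW.
apply: (@le_trans _ _ (lebesgue_measure (B 0%R (grid T m n)) +
    lebesgue_measure (B (grid T m n) (grid T m n.+1)))%E).
  apply: measureU2; exact: mB.
apply: leeD; first exact/ih/ltnW.
have := ha n; have := a0 n nm.
have [[t [/= tn St]]|Bn] := pselect (exists t, B (grid T m n) (grid T m n.+1) t).
  move: tn; rewrite in_itv/= => tn an /(_ t nm tn) an1.
  have tT : 0 <= t <= T.
    case/andP: tn => t0 t1.
    by rewrite (le_trans _ t0) ?grid_ge0//= (le_trans t1)// grid_leT.
  rewrite /clamped clamp_id// in St; have {}an1 := an1 St.
  apply: (@le_trans _ _ (lebesgue_measure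
      `[grid T m n, grid T m n.+1]%classic)).
    by apply: le_lebesgue => // ? [].
  rewrite lebesgue_measure_itv/= lte_fin -subr_gt0 gridS divr_gt0//.
  by rewrite lee_fin gridS ler_peMl// divr_ge0.
move=> an _; rewrite (_ : B _ _ = set0).
  by rewrite measure0 lee_fin mulr_ge0// divr_ge0.
by apply/seteqP; split => // t Bt; apply: Bn; exists t.
Qed.

End Occupation.

(** * Test functions and the time spent in a set *)

(** A test function for the occupation of [S] by a process that stays in the
    box of radius [b]: [h] has at each point a quadratic minorant, with
    gradient [p] and with Hessian [v^T v - 2 kap I], which is valid up to
    distance [e0], and [v] has norm at least 1 near [S]. *)
Definition occ_test (R : realType) (N : nat) (b : R) (S : set 'rV[R]_N)
    (h : 'rV[R]_N -> R) (p v : 'I_N -> 'rV[R]_N -> R) (Bh Pm kap e0 : R) :=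
  [/\ forall x, 0 <= h x <= Bh,
      forall j, borel_fun (p j) /\ borel_fun (v j),
      forall j x, `|p j x| <= Pm /\ `|v j x| <= 1,
      forall x y : 'rV[R]_N,
        (forall j, `|x 0 j| <= b) -> (forall j, `|y 0 j - x 0 j| <= e0) ->
        h x + \sum_j p j x * (y 0 j - x 0 j)
        + 2^-1 * (\sum_j v j x * (y 0 j - x 0 j)) ^+ 2
        - kap * (\sum_j (y 0 j - x 0 j) ^+ 2) <= h y
    & forall x y : 'rV[R]_N,
        (forall j, `|x 0 j| <= b) -> (forall j, `|y 0 j - x 0 j| <= e0) ->
        S y -> 1 <= \sum_j v j x ^+ 2].

Section OccupationBound.
Context (R : realType) (d : measure_display) (Omega : measurableType d)
  (P : probability Omega R) (T : R) (F : R -> set_system Omega) (N : nat).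
Variables (X M A : R -> Omega -> 'rV[R]_N) (Q : R -> Omega -> 'M[R]_N).
Hypothesis hT : 0 < T.
Hypothesis hF : filtration T F.
Hypothesis hcan : forall i,
  canonical_decomposition P T F (coord X i) (coord M i) (coord A i).
Hypothesis hbr : forall j k,
  bracket P T F (coord M j) (coord M k) (entry Q j k).
Variables (tau : 'I_N + 'I_N * 'I_N -> Omega -> R).
Hypothesis htau : forall a, stopping_time T F (tau a).
Hypothesis mart_stopped : forall a, martingale P T F (stopped M Q tau a).
Variables (c C : R) (hc : 0 < c) (hC : 0 <= C).
Hypothesis hell : {ae P, forall w s t, 0 <= s -> s <= t -> t <= T ->
  (forall v : 'I_N -> R, c * (\sum_j v j ^+ 2) * (t - s) <=
     \sum_j \sum_k v j * v k * (Q t w j k - Q s w j k)) /\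
  \sum_j (Q t w j j - Q s w j j) <= N%:R * C * (t - s)}.

Local Notation tameT := (tame T X M A Q tau).

(** A fixed path satisfies the bounds along all fine partitions as soon as its
    supremum and its variation are small enough, see [good_exhausts]. *)
Definition good (b : R) : set Omega :=
  \bigcup_m0 \bigcap_(m in [set m | (m0 <= m)%N]) tameT b m.

Lemma measurable_good b : measurable (good b).
Proof.
apply: bigcup_measurable => m0 _; apply: bigcap_measurable => [|m _].
  by exists m0 => /=.
exact: (measurable_tame hT hF hcan hbr htau).
Qed.

Let cX i : continuous_paths T (coord X i).
Proof. exact: (X_paths hcan). Qed.

Let aX i : adapted T F (coord X i).
Proof. exact: (adaptedX hcan). Qed.

(** Along a fine partition, if [X t] is in [S] then the left end of the step that
    contains [t] is within [e0] of [S]. *)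
Lemma good_occ_le (b e0 : R) (v : 'I_N -> 'rV[R]_N -> R) (S : set (borelV R N)) w :
  0 < e0 -> measurable S ->
  (forall x y : 'rV[R]_N, (forall j, `|x 0 j| <= b) ->
    (forall j, `|y 0 j - x 0 j| <= e0) -> S y -> 1 <= \sum_j v j x ^+ 2) ->
  good b w -> \forall m \near \oo,
    (occ T X S w <= (occ_sum T X M A Q tau v e0 b m w)%:E)%E.
Proof.
move=> e00 mS hS [m0 _ hm0].
have e20 : 0 < e0 / 2 by exact: divr_gt0.
have osc (Y : R -> Omega -> 'rV[R]_N) : (forall j, continuous_paths T (coord Y j)) ->
    forall e : R, 0 < e -> \forall m \near \oo, forall i s, (i < m.+1)%N ->
    grid T m i <= s <= grid T m i.+1 ->
    forall j, `|Y s w 0 j - Y (grid T m i) w 0 j| <= e.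
  move=> cY e e0'.
  have : \forall m \near \oo, forall j i s, (i < m.+1)%N ->
      grid T m i <= s <= grid T m i.+1 ->
      `|Y s w 0 j - Y (grid T m i) w 0 j| <= e.
    apply: filter_forall => j.
    have cw : {within `[0, T], continuous (fun t => Y t w 0 j)} by exact: cY.
    have := grid_osc hT cw e0'; apply: filterS => m hm i s im ist.
    by apply/ltW/hm.
  by apply: filterS => m hm i s im ist j; exact: hm.
have cM j : continuous_paths T (coord M j) by exact: (M_paths hcan).
have cA j : continuous_paths T (coord A j) by exact: (A_paths hcan).
have oM := osc M cM _ e20.
have oA := osc A cA _ e20.
have oX := osc X cX _ e00.
have m0m : \forall m \near \oo, (m0 <= m)%N by exact: nbhs_infty_ge.
near=> m.
have tm : tameT b m w by apply: hm0 => /=; near: m.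
have hM : forall i s, (i < m.+1)%N -> grid T m i <= s <= grid T m i.+1 ->
  forall j, `|M s w 0 j - M (grid T m i) w 0 j| <= e0 / 2 by near: m.
have hA : forall i s, (i < m.+1)%N -> grid T m i <= s <= grid T m i.+1 ->
  forall j, `|A s w 0 j - A (grid T m i) w 0 j| <= e0 / 2 by near: m.
have hX : forall i s, (i < m.+1)%N -> grid T m i <= s <= grid T m i.+1 ->
  forall j, `|X s w 0 j - X (grid T m i) w 0 j| <= e0 by near: m.
have run i : (i <= m.+1)%N -> running T X M A Q tau b (e0 / 2) m i w.
  move=> im l li; have lm := leq_trans li im.
  split; first exact: tm.
  case: l li lm => [_ _|l li lm] j /=.
    by rewrite !subrr normr0 ltW.
  have ll : grid T m l <= grid T m l.+1 <= grid T m l.+1.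
    by rewrite lexx andbT le_grid.
  by split; [exact: hM|exact: hA].
apply: (le_trans (occ_le_sum hT hF cX aX mS
  (a := fun i => \sum_j v j (X (grid T m i) w) ^+ 2) _ _)).
- by move=> i _; apply: sumr_ge0 => j _; exact: sqr_ge0.
- move=> i t im it St; apply: (hS _ (X t w)) => //.
    have [_ _ + _ _] := tm i (ltnW im); exact.
  exact: hX.
rewrite lee_fin /occ_sum; apply: ler_sum => i _.
by rewrite indicE mem_set ?mul1r//; exact: run.
Unshelve. all: by end_near.
Qed.

(** The limit of [Ex_occ_sum] as the mesh tends to 0: the overshoots vanish. *)
Lemma occ_test_bound (b : R) (S : set (borelV R N)) h p v (Bh Pm kap e0 : R) :
  0 <= b -> 0 <= Pm -> 0 <= kap -> 0 < e0 -> measurable S ->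
  occ_test b S h p v Bh Pm kap e0 ->
  Ex P (fun w => \1_(good b) w * fine (occ T X S w)) <=
  2 / c * (Bh + (Pm + (N%:R + 2 * kap) * (e0 / 2)) * b
           + 2 * kap * (N%:R * C * T)).
Proof.
move=> b0 Pm0 kap0 e00 mS [hh mpv hpv hineq hS].
pose os := occ_sum T X M A Q tau v e0 b.
have mgood := measurable_good b.
have L1os m : L1 P (os m).
  by apply: (L1_occ_sum hT hF hcan hbr htau) => j; [case: (mpv j)|move=> x; case: (hpv j x)].
have os0 m w : 0 <= os m w by exact: occ_sum_ge0.
pose D w := fine (occ T X S w).
have D0 w : 0 <= D w by apply: fine_ge0; exact: occ_ge0.
have mD : measurable_fun setT D.
  apply: measurableT_comp => //.
  exact: (measurable_fun_occ hT hF cX aX mS).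
have DT w : D w <= T.
  by rewrite -lee_fin -(occ_fin hT hF cX aX)// (occ_leT hT hF cX aX).
pose f m w := \1_(good b) w * Num.min (D w) (os m w).
have mf m : measurable_fun setT (f m).
  apply: measurable_funM; first exact: measurable_indic.
  by apply: measurable_minr => //; exact: L1_measurable (L1os m).
have fT m w : `|f m w| <= T.
  rewrite normrM ger0_norm ?indicE// ger0_norm; last by rewrite le_min D0 os0.
  rewrite (le_trans _ (DT w))// (@le_trans _ _ (Num.min (D w) (os m w)))//.
    by rewrite ler_piMl// ?le_min ?D0 ?os0//; case: (_ \in _).
  by rewrite ge_min lexx.
have cvf : (fun m => Ex P (f m)) @ \oo --> Ex P (fun w => \1_(good b) w * D w).
  apply: (Ex_dominated (g := fun=> T)) => //.
  - by apply: measurable_funM => //; exact: measurable_indic.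
  - exact: L1cst.
  move=> w; apply: cvg_near_cst.
  have [gw|gw] := pselect (good b w); last first.
    by near=> m; rewrite /f indicE memNset// !mul0r.
  have := good_occ_le e00 mS hS gw; apply: filterS => m.
  rewrite (occ_fin hT hF cX aX)// lee_fin -/(D w) => hm.
  by rewrite /f min_l.
pose K := mart_coef_bound N Pm kap b.
pose ej m := \sum_a exit_jump P T (running T X M A Q tau b (e0 / 2))
  (stopped M Q tau a) m.
have cvej : ej @ \oo --> (0 : R).
  rewrite [X in _ --> X](_ : 0 = \sum_(a : 'I_N + 'I_N * 'I_N) 0); last first.
    by rewrite big1.
  apply: cvg_big => [|a _]; first exact: add_continuous.
  exact: (exit_jump_stopped hT hF hcan hbr htau mart_stopped).
have fle m : Ex P (f m) <=
    2 / c * (occ_bound T N C Bh Pm kap e0 b + K * ej m).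
  apply: (@le_trans _ _ (Ex P (os m))).
    apply: le_Ex => //; first exact: L1_bounded (mf m) (fT m).
    move=> w; rewrite /f (@le_trans _ _ (Num.min (D w) (os m w)))//.
      apply: ler_piMl; first by rewrite le_min D0 os0.
      by rewrite indicE; case: (_ \in _); rewrite ?ler01.
    by rewrite ge_min lexx orbT.
  have c2 : 0 < 2 / c by rewrite divr_gt0.
  have -> : Ex P (os m) = 2 / c * (2^-1 * c * Ex P (os m)).
    by field; rewrite gt_eqF.
  rewrite ler_pM2l// /ej /K /os.
  apply: (Ex_occ_sum hT hF hcan hbr htau mart_stopped hC hell Pm0 kap0 e00 b0
    hh _ _ _ _ hineq m).
  - by move=> j; case: (mpv j).
  - by move=> j; case: (mpv j).
  - by move=> j x; case: (hpv j x).
  - by move=> j x; case: (hpv j x).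
have cvR : (fun m => 2 / c * (occ_bound T N C Bh Pm kap e0 b + K * ej m)) @ \oo
    --> 2 / c * (occ_bound T N C Bh Pm kap e0 b + K * 0).
  by apply: cvgMl_tmp; apply: cvgD; [exact: cvg_cst|exact: cvgMl_tmp].
rewrite mulr0 addr0 in cvR.
apply: ler_cvg_to cvf cvR _; exact: nearW.
Unshelve. all: by end_near.
Qed.

End OccupationBound.

(** * Brackets with an elliptic density *)

Section AeSections.
Context (R : realType) (d1 d2 : measure_display) (T1 : measurableType d1)
  (T2 : measurableType d2) (m1 : {sigma_finite_measure set T1 -> \bar R})
  (m2 : {sigma_finite_measure set T2 -> \bar R}).

Lemma ae_sections (K : T1 * T2 -> Prop) :
  {ae (m1 \x m2)%E, forall p, K p} ->
  {ae m2, forall y, {ae m1, forall x, K (x, y)}}.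
Proof.
move=> [A [mA A0 KA]].
have G0 : (\int[m2]_y m1 (ysection A y) = 0)%E.
  have := @fubini_tonelli2 _ _ _ _ _ m1 m2 (EFin \o \1_A).
  move=> /(_ _ _)/wrap[].
  - by apply/measurable_EFinP; exact: measurable_indic.
  - by move=> x; rewrite /= lee_fin indicE.
  move=> fub; transitivity (\int[(m1 \x m2)%E]_z (EFin \o \1_A) z)%E; last first.
    by rewrite [LHS](integral_indic _ measurableT mA) setIT.
  rewrite fub; apply: eq_integral => y _.
  have mAy := measurable_ysection y mA.
  have := integral_indic m1 measurableT mAy; rewrite setIT => <-.
  by apply: eq_integral => x _; rewrite /= !indicE mem_ysection.
have mG : measurable_fun setT (fun y => m1 (ysection A y)).
  exact: measurable_fun_ysection.
have : ae_eq m2 setT (fun y => m1 (ysection A y)) (cst 0%E).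
  apply/ae_eq_integral_abs => //.
  by rewrite -[RHS]G0; apply: eq_integral => y _; rewrite gee0_abs.
apply: filterS => y /(_ I) /= Ay.
exists (ysection A y); split => //; first exact: measurable_ysection.
by move=> x /= nK; rewrite /ysection/=; apply/mem_set/KA.
Qed.

End AeSections.

Lemma Rintegral_sum (R : realType) (d : measure_display) (U : measurableType d)
  (mu : {measure set U -> \bar R}) (D : set U) (I : Type) (s : seq I)
  (h : I -> U -> R) : measurable D ->
  (forall i, mu.-integrable D (EFin \o h i)) ->
  mu.-integrable D (EFin \o (fun x => \sum_(i <- s) h i x)) /\
  \int[mu]_(x in D) (\sum_(i <- s) h i x) = \sum_(i <- s) \int[mu]_(x in D) h i x.
Proof.
move=> mD ih; elim: s => [|i s [IH1 IH2]].
  rewrite big_nil; split.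
    apply: (eq_integrable mD (cst 0%E)); last exact: integrable0.
    by move=> x _; rewrite /= big_nil.
  under eq_Rintegral do rewrite big_nil.
  by rewrite /Rintegral integral0.
split.
  rewrite (_ : _ \o _ =
    ((EFin \o h i) \+ (EFin \o (fun x => (\sum_(j <- s) h j x)%R)))%E).
    exact: integrableD.
  by apply/funext => x; rewrite /= big_cons.
rewrite big_cons -IH2 -RintegralD//.
by apply: eq_Rintegral => x _; rewrite big_cons.
Qed.

Lemma ae_Rintegral_ge0 (R : realType) (d : measure_display)
  (U : measurableType d) (mu : {measure set U -> \bar R}) (D : set U)
  (h : U -> R) : measurable D -> mu.-integrable D (EFin \o h) ->
  {ae mu, forall x, D x -> 0 <= h x} -> 0 <= \int[mu]_(x in D) h x.
Proof.
move=> mD ih h0; rewrite /Rintegral.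
have -> : (\int[mu]_(x in D) (h x)%:E = \int[mu]_(x in D) `|h x|%:E)%E.
  apply: ae_eq_integral => //.
  - exact: measurable_int ih.
  - by have := integrable_norm ih => /measurable_int.
  - by apply: filterS h0 => x h0 Dx; rewrite ger0_norm// h0.
by apply: fine_ge0; apply: integral_ge0 => x _; rewrite lee_fin.
Qed.

Lemma ae_lebesgueW (R : realType) (K K' : R -> Prop) :
  {ae lebesgue_measure, forall x, K x} -> (forall x, K x -> K' x) ->
  {ae lebesgue_measure, forall x, K' x}.
Proof.
by move=> [A [mA A0 KA]] h; exists A; split=> // x /= nK'; apply: KA => /h.
Qed.

Lemma lebesgue_measure_oc (R : realType) (s t : R) : s <= t ->
  lebesgue_measure `]s, t]%classic = (t - s)%:E.
Proof.
rewrite lebesgue_measure_itv/= lte_fin le_eqVlt => /predU1P[->|->//].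
by rewrite ltxx subrr.
Qed.

Section Ellipticity.
Context (R : realType) (N : nat).
Implicit Types (g : 'M[R]_N) (u : 'I_N -> R).

Lemma quad_formE g u : ((\row_j u j) *m g *m (\row_j u j)^T) 0 0 =
  \sum_j \sum_k u j * u k * g j k.
Proof.
rewrite mxE exchange_big/=; apply: eq_bigr => k _.
rewrite !mxE mulr_suml; apply: eq_bigr => j _; rewrite mxE; ring.
Qed.

Lemma quad_form_scalar (c : R) u :
  ((\row_j u j) *m c%:M *m (\row_j u j)^T) 0 0 = c * \sum_j u j ^+ 2.
Proof.
rewrite mul_mx_scalar -scalemxAl !mxE; congr (_ * _).
by apply: eq_bigr => j _; rewrite !mxE expr2.
Qed.

Lemma loewner_le_lower (c : R) g u : loewner_le c%:M g ->
  c * \sum_j u j ^+ 2 <= \sum_j \sum_k u j * u k * g j k.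
Proof. by move=> /(_ (\row_j u j)); rewrite quad_form_scalar quad_formE. Qed.

Lemma loewner_le_diag (C : R) g j : loewner_le g C%:M -> g j j <= C.
Proof.
move=> /(_ (\row_k (k == j)%:R)); rewrite quad_form_scalar quad_formE.
have -> : \sum_k (k == j)%:R ^+ 2 = 1 :> R.
  rewrite (bigD1 j)//= eqxx expr1n big1 ?addr0// => k kj.
  by rewrite (negbTE kj) expr0n.
have -> : \sum_j0 \sum_k (j0 == j)%:R * (k == j)%:R * g j0 k = g j j.
  rewrite (bigD1 j)//= eqxx [X in _ + X]big1 ?addr0; last first.
    move=> k kj; rewrite (negbTE kj); apply: big1 => l _.
    by rewrite !mul0r.
  rewrite (bigD1 j)//= eqxx !mul1r big1 ?addr0// => k kj.
  by rewrite (negbTE kj) mulr0 mul0r.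
by rewrite mulr1.
Qed.

Variables (T c C : R) (g : R -> 'M[R]_N) (Q : R -> 'M[R]_N).
Local Notation leb := (@lebesgue_measure R).
Hypothesis ig : forall j k,
  leb.-integrable `[0, T] (fun s => (g s j k)%:E).
Hypothesis QE : forall j k t, 0 <= t <= T ->
  Q t j k = \int[leb]_(s in `[0, t]) g s j k.
Hypothesis ell : {ae leb, forall t, 0 <= t <= T ->
  loewner_le c%:M (g t) /\ loewner_le (g t) C%:M}.

(** Integration of the lower bound over the interval between [s] and [t]. *)
Lemma bracket_increment (s t : R) (u : 'I_N -> 'I_N -> R) (K : R) :
  0 <= s -> s <= t -> t <= T ->
  {ae leb, forall r, 0 <= r <= T -> K <= \sum_j \sum_k u j k * g r j k} ->
  K * (t - s) <= \sum_j \sum_k u j k * (Q t j k - Q s j k).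
Proof.
move=> s0 st tT hK.
have sub : `]s, t]%classic `<=` `[0, T]%classic.
  move=> r /=; rewrite !in_itv/= => /andP[sr rt].
  by rewrite (le_trans s0 (ltW sr)) (le_trans rt).
have QD j k : Q t j k - Q s j k = \int[leb]_(r in `]s, t]) g r j k.
  rewrite !QE ?(le_trans s0 st)//; last by rewrite s0 (le_trans st).
  rewrite (@Rintegral_itvB _ (fun r => g r j k) (BLeft 0) (BRight t) s)
    ?bnd_simp//.
  apply: integrableS (ig j k) => //.
  by apply: subset_itvl; rewrite bnd_simp.
have mst : measurable `]s, t]%classic by exact: measurable_itv.
have igst j k : leb.-integrable `]s, t] (EFin \o (fun r => u j k * g r j k)).
  rewrite (_ : _ \o _ = (fun r => (u j k)%:E * (g r j k)%:E)%E).
    by apply: integrableZl => //; apply: integrableS (ig j k).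
  by apply/funext => r; rewrite /= EFinM.
have RS := @Rintegral_sum R _ _ leb `]s, t]%classic 'I_N (index_enum 'I_N).
have [i1 e1] := RS _ mst (fun j => (RS _ mst (igst j)).1).
have -> : \sum_j \sum_k u j k * (Q t j k - Q s j k) =
    \int[leb]_(r in `]s, t]) (\sum_j \sum_k u j k * g r j k).
  rewrite e1; apply: eq_bigr => j _.
  rewrite (RS _ mst (igst j)).2.
  apply: eq_bigr => k _; rewrite QD RintegralZl//.
  exact: integrableS (ig j k).
have icst : leb.-integrable `]s, t] (EFin \o (fun=> K)).
  apply: measurable_bounded_integrable => //.
    apply: (@le_lt_trans _ _ (t - s)%:E); last exact: ltry.
    by rewrite -(lebesgue_measure_oc st).
  by exists `|K|; split; [exact: num_real|move=> x Kx r _ /=; exact: ltW].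
have -> : K * (t - s) = \int[leb]_(r in `]s, t]) K.
  rewrite Rintegral_cst//; congr (_ * _).
  by rewrite -[LHS]/(fine (t - s)%:E) -(lebesgue_measure_oc st).
rewrite -subr_ge0 -RintegralB//; apply: ae_Rintegral_ge0 => //.
  rewrite (_ : _ \o _ = ((EFin \o (fun r => (\sum_j \sum_k u j k * g r j k)%R))
    \- (EFin \o (fun=> K)))%E); last by apply/funext.
  apply: integrableB => //.
apply: (ae_lebesgueW hK) => r hr /sub/=; rewrite in_itv/= => /hr.
by rewrite subr_ge0.
Qed.

Lemma bracket_elliptic (s t : R) : 0 <= s -> s <= t -> t <= T ->
  (forall u, c * (\sum_j u j ^+ 2) * (t - s) <=
     \sum_j \sum_k u j * u k * (Q t j k - Q s j k)) /\
  \sum_j (Q t j j - Q s j j) <= N%:R * C * (t - s).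
Proof.
move=> s0 st tT; split => [u|].
  apply: bracket_increment => //; apply: (ae_lebesgueW ell) => r h /h[h1 _].
  exact: loewner_le_lower.
have h : - (N%:R * C) * (t - s) <=
    \sum_j \sum_k (- (j == k)%:R) * (Q t j k - Q s j k).
  apply: bracket_increment => //; apply: (ae_lebesgueW ell) => r h /h[_ h2].
  rewrite lerNl -sumrN.
  apply: (@le_trans _ _ (\sum_(j < N) C)); last first.
    by rewrite sumr_const card_ord mulr_natl.
  apply: ler_sum => j _; rewrite (bigD1 j)//= eqxx big1.
    by rewrite addr0 mulN1r opprK; exact: loewner_le_diag.
  by move=> k kj; rewrite eq_sym (negbTE kj) mulr0n oppr0 mul0r.
rewrite -lerN2 -mulNr (le_trans h)// le_eqVlt; apply/orP; left; apply/eqP.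
rewrite -sumrN; apply: eq_bigr => j _; rewrite (bigD1 j)//= eqxx big1.
  by rewrite addr0 mulN1r.
by move=> k kj; rewrite eq_sym (negbTE kj) mulr0n oppr0 mul0r.
Qed.

End Ellipticity.

(** * Exhaustion by the localizing events *)

Lemma within_continuous_bounded (R : realType) (T : R) (f : R -> R) : 0 <= T ->
  {within `[0, T], continuous f} ->
  exists B, forall t, 0 <= t <= T -> `|f t| <= B.
Proof.
move=> T0 cf.
have cn : {within `[0, T], continuous (fun t => `|f t|)}.
  by move=> x; apply: cvg_norm; exact: cf.
have [t0 _ ht0] := EVT_max T0 cn.
by exists `|f t0| => t tT; apply: ht0; rewrite in_itv.
Qed.

Lemma sum_le_total_variation (R : realType) (T : R) (f : R -> R) (m i : nat) :
  0 < T -> (i <= m.+1)%N -> 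
  ((\sum_(l < i) `|f (grid T m l.+1) - f (grid T m l)|)%:E
    <= total_variation 0%R (grid T m i) f)%E.
Proof.
move=> T0; elim: i => [_|i ih im].
  by rewrite big_ord0 grid0 total_variationxx.
rewrite big_ord_recr/= EFinD.
rewrite (@total_variationD _ _ _ (grid T m i)) ?grid_ge0// ?le_grid//.
apply: leeD; first exact/ih/ltnW.
by apply: total_variation_ge; exact: le_grid.
Qed.

Lemma bv_sum_bounded (R : realType) (T : R) (f : R -> R) : 0 < T ->
  bounded_variation 0 T f -> exists B, forall m i, (i <= m.+1)%N ->
  \sum_(l < i) `|f (grid T m l.+1) - f (grid T m l)| <= B.
Proof.
move=> T0 /(bounded_variationP _ (ltW T0)) fin.
exists (fine (total_variation 0 T f)) => m i im.
rewrite -lee_fin fineK// (le_trans (sum_le_total_variation _ T0 im))//.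
rewrite (@total_variationD _ 0 T (grid T m i)) ?grid_ge0// ?grid_leT//.
by rewrite leeDl// total_variation_ge0// grid_leT.
Qed.

Lemma fin_bound (R : realType) (I : finType) (K : I -> R -> Prop) :
  (forall i x y, x <= y -> K i x -> K i y) -> (forall i, exists x, K i x) ->
  exists x, forall i, K i x.
Proof.
move=> Kmon Kex; pose x i := projT1 (cid (Kex i)).
exists (\sum_i `|x i|) => i; apply: Kmon (projT2 (cid (Kex i))).
rewrite -/(x i) (bigD1 i)//= (le_trans (ler_norm _))// lerDl.
exact: sumr_ge0.
Qed.

Section OccupationEstimate.
Context (R : realType) (d : measure_display) (Omega : measurableType d)
  (P : probability Omega R) (T : R) (F : R -> set_system Omega) (n : nat).
Local Notation N := n.+1.
Variables (X : R -> Omega -> 'rV[R]_N) (g : R -> Omega -> 'M[R]_N).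
Hypothesis hT : 0 < T.
Hypothesis hF : filtration T F.
Hypothesis hg : density_matrix P T F X g.
Variables (c C : R) (hc : 0 < c) (hcC : c < C).
Hypothesis hcg : {ae (lebesgue_measure \x P)%E, forall p : R * Omega,
       0 <= p.1 <= T ->
       loewner_le c%:M (g p.1 p.2) /\ loewner_le (g p.1 p.2) C%:M}.

(** Once the localizing sequences have reached [T], all bounds hold for large [k]
    because the path is bounded and its variation is finite. *)
Lemma good_exhausts (M A : R -> Omega -> 'rV[R]_N) (Q : R -> Omega -> 'M[R]_N)
  (hcan : forall i,
    canonical_decomposition P T F (coord X i) (coord M i) (coord A i))
  (hbr : forall j k, bracket P T F (coord M j) (coord M k) (entry Q j k))
  (tau : 'I_N + 'I_N * 'I_N -> nat -> Omega -> R) w :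
  (forall a, \forall k \near \oo, tau a k w = T) ->
  \forall k \near \oo, good T X M A Q (fun a => tau a k) k%:R w.
Proof.
move=> htau; have T0 := ltW hT.
have [BM hM] : exists B, forall j t, 0 <= t <= T -> `|M t w 0 j| <= B.
  apply: fin_bound => [j x y xy h t tT|j]; first by rewrite (le_trans (h t tT)).
  apply: within_continuous_bounded => //.
  exact: (M_paths hcan).
have [BX hX] : exists B, forall j t, 0 <= t <= T -> `|X t w 0 j| <= B.
  apply: fin_bound => [j x y xy h t tT|j]; first by rewrite (le_trans (h t tT)).
  apply: within_continuous_bounded => //.
  exact: (X_paths hcan).
have [BQ hQ] : exists B, forall (jk : 'I_N * 'I_N) t, 0 <= t <= T ->
    `|Q t w jk.1 jk.2| <= B.
  apply: fin_bound => [j x y xy h t tT|[j k]]; first by rewrite (le_trans (h t tT)).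
  apply: within_continuous_bounded => //.
  exact: (Q_paths hbr).
have [BA hA] : exists B, forall j m i, (i <= m.+1)%N ->
    \sum_(l < i) `|A (grid T m l.+1) w 0 j - A (grid T m l) w 0 j| <= B.
  apply: fin_bound => [j x y xy h m i im|j]; first by rewrite (le_trans (h m i im)).
  apply: (@bv_sum_bounded _ _ (fun t => A t w 0 j)) => //.
  by have [_ _ [_ _ + _] _] := hcan j; apply.
have htau' : \forall k \near \oo, forall a, tau a k w = T by exact: filter_forall.
have big (B : R) : \forall k \near \oo, B <= k%:R by exact: nbhs_infty_ger.
have b1 := big BM; have b2 := big BX; have b3 := big BQ.
have b4 := big (\sum_(j < N) BA).
near=> k.
have tT a : tau a k w = T by move: a; near: k.
have c1 : BM <= k%:R by near: k.
have c2 : BX <= k%:R by near: k.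
have c3 : BQ <= k%:R by near: k.
have c4 : \sum_(j < N) BA <= k%:R by near: k.
exists 0%N => // m _ i im; have iT := grid_itv hT im.
split.
- by move=> a; rewrite tT; case/andP: iT.
- by move=> j; rewrite (le_trans (hM j _ iT)).
- by move=> j; rewrite (le_trans (hX j _ iT)).
- by move=> jk; rewrite (le_trans (hQ jk _ iT)).
- rewrite exchange_big/= (le_trans _ c4)//; apply: ler_sum => j _.
  exact: hA.
Unshelve. all: by end_near.
Qed.

(** Plays the role of the Ito-Tanaka formula and of the occupation time formula;
    the sets [Good k] carry the localization. *)
Theorem occupation_estimate : exists (Good : nat -> set Omega) (K : nat -> R),
  [/\ forall k, measurable (Good k),
      {ae P, forall w, \forall k \near \oo, Good k w},
      forall k, 0 <= K k
    & forall k (S : set (borelV R N)) h p v Bh Pm kap e0,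
        measurable S -> 0 <= Pm -> 0 <= kap -> 0 < e0 <= 1 ->
        occ_test k%:R S h p v Bh Pm kap e0 ->
        Ex P (fun w => \1_(Good k) w * fine (occ T X S w)) <=
          K k * (Bh + Pm + kap + e0)].
Proof.
have [_ _ [Q [[M [A [hcan hbr]]] hQ]]] := hg.
have hloc a := locmart_local hcan hbr a.
have [tau htau] := choice (fun a => (hloc a).2).
have hell : {ae P, forall w s t, 0 <= s -> s <= t -> t <= T ->
  (forall v : 'I_N -> R, c * (\sum_j v j ^+ 2) * (t - s) <=
     \sum_j \sum_k v j * v k * (Q t w j k - Q s w j k)) /\
  \sum_j (Q t w j j - Q s w j j) <= N%:R * C * (t - s)}.
  have hs := ae_sections hcg.
  apply: filterS2 hQ hs => w hQw hsw s t s0 st tT.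
  apply: (@bracket_elliptic R N T c C (fun t => g t w) (fun t => Q t w)) => //.
  - by move=> j k; case: (hQw j k).
  - by move=> j k r rT; case: (hQw j k) => _; exact.
have htau1 a k : stopping_time T F (tau a k) by case: (htau a).
have htau2 k a : martingale P T F (stopped M Q (tau ^~ k) a).
  by case: (htau a) => _ _ _; apply.
have C0 : 0 <= C by rewrite ltW// (lt_trans hc).
exists (fun k => good T X M A Q (tau ^~ k) k%:R).
exists (fun k => 2 / c * (1 + k%:R + N%:R * k%:R + k%:R + 2 * (N%:R * C * T))).
split.
- by move=> k; apply: (measurable_good hT hF hcan hbr) => a; exact: htau1.
- have : {ae P, forall w, forall a, \forall k \near \oo, tau a k w = T}.
    by apply: filter_forall => a; case: (htau a).
  by apply: filterS => w; exact: good_exhausts.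
- move=> k; rewrite mulr_ge0 ?divr_ge0 ?(ltW hc)//.
  by rewrite !addr_ge0// !mulr_ge0// ltW.
move=> k S h p v Bh Pm kap e0 mS Pm0 kap0 /andP[e00 e01] test.
have := occ_test_bound hT hF hcan hbr (fun a => htau1 a k) (htau2 k) hc C0 hell
  (ler0n _ k) Pm0 kap0 e00 mS test.
move/le_trans; apply.
rewrite -[leRHS]mulrA ler_wpM2l ?divr_ge0 ?(ltW hc)//.
have Bh0 : 0 <= Bh.
  by case: test => /(_ 0)/andP[h1 h2] _ _ _ _; exact: le_trans h1 h2.
set NCT := N%:R * C * T.
have NCT0 : 0 <= NCT by rewrite /NCT !mulr_ge0 ?ler0n ?(ltW hT).
set kk : R := k%:R; have kk0 : 0 <= kk by rewrite ler0n.
set NN : R := N%:R; have NN0 : 0 <= NN by rewrite ler0n.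
have a1 : 0 <= Bh * kk by rewrite mulr_ge0.
have a2 : 0 <= Bh * (NN * kk) by rewrite !mulr_ge0.
have a3 : 0 <= Bh * NCT by exact: mulr_ge0.
have a4 : 0 <= Pm * kk by rewrite mulr_ge0.
have a5 : 0 <= Pm * (NN * kk) by rewrite !mulr_ge0.
have a6 : 0 <= Pm * NCT by exact: mulr_ge0.
have a7 : 0 <= kap * kk by rewrite mulr_ge0.
have a8 : 0 <= kap * (NN * kk) by rewrite !mulr_ge0.
have a9 : 0 <= kap * NCT by exact: mulr_ge0.
have e00' := ltW e00.
have a10 : 0 <= e0 * kk by rewrite mulr_ge0.
have a11 : 0 <= e0 * (NN * kk) by rewrite !mulr_ge0.
have a12 : 0 <= e0 * NCT by exact: mulr_ge0.
have a13 : kap * kk * e0 <= kap * kk by rewrite ler_piMr.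
lra.
Qed.

End OccupationEstimate.

(** * Euclidean norm and distance to a closed set *)

Section EuclideanNorm.
Context (R : realType) (N : nat).
Implicit Types (x y z : 'rV[R]_N) (r : R).

Definition dotp x y : R := \sum_i x 0 i * y 0 i.

Lemma dotpC x y : dotp x y = dotp y x.
Proof. by apply: eq_bigr => i _; rewrite mulrC. Qed.

Lemma dotpDr x y z : dotp x (y + z) = dotp x y + dotp x z.
Proof. by rewrite -big_split; apply: eq_bigr => i _; rewrite mxE mulrDr. Qed.

Lemma dotpNr x y : dotp x (- y) = - dotp x y.
Proof. by rewrite -sumrN; apply: eq_bigr => i _; rewrite mxE mulrN. Qed.

Lemma dotpBr x y z : dotp x (y - z) = dotp x y - dotp x z.
Proof. by rewrite dotpDr dotpNr. Qed.

Lemma dotpZr r x y : dotp x (r *: y) = r * dotp x y.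
Proof. by rewrite mulr_sumr; apply: eq_bigr => i _; rewrite mxE mulrCA. Qed.

Lemma dotpDl x y z : dotp (x + y) z = dotp x z + dotp y z.
Proof. by rewrite dotpC dotpDr !(dotpC z). Qed.

Lemma dotpNl x y : dotp (- x) y = - dotp x y.
Proof. by rewrite dotpC dotpNr dotpC. Qed.

Lemma dotpBl x y z : dotp (x - y) z = dotp x z - dotp y z.
Proof. by rewrite dotpDl dotpNl. Qed.

Lemma dotpZl r x y : dotp (r *: x) y = r * dotp x y.
Proof. by rewrite dotpC dotpZr dotpC. Qed.

Lemma dotp_ge0 x : 0 <= dotp x x.
Proof. by apply: sumr_ge0 => i _; rewrite -expr2 sqr_ge0. Qed.

Lemma enorm_sqr x : enorm x ^+ 2 = dotp x x.
Proof.
rewrite /enorm sqr_sqrtr; last by apply: sumr_ge0 => i _; exact: sqr_ge0.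
by apply: eq_bigr => i _; rewrite expr2.
Qed.

Lemma enorm_ge0 x : 0 <= enorm x.
Proof. exact: sqrtr_ge0. Qed.

Lemma enorm_le x r : 0 <= r -> (enorm x <= r) = (dotp x x <= r ^+ 2).
Proof.
by move=> r0; rewrite -enorm_sqr ler_sqr ?nnegrE ?enorm_ge0.
Qed.

Lemma ge_enorm x r : 0 <= r -> (r <= enorm x) = (r ^+ 2 <= dotp x x).
Proof.
by move=> r0; rewrite -enorm_sqr ler_sqr ?nnegrE ?enorm_ge0.
Qed.

Lemma enormN x : enorm (- x) = enorm x.
Proof. by congr Num.sqrt; apply: eq_bigr => i _; rewrite mxE sqrrN. Qed.

Lemma enormB x y : enorm (x - y) = enorm (y - x).
Proof. by rewrite -enormN opprB. Qed.

Lemma enorm_eq0 x : enorm x = 0 -> x = 0.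
Proof.
move=> x0; have /eqP : dotp x x = 0 by rewrite -enorm_sqr x0 expr0n.
rewrite psumr_eq0; last by move=> i _; rewrite -expr2 sqr_ge0.
move=> /allP h; apply/rowP => i; rewrite mxE.
by have := h i (mem_index_enum i); rewrite /= -expr2 sqrf_eq0 => /eqP.
Qed.

Lemma enorm0 : enorm (0 : 'rV[R]_N) = 0.
Proof. by rewrite /enorm big1 ?sqrtr0// => i _; rewrite mxE expr0n. Qed.

Lemma dotp_le x y : dotp x y <= enorm x * enorm y.
Proof.
have [y0|y0] := eqVneq (enorm y) 0.
  by rewrite (enorm_eq0 y0) enorm0 mulr0 -(scale0r (0 : 'rV[R]_N)) dotpZr mul0r.
have yp : 0 < enorm y by rewrite lt_neqAle eq_sym y0 enorm_ge0.
rewrite (le_trans (ler_norm _))// -ler_sqr ?nnegrE ?mulr_ge0 ?enorm_ge0//.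
rewrite real_normK ?num_real// exprMn.
have := dotp_ge0 (enorm y ^+ 2 *: x - dotp x y *: y).
rewrite dotpBr !dotpBl !dotpZl !dotpZr (dotpC y x) -!enorm_sqr.
have -> : enorm y ^+ 2 * (enorm y ^+ 2 * enorm x ^+ 2) -
    dotp x y * (enorm y ^+ 2 * dotp x y) -
    (enorm y ^+ 2 * (dotp x y * dotp x y) - dotp x y * (dotp x y * enorm y ^+ 2))
  = enorm y ^+ 2 * (enorm x ^+ 2 * enorm y ^+ 2 - dotp x y ^+ 2) by ring.
by rewrite pmulr_rge0 ?exprn_gt0// subr_ge0.
Qed.

Lemma dotp_le_norm x y : `|dotp x y| <= enorm x * enorm y.
Proof.
rewrite ler_norml dotp_le andbT lerNl -dotpNl.
by rewrite (le_trans (dotp_le _ _))// enormN.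
Qed.

Lemma enormD x y : enorm (x + y) <= enorm x + enorm y.
Proof.
rewrite enorm_le ?addr_ge0 ?enorm_ge0// dotpDl !dotpDr (dotpC y x) sqrrD.
have := dotp_le x y; rewrite !enorm_sqr; lra.
Qed.

Lemma enorm_triangle x y z : enorm (x - z) <= enorm (x - y) + enorm (y - z).
Proof. by rewrite (le_trans _ (enormD _ _))// addrA subrK. Qed.

Lemma coord_le_enorm x i : `|x 0 i| <= enorm x.
Proof.
rewrite ge_enorm// real_normK ?num_real// /dotp (bigD1 i)//= expr2 lerDl.
by apply: sumr_ge0 => j _; rewrite -expr2 sqr_ge0.
Qed.

Lemma enorm_le_coord x r : 0 <= r -> (forall i, `|x 0 i| <= r) ->
  enorm x <= N%:R * r.
Proof.
move=> r0 xr; apply: (@le_trans _ _ (\sum_i `|x 0 i|)); last first.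
  rewrite (le_trans (ler_sum _ (fun i _ => xr i)))//.
  by rewrite sumr_const card_ord mulr_natl.
rewrite enorm_le ?sumr_ge0// expr2 mulr_suml; apply: ler_sum => i _.
rewrite (le_trans (ler_norm _))// normrM ler_wpM2l//.
by rewrite (bigD1 i)//= lerDl sumr_ge0.
Qed.

Lemma nbhs_enorm (x : 'rV[R]_N) (U : set 'rV[R]_N) : nbhs x U ->
  exists2 r, 0 < r & forall y, enorm (x - y) < r -> U y.
Proof.
move=> /nbhs_ballP[r /= r0 rU]; exists r => // y xy.
apply: rU; split => // i j; rewrite (ord1 i) /ball/=.
by apply: le_lt_trans xy; have := coord_le_enorm (x - y) j; rewrite !mxE.
Qed.

Lemma enorm_nbhs (x : 'rV[R]_N) r : 0 < r ->
  nbhs x [set y | enorm (x - y) < r].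
Proof.
move=> r0; apply/nbhs_ballP; exists (r / N.+1%:R) => /=.
  exact: divr_gt0.
move=> y [_ xy].
have := @enorm_le_coord (x - y) (r / N.+1%:R).
move=> /(_ _ _)/wrap[].
- by rewrite ltW// divr_gt0.
- by move=> i; have := xy 0 i; rewrite /ball/= !mxE => /ltW.
move/le_lt_trans; apply.
by rewrite mulrA ltr_pdivrMr// mulrC ltr_pM2l// ltr_nat.
Qed.

Lemma lipschitz_enorm_continuous (f : 'rV[R]_N -> R) (K : R) :
  (forall x y, `|f x - f y| <= K * enorm (x - y)) -> continuous f.
Proof.
move=> fK x A /nbhs_ballP[e /= e0 eA].
have K1 : 0 < `|K| + 1 by rewrite ltr_wpDl.
have nx : nbhs x [set y | enorm (x - y) < e / (`|K| + 1)].
  by apply: enorm_nbhs; exact: divr_gt0.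
apply: (@filterS _ (nbhs x) (nbhs_filter x) _ _ _ nx) => y /= xy.
apply: eA; rewrite /ball/= (le_lt_trans (fK x y))//.
move: xy; rewrite ltr_pdivlMr// mulrC; apply: le_lt_trans.
by rewrite ler_wpM2r ?enorm_ge0// (le_trans (ler_norm K))// lerDl.
Qed.

Lemma enorm_lip x y : `|enorm x - enorm y| <= enorm (x - y).
Proof.
have h (u v : 'rV[R]_N) : enorm u <= enorm v + enorm (u - v).
  have := enormD v (u - v); by rewrite addrC subrK.
rewrite ler_norml; have := h x y; have := h y x; rewrite (enormB y x); lra.
Qed.

Lemma enorm_continuous : continuous (@enorm R N).
Proof.
by apply: (@lipschitz_enorm_continuous _ 1) => x y; rewrite mul1r enorm_lip.
Qed.

End EuclideanNorm.

Section Distance.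
Context (R : realType) (n : nat).
Local Notation N := n.+1.
Variable (G : set 'rV[R]_N).
Hypothesis cG : closed G.
Implicit Types x y z : 'rV[R]_N.

(** The distance to [G] as a real number; it is 0 by convention if [G] is
    empty. *)
Definition dst (x : 'rV[R]_N) : R := fine (edist_to G x).

Lemma compact_enorm_ball (K : set 'rV[R]_N) (r : R) : closed K ->
  (forall x, K x -> enorm x <= r) -> compact K.
Proof.
move=> cK Kr; apply: bounded_closed_compact => //.
exists r; split; first exact: num_real.
move=> M rM x Kx /=; rewrite /Num.norm/= mx_normrE.
apply: bigmax_le => [|[i j] _] /=.
  by rewrite (le_trans (enorm_ge0 x))// (le_trans (Kr x Kx))// ltW.
by rewrite (ord1 i) (le_trans (coord_le_enorm _ _))// (le_trans (Kr x Kx))// ltW.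
Qed.

(** Bounded closed sets are compact. *)
Lemma nearest_point x : G !=set0 ->
  exists p, [/\ G p, forall z, G z -> enorm (x - p) <= enorm (x - z),
    edist_to G x = (enorm (x - p))%:E & dst x = enorm (x - p)].
Proof.
move=> [z0 Gz0].
pose f (z : 'rV[R]_N) := enorm (x - z).
have cf : continuous f.
  apply: (@lipschitz_enorm_continuous _ _ _ 1) => u v; rewrite mul1r.
  by rewrite (le_trans (enorm_lip _ _))// opprB addrC addrA subrK enormB.
pose K := G `&` [set z | f z <= f z0].
have cK : compact K.
  apply: (@compact_enorm_ball _ (enorm x + f z0)).
    apply: closedI => //.
    exact: (proj1 (continuous_closedP f) cf _ (@closed_le _ (f z0))).
  move=> z [_ /= fz]; have := enormD x (- (x - z)).
  rewrite opprB addrC subrK (enormB z x).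
  by move/le_trans; apply; rewrite lerD2l.
have K0 : K !=set0 by exists z0; split => //=.
have cfK : {within K, continuous f} by exact: continuous_subspaceT.
have [p /set_mem[Gp fp] hp] := EVT_min_rV K0 cK cfK.
have hG z : G z -> f p <= f z.
  move=> Gz; have [fz|fz] := leP (f z) (f z0).
    by apply: hp; apply/mem_set; split.
  by rewrite (le_trans fp)// ltW.
have E : edist_to G x = (f p)%:E.
  apply/eqP; rewrite eq_le; apply/andP; split.
    by apply: ereal_inf_lbound; exists p.
  by apply: le_ereal_inf_tmp => _ [z Gz <-]; rewrite lee_fin hG.
by exists p; split => //; rewrite /dst E.
Qed.

Hypothesis G0 : G !=set0.

Lemma edistE x : edist_to G x = (dst x)%:E.
Proof. by have [p [_ _ -> ->]] := nearest_point x G0. Qed.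

Lemma dst_ge0 x : 0 <= dst x.
Proof. by have [p [_ _ _ ->]] := nearest_point x G0; exact: enorm_ge0. Qed.

Lemma dst_le x z : G z -> dst x <= enorm (x - z).
Proof. by move=> Gz; have [p [_ h _ ->]] := nearest_point x G0; exact: h. Qed.

Lemma dst_eq0 x : dst x = 0 -> G x.
Proof.
have [p [Gp _ _ ->]] := nearest_point x G0 => /enorm_eq0/eqP.
by rewrite subr_eq0 => /eqP ->.
Qed.

Lemma dst0 x : G x -> dst x = 0.
Proof.
move=> Gx; apply/le_anti; rewrite dst_ge0 andbT (le_trans (dst_le x Gx))//.
by rewrite subrr enorm0.
Qed.

Lemma dst_lip x y : `|dst x - dst y| <= enorm (x - y).
Proof.
have h (u v : 'rV[R]_N) : dst u <= dst v + enorm (u - v).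
  have [p [Gp _ _ ->]] := nearest_point v G0.
  by rewrite (le_trans (dst_le u Gp))// (le_trans (enorm_triangle u v p))// addrC.
rewrite ler_norml; have := h x y; have := h y x; rewrite (enormB y x); lra.
Qed.

Lemma dst_continuous : continuous dst.
Proof.
by apply: (@lipschitz_enorm_continuous _ _ _ 1) => x y; rewrite mul1r dst_lip.
Qed.

End Distance.

(** * Second order Taylor estimates *)

Section MinMax.
Context (R : realType).
Implicit Types a b c p q z : R.

Lemma minmax_dist a b p q z : `|a - p| <= q -> `|b - p| <= q ->
  Num.min a b <= z <= Num.max a b -> `|z - p| <= q.
Proof.
rewrite !ler_norml => /andP[? ?] /andP[? ?].
by rewrite /Num.min /Num.max; case: ifPn => _ /andP[? ?]; apply/andP; split; lra.
Qed.

Lemma minmax_sub a b c z : Num.min a b <= c <= Num.max a b ->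
  Num.min a c <= z <= Num.max a c -> Num.min a b <= z <= Num.max a b.
Proof.
rewrite /Num.min /Num.max.
by case: (ltP a b) => ?; case: (ltP a c) => ? /andP[? ?] /andP[? ?];
  apply/andP; split; lra.
Qed.

Lemma minmax_norm a b z : Num.min a b <= z <= Num.max a b ->
  `|z - a| <= `|b - a|.
Proof.
rewrite /Num.min /Num.max; case: (ltP a b) => ab /andP[? ?].
  by rewrite !ger0_norm; lra.
by rewrite !ler0_norm; lra.
Qed.

End MinMax.

Section CoordinateTaylor.
Context (R : realType) (N : nat).
Implicit Types (h : 'rV[R]_N -> R) (x y z : 'rV[R]_N).

Lemma derive_line h (a v : 'rV[R]_N) (s : R) : derivable h (a + s *: v) v ->
  is_derive s 1 (fun t => h (a + t *: v)) ('D_v h (a + s *: v)).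
Proof.
move=> dh.
have E : (fun t : R => t^-1 *: (((fun t => h (a + t *: v)) \o shift s) (t *: 1)
    - h (a + s *: v))) =
  (fun t => t^-1 *: ((h \o shift (a + s *: v)) (t *: v) - h (a + s *: v))).
  apply/funext => t /=; congr (_ *: (h _ - _)).
  by rewrite /shift/= scaler1 scalerDl addrCA.
by apply: DeriveDef; rewrite /derivable /derive E.
Qed.

Definition rect x y : set 'rV[R]_N :=
  [set z | forall i, Num.min (x 0 i) (y 0 i) <= z 0 i <= Num.max (x 0 i) (y 0 i)].

Lemma mvt_norm (f df : R -> R) (a b c L : R) :
  (forall s, Num.min a b <= s <= Num.max a b -> is_derive s 1 f (df s)) ->
  (forall s, Num.min a b <= s <= Num.max a b -> `|df s - c| <= L) ->
  `|f b - f a - c * (b - a)| <= L * `|b - a|.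
Proof.
wlog ab : a b / a <= b.
  move=> H hd hb; have [/H|ba] := leP a b; first exact.
  rewrite (_ : _ - _ - _ = - (f a - f b - c * (a - b))); last by ring.
  rewrite normrN (distrC b); apply: H; first exact: ltW.
    by move=> s; rewrite minC maxC; exact: hd.
  by move=> s; rewrite minC maxC; exact: hb.
rewrite min_l// max_r// => hd hb.
have [||s sab ->] := @MVT_segment R f df a b ab.
- by move=> s; rewrite in_itv/= => /andP[h1 h2]; apply: hd; rewrite !ltW.
- apply: derivable_within_continuous => s; rewrite in_itv/= => sab.
  by have := hd s sab.
rewrite -mulrBl normrM ler_wpM2r//; apply: hb.
by move: sab; rewrite in_itv.
Qed.

(** Mean value inequality along a path that changes one coordinate at a time,
    hence in terms of the partial derivatives. *)
Lemma box_taylor h x y (c : 'I_N -> R) (L : R) :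
  (forall z i, rect x y z -> pderivable i h z /\ `|pderiv i h z - c i| <= L) ->
  `|h y - h x - \sum_i c i * (y 0 i - x 0 i)| <= L * \sum_i `|y 0 i - x 0 i|.
Proof.
move=> hz.
pose z k : 'rV[R]_N := \row_i (if (i < k)%N then y 0 i else x 0 i).
have z0 : z 0%N = x by apply/rowP => i; rewrite mxE.
have zN : z N = y by apply/rowP => i; rewrite mxE ltn_ord.
have zS (k : 'I_N) : `|h (z k.+1) - h (z k) - c k * (y 0 k - x 0 k)| <=
    L * `|y 0 k - x 0 k|.
  pose a : 'rV[R]_N := \row_i (if i == k then 0 else z k 0 i).
  have lineE s i : (a + s *: delta_mx 0 k) 0 i =
      if i == k then s else z k 0 i.
    rewrite !mxE eqxx/=; case: (eqVneq i k) => _ /=.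
      by rewrite mulr1 add0r.
    by rewrite mulr0 addr0.
  have e1 : z k.+1 = a + y 0 k *: delta_mx 0 k.
    apply/rowP => i; rewrite lineE !mxE ltnS; case: eqVneq => [->|ik].
      by rewrite leqnn.
    by rewrite ltn_neqAle; move: ik; rewrite -val_eqE /= => ->.
  have e2 : z k = a + x 0 k *: delta_mx 0 k.
    apply/rowP => i; rewrite lineE !mxE; case: eqVneq => [->|//].
    by rewrite ltnn.
  have rectL s : Num.min (x 0 k) (y 0 k) <= s <= Num.max (x 0 k) (y 0 k) ->
      rect x y (a + s *: delta_mx 0 k).
    move=> sxy i; rewrite lineE mxE; case: eqVneq => [->//|_].
    by case: ifP => _; rewrite !(ge_min, le_max, lexx, orbT).
  rewrite e1 e2.
  apply: (@mvt_norm (fun s => h (a + s *: delta_mx 0 k))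
    (fun s => pderiv k h (a + s *: delta_mx 0 k))).
  - move=> s /rectL/hz-/(_ k)[dh _]; exact: derive_line.
  - by move=> s /rectL/hz-/(_ k)[_].
have tel : h y - h x = \sum_(k < N) (h (z k.+1) - h (z k)).
  rewrite -(big_mkord predT (fun k => h (z k.+1) - h (z k))).
  by rewrite telescope_sumr// zN z0.
rewrite tel -sumrB (le_trans (ler_norm_sum _ _ _))// mulr_sumr.
by apply: ler_sum => k _; exact: zS.
Qed.

Definition grad h x : 'rV[R]_N := \row_i pderiv i h x.

Lemma dotp_grad h x v : dotp (grad h x) v = \sum_i pderiv i h x * v 0 i.
Proof. by apply: eq_bigr => i _; rewrite mxE. Qed.

Lemma sum_coord_le x : \sum_i `|x 0 i| <= N%:R * enorm x.
Proof.
apply: (@le_trans _ _ (\sum_(i < N) enorm x)).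
  by apply: ler_sum => i _; exact: coord_le_enorm.
by rewrite sumr_const card_ord mulr_natl.
Qed.

Lemma sum_coordB_le x y : \sum_i `|y 0 i - x 0 i| <= N%:R * enorm (y - x).
Proof.
have := sum_coord_le (y - x); under eq_bigr do rewrite !mxE.
by move/le_trans; apply.
Qed.

(** The first and second partial derivatives are bounded near [p0] by continuity,
    and [box_taylor] is applied to [h] and to its partial derivatives. *)
Lemma C2_local (U : set 'rV[R]_N) h p0 : open U -> U p0 -> C2_on U h ->
  exists r L, [/\ 0 < r, 0 <= L,
    forall x, enorm (x - p0) < r -> U x &
    forall x y, enorm (x - p0) < r -> enorm (y - p0) < r ->
    [/\ `|h y - h x| <= L * enorm (y - x),
        `|h y - h x - dotp (grad h x) (y - x)| <= L * enorm (y - x) ^+ 2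
      & forall i, `|pderiv i h y - pderiv i h x| <= L * enorm (y - x)]].
Proof.
move=> oU Up0 [_ D1 D2].
have FF : Filter (nbhs p0) := nbhs_filter p0.
have near_bound (f : 'rV[R]_N -> R) : {for p0, continuous f} ->
    \forall x \near p0, `|f x| <= `|f p0| + 1.
  move=> cf; have : nbhs (f p0) [set t | `|t| <= `|f p0| + 1].
    apply/nbhs_ballP; exists 1 => //= t; rewrite /ball/= => ft.
    have := ler_normB (f p0) (f p0 - t); rewrite subKr => /le_trans; apply.
    by rewrite lerD2l ltW.
  exact: cf.
pose L1 := \sum_i (`|pderiv i h p0| + 1).
pose L2 := \sum_i \sum_j (`|pderiv j (pderiv i h) p0| + 1).
have L10 : 0 <= L1 by apply: sumr_ge0 => i _; rewrite addr_ge0.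
have L20 : 0 <= L2 by do 2 (apply: sumr_ge0 => ? _); rewrite addr_ge0.
have nU : \forall x \near p0, U x by exact: open_nbhs_nbhs.
have n1 : \forall x \near p0, forall i, `|pderiv i h x| <= L1.
  apply: (@filter_forall _ _ (fun i => [set x | `|pderiv i h x| <= L1]) _ FF) => i.
  have [_ ci] := D1 i.
  apply: filterS (near_bound _ (ci p0 Up0)) => x /le_trans; apply.
  by rewrite /L1 (bigD1 i)//= lerDl; apply: sumr_ge0 => j _; rewrite addr_ge0.
have n2 : \forall x \near p0, forall i j, `|pderiv j (pderiv i h) x| <= L2.
  apply: (@filter_forall _ _ (fun i => [set x |
    forall j, `|pderiv j (pderiv i h) x| <= L2]) _ FF) => i.
  apply: (@filter_forall _ _ (fun j => [set x |
    `|pderiv j (pderiv i h) x| <= L2]) _ FF) => j.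
  have [_ ci] := D2 i j.
  apply: filterS (near_bound _ (ci p0 Up0)) => x /le_trans; apply.
  pose S i' := \sum_j (`|pderiv j (pderiv i' h) p0| + 1).
  have S0 i' : 0 <= S i' by apply: sumr_ge0 => j' _; rewrite addr_ge0.
  apply: (@le_trans _ _ (S i)).
    by rewrite /S (bigD1 j)//= lerDl; apply: sumr_ge0 => j' _; rewrite addr_ge0.
  rewrite (_ : L2 = \sum_i' S i')// [leRHS](bigD1 i)//= lerDl.
  by apply: sumr_ge0 => i' _; exact: S0.
have : \forall x \near p0, [/\ U x, forall i, `|pderiv i h x| <= L1 &
    forall i j, `|pderiv j (pderiv i h) x| <= L2].
  by apply: filterS3 nU n1 n2 => x.
move=> /nbhs_enorm[r0 r00 hr0].
pose M := N%:R + 1 : R.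
have M0 : 0 < M by rewrite ltr_wpDl.
have N1 : N%:R <= M by rewrite lerDl.
have M1 : 1 <= M by rewrite lerDr.
pose L := L1 * M + L2 * M ^+ 2.
have LM1 : 0 <= L1 * M by rewrite mulr_ge0// ltW.
have LM2 : 0 <= L2 * M ^+ 2 by rewrite mulr_ge0// sqr_ge0.
have LM3 : L2 * M <= L2 * M ^+ 2.
  by rewrite ler_wpM2l// expr2 ler_peMl// ltW.
exists (r0 / M), L; split.
- exact: divr_gt0.
- by rewrite addr_ge0.
- move=> x xr; have [] // := hr0 x.
  rewrite enormB (lt_le_trans xr)// ler_pdivrMr// ler_peMr// ltW//.
move=> x y xr yr.
have rectr (x' y' z : 'rV[R]_N) : enorm (x' - p0) < r0 / M ->
    enorm (y' - p0) < r0 / M -> rect x' y' z -> enorm (p0 - z) < r0.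
  move=> xr' yr' xyz; pose q := Num.max (enorm (x' - p0)) (enorm (y' - p0)).
  have q0 : 0 <= q by rewrite le_max enorm_ge0.
  have qr : q < r0 / M by rewrite gt_max xr' yr'.
  rewrite enormB; apply: (@le_lt_trans _ _ (M * q)); last first.
    by move: qr; rewrite ltr_pdivlMr// mulrC.
  apply: (@le_trans _ _ (N%:R * q)); last by rewrite ler_wpM2r.
  apply: enorm_le_coord => // i; have := xyz i; rewrite !mxE.
  have h1 : `|x' 0 i - p0 0 i| <= q.
    rewrite le_max; apply/orP; left.
    by have := coord_le_enorm (x' - p0) i; rewrite !mxE.
  have h2 : `|y' 0 i - p0 0 i| <= q.
    rewrite le_max; apply/orP; right.
    by have := coord_le_enorm (y' - p0) i; rewrite !mxE.
  exact: minmax_dist h1 h2.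
have lip1 x' y' i : enorm (x' - p0) < r0 / M -> enorm (y' - p0) < r0 / M ->
    `|pderiv i h y' - pderiv i h x'| <= L2 * M * enorm (y' - x').
  move=> xr' yr'.
  have := @box_taylor (pderiv i h) x' y' (fun=> 0) L2.
  rewrite big1 ?subr0; last by move=> j _; rewrite mul0r.
  move=> /(_ _)/wrap[].
    move=> z j /(rectr _ _ _ xr' yr')/hr0[Uz _ h2].
    by rewrite subr0; split => //; have [+ _] := D2 i j; exact.
  move/le_trans; apply; rewrite -mulrA ler_wpM2l//.
  rewrite (le_trans (sum_coordB_le _ _))// ler_wpM2r// enorm_ge0//.
have exy := enorm_ge0 (y - x).
have sxy : \sum_i `|y 0 i - x 0 i| <= M * enorm (y - x).
  by rewrite (le_trans (sum_coordB_le _ _))// ler_wpM2r.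
split.
- have := @box_taylor h x y (fun=> 0) L1.
  rewrite big1 ?subr0; last by move=> j _; rewrite mul0r.
  move=> /(_ _)/wrap[].
    move=> z j /(rectr _ _ _ xr yr)/hr0[Uz h1 _].
    by rewrite subr0; split => //; have [+ _] := D1 j; exact.
  move/le_trans; apply; rewrite (le_trans (ler_wpM2l L10 sxy))//.
  by rewrite mulrA ler_wpM2r// lerDl.
- have := @box_taylor h x y (fun i => pderiv i h x) (L2 * M * enorm (y - x)).
  move=> /(_ _)/wrap[].
    move=> z j xyz; have := rectr _ _ _ xr yr xyz => zr0.
    have [Uz _ h2] := hr0 z zr0; split.
      by have [+ _] := D1 j; exact.
    have rxz z' : rect x z z' -> rect x y z'.
      by move=> xzz i; exact: minmax_sub (xyz i) (xzz i).
    have := @box_taylor (pderiv j h) x z (fun=> 0) L2.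
    rewrite big1 ?subr0; last by move=> i _; rewrite mul0r.
    move=> /(_ _)/wrap[].
      move=> z' i /rxz/(rectr _ _ _ xr yr)/hr0[Uz' _ h2'].
      by rewrite subr0; split => //; have [+ _] := D2 j i; exact.
    move/le_trans; apply; rewrite -mulrA ler_wpM2l//.
    apply: (le_trans _ sxy); apply: ler_sum => i _.
    exact: minmax_norm (xyz i).
  have -> : \sum_i pderiv i h x * (y 0 i - x 0 i) = dotp (grad h x) (y - x).
    by rewrite dotp_grad; apply: eq_bigr => i _; rewrite !mxE.
  move/le_trans; apply.
  have LM0 : 0 <= L2 * M * enorm (y - x) by rewrite !mulr_ge0// ltW.
  rewrite (le_trans (ler_wpM2l LM0 sxy))// [leLHS](_ : _ =
    (L2 * M ^+ 2) * enorm (y - x) ^+ 2); last by ring.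
  by rewrite ler_wpM2r ?sqr_ge0// lerDr.
- move=> i; rewrite (le_trans (lip1 x y i xr yr))// ler_wpM2r//.
  by rewrite (le_trans LM3)// lerDr.
Qed.

End CoordinateTaylor.

(** * Unit normals of a hypersurface *)

Lemma enorm_delta (R : realType) (N : nat) (i : 'I_N) (s : R) :
  enorm (s *: delta_mx 0 i : 'rV[R]_N) = `|s|.
Proof.
rewrite /enorm (bigD1 i)//= !mxE !eqxx mulr1 big1 ?addr0 ?sqrtr_sqr// => j ji.
by rewrite !mxE (negbTE ji) andbF mulr0 expr0n.
Qed.

Lemma enormZ (R : realType) (N : nat) (s : R) (x : 'rV[R]_N) :
  enorm (s *: x) = `|s| * enorm x.
Proof.
apply/eqP; rewrite -(eqrXn2 (n := 2))// ?mulr_ge0 ?enorm_ge0//.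
by rewrite exprMn !enorm_sqr dotpZl dotpZr real_normK ?num_real// mulrA -expr2.
Qed.

Lemma cvg_sum_fin (R : realType) (U : Type) (F : set_system U) (FF : Filter F)
  (I : finType) (f : I -> U -> R) (a : I -> R) :
  (forall i, f i @ F --> a i) -> (fun x => \sum_i f i x) @ F --> \sum_i a i.
Proof.
by move=> fa; apply: cvg_big => [|i _]; [exact: add_continuous|exact: fa].
Qed.

Section LocalNormal.
Context (R : realType) (n : nat).
Local Notation N := n.+1.
Variables (G : set 'rV[R]_N) (k : chart R N) (p0 : 'rV[R]_N).
Hypothesis sk : slice_chart G k.
Hypothesis domp0 : chart_dom k p0.
Hypothesis Gp0 : G p0.

Let u (x : 'rV[R]_N) : R := chart_map k x 0 ord_max.

Let oU : open (chart_dom k). Proof. by case: sk => -[]. Qed.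

Let C2u : C2_on (chart_dom k) u.
Proof. by case: sk => _ _ _ [+ _] _; apply. Qed.

Let Gu x : chart_dom k x -> G x <-> u x = 0.
Proof. by case: sk => _ _ _ _; apply. Qed.

(** [u] increases at unit speed along the image of the last coordinate axis by
    the inverse chart, which is Lipschitz. *)
Lemma chart_grad_gt0 : 0 < enorm (grad u p0).
Proof.
rewrite lt_neqAle enorm_ge0 andbT eq_sym; apply/eqP => g0.
have [_ hmap hinv [_ C2inv] _] := sk.
have [imy0 invy0] := hmap p0 domp0.
set y0 := chart_map k p0 in imy0 invy0.
have oV : open (chart_im k) by case: sk => -[].
have [x hx] : exists x : R, forall i : 'I_N, forall y : 'rV[R]_N,
    enorm (y - y0) * x < 1 -> chart_im k y /\
    `|chart_inv k y 0 i - p0 0 i| <= x * enorm (y - y0).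
  apply: fin_bound => [i x x' xx' h y yx'|i].
    have e0 := enorm_ge0 (y - y0).
    have [] := h y; first by rewrite (le_lt_trans _ yx')// ler_wpM2l.
    by move=> h1 h2; split => //; rewrite (le_trans h2)// ler_wpM2r.
  have [r [L [r0 L0 hU hL]]] := C2_local oV imy0 (C2inv i).
  exists (Num.max r^-1 L) => y yr.
  have e0 := enorm_ge0 (y - y0).
  have {}yr : enorm (y - y0) < r.
    rewrite -[ltRHS]mul1r -ltr_pdivrMr//.
    by rewrite (le_lt_trans _ yr)// ler_wpM2l// le_max lexx.
  split; first exact: hU.
  have [h1 _ _] : [/\ `|chart_inv k y 0 i - chart_inv k y0 0 i| <=
    L * enorm (y - y0), True & True].
    have [] // := hL y0 y _ yr; by rewrite subrr enorm0.
  by rewrite -{1}invy0 (le_trans h1)// ler_wpM2r// le_max lexx orbT.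
have [r [L [r0 L0 hU hL]]] := C2_local oU domp0 C2u.
pose x1 := `|x| + 1; pose M := N%:R * x1.
have x10 : 0 < x1 by rewrite ltr_wpDl.
have M0 : 0 < M by rewrite mulr_gt0.
pose D := 1 + x1 + M / r + L * M ^+ 2.
have D1 : 0 <= M / r by rewrite divr_ge0// ltW.
have D2 : 0 <= L * M ^+ 2 by rewrite mulr_ge0// sqr_ge0.
have D0 : 0 < D by rewrite /D; lra.
pose s := D^-1.
have s0 : 0 < s by rewrite invr_gt0.
have sD c : c < D -> c * s < 1 by move=> cD; rewrite ltr_pdivrMr// mul1r.
pose y := y0 + s *: delta_mx 0 ord_max.
have ey : enorm (y - y0) = s.
  by rewrite /y addrC addKr enorm_delta gtr0_norm.
have xx1 : x <= x1 by rewrite (le_trans (ler_norm x))// lerDl.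
have hy i : chart_im k y /\ `|chart_inv k y 0 i - p0 0 i| <= x * s.
  have := hx i y; rewrite ey; apply; rewrite mulrC; apply: sD.
  rewrite (le_lt_trans xx1)// /D; lra.
have imy : chart_im k y by case: (hy ord_max).
have [domz mapz] := hinv y imy.
set z := chart_inv k y in domz mapz hy.
have ez : enorm (z - p0) <= M * s.
  rewrite /M -mulrA; apply: enorm_le_coord => [|i]; first by rewrite mulr_ge0// ltW.
  by rewrite !mxE (le_trans (hy i).2)// ler_wpM2r// ltW.
have zr : enorm (z - p0) < r.
  rewrite (le_lt_trans ez)// -[ltRHS]mul1r -ltr_pdivrMr// mulrAC.
  by apply: sD; rewrite /D; lra.
have up0 : u p0 = 0 by exact/(Gu domp0).1.
have uz : u z = s.
  rewrite /u mapz /y !mxE !eqxx mulr1.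
  by rewrite -/(u p0) up0 add0r.
have [_ + _] : [/\ True, `|u z - u p0 - dotp (grad u p0) (z - p0)| <=
    L * enorm (z - p0) ^+ 2 & True].
  have [] // := hL p0 z _ zr; by rewrite subrr enorm0.
rewrite uz up0 subr0 (enorm_eq0 g0) -(scale0r (0 : 'rV[R]_N)) dotpZl mul0r subr0.
rewrite gtr0_norm// leNgt => /negP; apply.
apply: (@le_lt_trans _ _ (L * (M * s) ^+ 2)).
  rewrite ler_wpM2l// ler_sqr ?nnegrE ?enorm_ge0// mulr_ge0// ltW//.
rewrite exprMn mulrA expr2 mulrA gtr_pMl//.
by apply: sD; rewrite /D; lra.
Qed.

Definition unit_grad (x : 'rV[R]_N) : 'rV[R]_N :=
  (enorm (grad u x))^-1 *: grad u x.

Lemma unit_grad_continuous x j : chart_dom k x -> 0 < enorm (grad u x) ->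
  {for x, continuous (fun y => unit_grad y 0 j)}.
Proof.
move=> Ux gx; have [_ D1 _] := C2u.
have FF : Filter (nbhs x) := nbhs_filter x.
have cg i : {for x, continuous (fun y => grad u y 0 i)}.
  have [_ /(_ x Ux)] := D1 i.
  by rewrite (_ : (fun y => grad u y 0 i) = pderiv i u)//;
    apply/funext => y; rewrite mxE.
have cn : {for x, continuous (fun y => enorm (grad u y))}.
  rewrite /enorm; apply: (@cvg_comp _ _ _
    (fun y => \sum_i grad u y 0 i ^+ 2) Num.sqrt); last exact: sqrt_continuous.
  apply: (cvg_sum_fin FF) => i.
  by apply: (@cvgM _ _ (nbhs x) FF); exact: cg.
rewrite (_ : (fun y => unit_grad y 0 j) =
    (fun y => (enorm (grad u y))^-1 * grad u y 0 j)); last first.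
  by apply/funext => y; rewrite mxE.
apply: (@cvgM _ _ (nbhs x) FF); last exact: cg.
by apply: (@cvgV _ _ (nbhs x) FF); [rewrite gt_eqF|exact: cn].
Qed.

(** Near [p0] the tangent hyperplane at [p] has contact of order 2 with [G],
    and the directions of the balls that touch [G] at [p] from outside are the
    two unit normals: in any other direction [e] the ball contains points of
    [G], which the intermediate value theorem provides on small segments
    orthogonal to the tangent part [w] of [e]. *)
Lemma local_normal : exists r K, [/\ 0 < r, 0 < K,
  forall p j, enorm (p - p0) < r ->
    {for p, continuous (fun x => unit_grad x 0 j)} &
  forall p, G p -> enorm (p - p0) < r -> [/\ enorm (unit_grad p) = 1,
    forall z, G z -> `|dotp (unit_grad p) (z - p)| <= K * enorm (z - p) ^+ 2 &
    forall e a, enorm e = 1 -> 0 < a ->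
      (forall z, G z -> 2 * a * dotp e (z - p) <= enorm (z - p) ^+ 2) ->
      e = unit_grad p \/ e = - unit_grad p]].
Proof.
have [r0 [L [r00 L0 hU hL]]] := C2_local oU domp0 C2u.
have m00 := chart_grad_gt0.
pose m := enorm (grad u p0) / 2.
have m0 : 0 < m by rewrite divr_gt0.
pose NL := N%:R * L + 1 : R.
have NL0 : 0 < NL by rewrite ltr_wpDl// mulr_ge0.
pose r := Num.min (r0 / 2) (m / NL).
have r0' : 0 < r by rewrite lt_min !divr_gt0.
have rr0 x : enorm (x - p0) < r -> enorm (x - p0) < r0 / 2.
  by rewrite lt_min => /andP[].
have r0h : r0 / 2 < r0 by rewrite ltr_pdivrMr// ltr_pMr// ltr1n.
have gm x : enorm (x - p0) < r -> m <= enorm (grad u x).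
  move=> xr; have xr0 := lt_trans (rr0 x xr) r0h.
  have [|_ _ hg] := hL p0 x _ xr0; first by rewrite subrr enorm0.
  have : enorm (grad u x - grad u p0) <= N%:R * (L * enorm (x - p0)).
    apply: enorm_le_coord => [|i]; first by rewrite mulr_ge0// enorm_ge0.
    by rewrite !mxE; exact: hg.
  have : N%:R * (L * enorm (x - p0)) <= m.
    rewrite mulrA (@le_trans _ _ (NL * enorm (x - p0)))//.
      by rewrite ler_wpM2r ?enorm_ge0// /NL lerDl.
    move: xr; rewrite lt_min => /andP[_].
    by rewrite ltr_pdivlMr// mulrC => /ltW.
  have := enorm_lip (grad u p0) (grad u x); rewrite enormB ler_norml.
  rewrite /m => /andP[_ h1] h2 h3; lra.
exists r, (L / m + 2 / r0); split => //.
- apply: ltr_wpDl; last exact: divr_gt0.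
  by rewrite divr_ge0// ltW.
- move=> p j pr; have gp := lt_le_trans m0 (gm p pr).
  by apply: unit_grad_continuous => //; apply: hU; exact: lt_trans (rr0 p pr) r0h.
move=> p Gp pr; have gmp := gm p pr.
set mp := enorm (grad u p) in gmp; have mp0 : 0 < mp by exact: lt_le_trans gmp.
set nu := unit_grad p.
have gnu : grad u p = mp *: nu.
  by rewrite /nu /unit_grad scalerA mulfV ?gt_eqF// scale1r.
have nu1 : enorm nu = 1.
  by rewrite /nu /unit_grad enormZ ger0_norm ?invr_ge0 ?ltW// mulVf// gt_eqF.
clearbody nu.
have pr0 := lt_trans (rr0 p pr) r0h.
have Up := hU p pr0; have up : u p = 0 by exact/(Gu Up).1.
have inr0 z : enorm (z - p) < r0 / 2 -> enorm (z - p0) < r0.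
  move=> zp; rewrite (le_lt_trans (enorm_triangle z p p0))//.
  by rewrite [ltRHS]splitr ltrD// rr0.
have taylor z : enorm (z - p) < r0 / 2 ->
    `|u z - mp * dotp nu (z - p)| <= L * enorm (z - p) ^+ 2.
  move=> zp; have [_ + _] := hL p z pr0 (inr0 z zp).
  by rewrite up subr0 gnu dotpZl.
split => // [z Gz|e a e1 a0 he].
  have zp0 := enorm_ge0 (z - p).
  have [zp|zp] := ltP (enorm (z - p)) (r0 / 2).
    have := taylor z zp; rewrite ((Gu (hU z (inr0 z zp))).1 Gz) sub0r normrN.
    rewrite normrM gtr0_norm// => h.
    apply: (@le_trans _ _ (L / m * enorm (z - p) ^+ 2)); last first.
      by rewrite ler_wpM2r ?sqr_ge0// lerDl divr_ge0// ltW.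
    rewrite mulrAC ler_pdivlMr// (le_trans _ h)// mulrC ler_wpM2r//.
  apply: (@le_trans _ _ (2 / r0 * enorm (z - p) ^+ 2)); last first.
    by rewrite ler_wpM2r ?sqr_ge0// lerDr divr_ge0// ltW.
  rewrite (le_trans (dotp_le_norm _ _))// nu1 mul1r expr2 mulrA ler_peMl//.
  by rewrite mulrAC ler_pdivlMr// mul1r mulrC -ler_pdivrMr.
pose c := dotp e nu; pose w := e - c *: nu.
have ee : dotp e e = 1 by rewrite -enorm_sqr e1 expr1n.
have nn : dotp nu nu = 1 by rewrite -enorm_sqr nu1 expr1n.
have wnu : dotp nu w = 0.
  by rewrite /w dotpBr dotpZr nn mulr1 dotpC -/c subrr.
have ew : dotp e w = 1 - c ^+ 2 by rewrite /w dotpBr dotpZr ee -/c expr2.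
have ww : dotp w w = 1 - c ^+ 2.
  by rewrite {1}/w dotpBl dotpZl wnu mulr0 subr0 ew.
have c1 : c ^+ 2 <= 1 by rewrite -subr_ge0 -ww dotp_ge0.
have w1 : enorm w <= 1.
  by rewrite enorm_le// ww expr1n lerBlDr lerDl sqr_ge0.
have cn1 : `|c| <= 1 by rewrite -(expr_le1 (n := 2))// real_normK ?num_real.
suff c2 : 1 <= c ^+ 2.
  have w0 : w = 0.
    apply: enorm_eq0; apply/eqP; rewrite -sqrf_eq0 enorm_sqr ww subr_eq0.
    by rewrite eq_le c1 c2.
  have ec : e = c *: nu by apply/eqP; rewrite -subr_eq0; apply/eqP.
  have : c ^+ 2 == 1 by rewrite eq_le c1 c2.
  rewrite sqrf_eq1 => /orP[/eqP cc|/eqP cc]; rewrite ec cc.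
    by left; rewrite scale1r.
  by right; rewrite scaleN1r.
rewrite leNgt; apply/negP => c2.
have W0 : 0 < 1 - c ^+ 2 by rewrite subr_gt0.
set W := 1 - c ^+ 2 in W0 ew ww.
(* [h] is an upper bound for the height over the tangent plane, relative to the
   square of the step [s], at which [u] is known to have changed sign *)
pose h := 4 * L / m.
have h0 : 0 <= h by apply: divr_ge0; [exact: mulr_ge0|exact: ltW].
have aW : 0 < 2 * a * W by rewrite !mulr_gt0.
pose D := 1 + h + 4 / r0 + (4 + 2 * a * h) / (2 * a * W).
have D1 : 0 <= 4 / r0 by rewrite divr_ge0// ltW.
have D2 : 0 <= (4 + 2 * a * h) / (2 * a * W).
  apply: divr_ge0; last exact: ltW.
  by rewrite addr_ge0// mulr_ge0// mulr_ge0// ltW.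
have D0 : 0 < D + 1 by rewrite /D; lra.
pose s := (D + 1)^-1.
have s0 : 0 < s by rewrite invr_gt0.
have sD b : b <= D -> b * s < 1.
  by move=> bD; rewrite ltr_pdivrMr// mul1r (le_lt_trans bD)// ltrDl.
have s1 : s < 1 by rewrite -[s]mul1r; apply: sD; rewrite /D; lra.
have hs1 : h * s < 1 by apply: sD; rewrite /D; lra.
have sr : 4 * s < r0.
  by rewrite -[ltRHS]mul1r -ltr_pdivrMr// mulrAC; apply: sD; rewrite /D; lra.
have sa : (4 + 2 * a * h) * s < 2 * a * W.
  by rewrite -[ltRHS]mul1r -ltr_pdivrMr// mulrAC; apply: sD; rewrite /D; lra.
pose q t := p + (s *: w + t *: nu).
pose T := h * s ^+ 2.
have T0 : 0 <= T by rewrite mulr_ge0// sqr_ge0.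
have Ts : T <= s.
  by rewrite /T expr2 mulrA ler_piMl ?(ltW s0)// ltW.
have qp t : q t - p = s *: w + t *: nu by rewrite /q addrC addKr.
have eq t : `|t| <= T -> enorm (q t - p) <= 2 * s.
  move=> tT; rewrite qp (le_trans (enormD _ _))// !enormZ nu1 mulr1.
  rewrite gtr0_norm// mulr_natl mulr2n lerD ?(le_trans tT)//.
  by rewrite ler_piMr// ltW.
have eqr t : `|t| <= T -> enorm (q t - p) < r0 / 2.
  by move=> /eq/le_lt_trans; apply; rewrite ltr_pdivlMr//; lra.
have uq t : `|t| <= T -> `|u (q t) - mp * t| <= mp * T.
  move=> tT; have := taylor (q t) (eqr t tT).
  rewrite qp dotpDr !dotpZr wnu mulr0 add0r nn mulr1 -qp => /le_trans; apply.
  apply: (@le_trans _ _ (m * T)); last by rewrite ler_wpM2r.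
  have -> : m * T = L * (2 * s) ^+ 2.
    by rewrite /T /h; field; rewrite gt_eqF.
  by rewrite ler_wpM2l// ler_sqr ?nnegrE ?enorm_ge0 ?eq// mulr_ge0// ltW.
have [t tT ut] : exists2 t, `|t| <= T & u (q t) = 0.
  pose f t := u (q (t - T)).
  have shiftT t : 0 <= t <= 2 * T -> `|t - T| <= T.
    by move=> /andP[? ?]; rewrite ler_norml; apply/andP; split; lra.
  have cf : {within `[0, 2 * T], continuous f}.
    apply: within_continuousW => eps eps0.
    have L1 : 0 < L + 1 by rewrite ltr_wpDl.
    exists (eps / (L + 1)); first exact: divr_gt0.
    move=> t t' /shiftT tT /shiftT tT' tt'.
    have [h1 _ _] := hL _ _ (inr0 _ (eqr _ tT)) (inr0 _ (eqr _ tT')).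
    rewrite (le_lt_trans h1)//.
    have -> : q (t' - T) - q (t - T) = (t' - t) *: nu.
      rewrite /q; apply/rowP => i; rewrite !mxE; ring.
    rewrite enormZ nu1 mulr1.
    apply: (@le_lt_trans _ _ ((L + 1) * `|t' - t|)).
      by rewrite ler_wpM2r// lerDl.
    by rewrite mulrC -ltr_pdivlMr.
  have T20 : 0 <= 2 * T by rewrite mulr_ge0.
  have f0 : f 0 <= 0.
    have := uq (0 - T); rewrite /f sub0r normrN ger0_norm// lexx => /(_ isT).
    rewrite ler_norml => /andP[_]; lra.
  have fT : 0 <= f (2 * T).
    have -> : f (2 * T) = u (q T) by rewrite /f; congr (u (q _)); ring.
    have := uq T; rewrite ger0_norm// lexx => /(_ isT).
    rewrite ler_norml => /andP[]; lra.
  have [|t] := IVT (v := 0) T20 cf.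
    by rewrite ge_min f0 le_max fT orbT.
  rewrite in_itv/= => tT ft; exists (t - T) => //; exact: shiftT.
have Gq : G (q t) by apply/(Gu (hU _ (inr0 _ (eqr _ tT)))).
have := he (q t) Gq; rewrite {1}qp dotpDr !dotpZr ew -/c.
have : enorm (q t - p) ^+ 2 <= 4 * s ^+ 2.
  have -> : 4 * s ^+ 2 = (2 * s) ^+ 2 by ring.
  by rewrite ler_sqr ?nnegrE ?enorm_ge0 ?eq// mulr_ge0// ltW.
have tc : - T <= t * c.
  rewrite lerNl (le_trans (ler_norm _))// normrN normrM.
  by rewrite -[leRHS]mulr1 ler_pM.
have a20 : 0 <= 2 * a by rewrite mulr_ge0// ltW.
have := ler_wpM2l a20 tc.
have := ltr_pM2r s0 ((4 + 2 * a * h) * s) (2 * a * W); rewrite sa.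
rewrite /T; lra.
Qed.

End LocalNormal.

(** * Tangent balls on both sides *)

(** Tangential contact of order 2 and the directions of the balls that touch [G]
    at [p] from outside. *)
Definition normal_at (R : realType) (N : nat) (G : set 'rV[R]_N) (K : R)
    (p nu : 'rV[R]_N) : Prop :=
  [/\ enorm nu = 1,
      forall z, G z -> `|dotp nu (z - p)| <= K * enorm (z - p) ^+ 2 &
      forall e a, enorm e = 1 -> 0 < a ->
        (forall z, G z -> 2 * a * dotp e (z - p) <= enorm (z - p) ^+ 2) ->
        e = nu \/ e = - nu].

Lemma normal_atW (R : realType) (N : nat) (G : set 'rV[R]_N) (K K' : R) p nu :
  K <= K' -> normal_at G K p nu -> normal_at G K' p nu.
Proof.
move=> KK [h1 h2 h3]; split => // z Gz; rewrite (le_trans (h2 z Gz))//.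
by rewrite ler_wpM2r// sqr_ge0.
Qed.

Section TwoSidedBalls.
Context (R : realType) (n : nat).
Local Notation N := n.+1.
Variable (G : set 'rV[R]_N).
Hypothesis cG : closed G.
Hypothesis hG : C2_hypersurface G.

(** The constants of [local_normal] are uniform on a compact part of [G]. *)
Lemma uniform_normal (b : R) : exists2 K, 0 < K &
  forall p, G p -> enorm p <= b -> exists nu, normal_at G K p nu.
Proof.
have cK : compact (G `&` [set x | enorm x <= b]).
  apply: (@compact_enorm_ball _ _ _ b) => [|x []//].
  apply: closedI => //.
  exact: (proj1 (continuous_closedP _) (@enorm_continuous R N) _ (@closed_le _ b)).
have /compact_near_coveringP/(_ nat (\oo : set_system nat)
  (fun i p => G p -> exists nu, normal_at G i%:R p nu)) := cK.
case=> [p0 [Gp0 _]|m _ hm].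
  have [k [sk dk]] := hG Gp0.
  have [r [K [r0 K0 _ hr]]] := local_normal sk dk Gp0.
  have hK : \forall i \near \oo, K <= i%:R :> R by exact: nbhs_infty_ger.
  exists ([set p | enorm (p0 - p) < r], [set i | K <= i%:R]).
    by split => //=; exact: enorm_nbhs.
  move=> [p i] /= [pr Ki] Gp; exists (unit_grad k p).
  by apply: normal_atW Ki _; apply: hr => //; rewrite enormB.
exists m.+1%:R => // p Gp pb.
by apply: (hm m.+1) => //=; exact: leqW.
Qed.

Hypothesis G0 : G !=set0.

(** A point at distance [q] from the centre of a ball, moved by [D]: convexity
    of the norm, to first order. *)
Lemma enorm_shift_le (e D : 'rV[R]_N) (q : R) : enorm e = 1 -> 0 < q ->
  enorm (D + q *: e) <= q + dotp e D + enorm D ^+ 2 / (2 * q).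
Proof.
move=> e1 q0; have q2 : 0 < 2 * q by rewrite mulr_gt0.
have -> : q + dotp e D + enorm D ^+ 2 / (2 * q) =
    (enorm (D + q *: e) ^+ 2 + q ^+ 2) / (2 * q).
  rewrite !enorm_sqr dotpDl !dotpDr !dotpZl !dotpZr (dotpC D e).
  by rewrite -(enorm_sqr e) e1; field; rewrite gt_eqF.
rewrite ler_pdivlMr//.
have := sqr_ge0 (enorm (D + q *: e) - q); rewrite sqrrB; lra.
Qed.

(** The two balls of radius [1 / (2 K)] that touch [G] at [p] do not meet [G]:
    the distance to [G] is at least the distance to their complements. *)
Lemma dst_ge_balls (K a : R) (p e y : 'rV[R]_N) : 0 < K -> enorm e = 1 ->
  (forall z, G z -> `|dotp e (z - p)| <= K * enorm (z - p) ^+ 2) ->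
  0 <= a -> a * (4 * K) <= 1 ->
  `|a + dotp e (y - (p + a *: e))| - 2 * K * enorm (y - (p + a *: e)) ^+ 2
    <= dst G y.
Proof.
move=> K0 e1 he a0 aK; set D := y - (p + a *: e).
have [z [Gz _ _ ->]] := nearest_point cG y G0.
pose s := (2 * K)^-1; have s0 : 0 < s by rewrite invr_gt0 mulr_gt0.
have sK : s * (2 * K) = 1 by rewrite mulVf// gt_eqF// mulr_gt0.
have as2 : 2 * a <= s.
  by rewrite -[leRHS]mul1r ler_pdivlMr ?mulr_gt0//; lra.
have ball sg : `|sg| = 1 -> s <= enorm (z - (p + (sg * s) *: e)).
  move=> sg1; rewrite ge_enorm ?(ltW s0)// opprD addrA.
  have := he z Gz; move: (z - p) => zz hzz.
  rewrite dotpBl !dotpBr !dotpZl !dotpZr (dotpC zz e).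
  rewrite -(enorm_sqr e) e1 expr1n mulr1 -enorm_sqr.
  have sg2 : sg ^+ 2 = 1 by rewrite -real_normK ?num_real// sg1 expr1n.
  have : 2 * s * (sg * dotp e zz) <= enorm zz ^+ 2.
    apply: (@le_trans _ _ (2 * s * (K * enorm zz ^+ 2))).
      rewrite ler_wpM2l ?mulr_ge0 ?(ltW s0)//.
      by rewrite (le_trans (ler_norm _))// normrM sg1 mul1r.
    have -> : 2 * s * (K * enorm zz ^+ 2) = s * (2 * K) * enorm zz ^+ 2 by ring.
    by rewrite sK mul1r.
  have -> : enorm zz ^+ 2 - sg * s * dotp e zz -
      (sg * s * dotp e zz - sg * s * (sg * s)) =
    enorm zz ^+ 2 - 2 * s * (sg * dotp e zz) + sg ^+ 2 * s ^+ 2 by ring.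
  by rewrite sg2; lra.
have Dn := sqr_ge0 (enorm D).
have bnd q : s <= 2 * q -> enorm D ^+ 2 / (2 * q) <= 2 * K * enorm D ^+ 2.
  move=> sq; have q0 : 0 < 2 * q by exact: lt_le_trans sq.
  rewrite ler_pdivrMr// mulrAC ler_peMl//.
  rewrite mulrC -ler_pdivrMr; first by rewrite div1r.
  by rewrite mulr_gt0.
rewrite lerBlDr ler_norml; apply/andP; split; last first.
  have := ball 1 (normr1 _); rewrite mul1r => h1.
  have h2 := enorm_triangle z y (p + s *: e).
  have h3 : enorm (y - (p + s *: e)) <=
      (s - a) - dotp e D + enorm D ^+ 2 / (2 * (s - a)).
    have -> : y - (p + s *: e) = - (- D + (s - a) *: e).
      by rewrite /D; apply/rowP => i; rewrite !mxE; ring.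
    rewrite enormN; have sa0 : 0 < s - a by lra.
    by have := enorm_shift_le (- D) e1 sa0; rewrite dotpNr enormN.
  have := bnd (s - a); rewrite (enormB y z) => /(_ _)/wrap[]; first by lra.
  move: h1 h2 h3; lra.
have := ball (-1); rewrite normrN1 mulN1r => /(_ erefl) h1.
have h2 := enorm_triangle z y (p + - s *: e).
have h3 : enorm (y - (p + - s *: e)) <=
    (s + a) + dotp e D + enorm D ^+ 2 / (2 * (s + a)).
  have -> : y - (p + - s *: e) = D + (s + a) *: e.
    by rewrite /D; apply/rowP => i; rewrite !mxE; ring.
  by apply: enorm_shift_le => //; lra.
have := bnd (s + a); rewrite (enormB y z) => /(_ _)/wrap[]; first by lra.
move: h1 h2 h3; lra.
Qed.

(** The vector [e] is the direction from the nearest point [p] of [G] to [x].  The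
    ball around [x] through [p] touches [G] from outside, so [e] is normal to [G]
    at [p] and [dst_ge_balls] applies if [x] is close to [p]. *)
Lemma two_sided (b : R) : exists rho K, [/\ 0 < rho, 0 < K &
  forall x, enorm x <= b -> 0 < dst G x < rho ->
  exists e, [/\ enorm e = 1,
    exists2 p, G p & x = p + dst G x *: e &
    forall y, `|dst G x + dotp e (y - x)| - K * enorm (y - x) ^+ 2 <= dst G y]].
Proof.
have [K K0 hK] := uniform_normal (b + 1).
have K40 : 0 < 4 * K by rewrite mulr_gt0.
exists (Num.min 1 (4 * K)^-1), (2 * K); split.
- by rewrite lt_min ltr01 invr_gt0.
- by rewrite mulr_gt0.
move=> x xb /andP[d0]; rewrite lt_min => /andP[d1 dK].
have [p [Gp hp _ dp]] := nearest_point cG x G0.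
set a := dst G x in d0 d1 dK dp *.
pose e := a^-1 *: (x - p).
have xE : x - p = a *: e by rewrite /e scalerA mulfV ?gt_eqF// scale1r.
have e1 : enorm e = 1.
  by rewrite /e enormZ -dp gtr0_norm ?invr_gt0// mulVf// gt_eqF.
clearbody e.
have xpE : x = p + a *: e by rewrite -xE addrC subrK.
have pb : enorm p <= b + 1.
  have := enormD x (- (x - p)); rewrite subKr enormN -dp.
  by move/le_trans; apply; rewrite lerD// ltW.
have [nu [nu1 nuK nue]] := hK p Gp pb.
have ee : e = nu \/ e = - nu.
  apply: (nue e a) => // z Gz.
  have := hp z Gz; rewrite -dp.
  have -> : x - z = a *: e - (z - p).
    by rewrite -xE opprB addrA subrK.
  move: (z - p) => zz.
  rewrite ge_enorm ?(ltW d0)// dotpBl !dotpBr !dotpZl !dotpZr (dotpC zz e).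
  rewrite -(enorm_sqr e) e1 expr1n -enorm_sqr; lra.
exists e; split => //; first by exists p.
move=> y; rewrite xpE; apply: dst_ge_balls => //; last 2 first.
- exact: ltW.
- by move: dK; rewrite -[X in _ < X]mul1r ltr_pdivlMr// => /ltW.
move=> z Gz; case: ee => ->; first exact: nuK.
by rewrite dotpNl normrN nuK.
Qed.

(** Off [G] the direction [e] is the gradient of the distance, hence the limit
    of difference quotients. *)
Lemma two_sided_gradient (K : R) (x e : 'rV[R]_N) j : 0 < K -> enorm e = 1 ->
  0 < dst G x -> (exists2 p, G p & x = p + dst G x *: e) ->
  (forall y, `|dst G x + dotp e (y - x)| - K * enorm (y - x) ^+ 2 <= dst G y) ->
  (fun m : nat => m.+1%:R *
    (dst G (x + m.+1%:R^-1 *: delta_mx 0 j) - dst G x)) @ \oo --> e 0 j.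
Proof.
move=> K0 e1 d0 [p Gp xE] he; apply/cvgrPdist_le => eps eps0.
set a := dst G x in d0 xE he *.
pose C := K + (2 * a)^-1.
have C0 : 0 < C by rewrite addr_gt0// invr_gt0 mulr_gt0.
have := @cvg_harmonic R => /cvgrPdist_le/(_ (eps / C) (divr_gt0 eps0 C0)).
apply: filterS => m; rewrite sub0r normrN /harmonic/= ger0_norm ?invr_ge0//.
set t := m.+1%:R^-1; have t0 : 0 < t by rewrite invr_gt0.
have -> : m.+1%:R = t^-1 by rewrite invrK.
rewrite ler_pdivlMr// => tC.
set y := x + t *: delta_mx 0 j.
have yx : y - x = t *: delta_mx 0 j by rewrite /y addrC addKr.
have eD : enorm (y - x) = t by rewrite yx enorm_delta gtr0_norm.
have dD : dotp e (y - x) = t * e 0 j.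
  rewrite yx dotpZr /dotp (bigD1 j)//= mxE !eqxx mulr1 big1 ?addr0// => i ij.
  by rewrite mxE (negbTE ij) andbF mulr0.
have lo : a + t * e 0 j - K * t ^+ 2 <= dst G y.
  by apply: le_trans (he y); rewrite dD eD lerD2r ler_norm.
have hi : dst G y <= a + t * e 0 j + t ^+ 2 / (2 * a).
  rewrite (le_trans (dst_le cG G0 y Gp))//.
  have -> : y - p = (y - x) + a *: e by rewrite [in RHS]xE opprD addrA subrK.
  by have := enorm_shift_le (y - x) e1 d0; rewrite dD eD.
have -> : e 0 j - t^-1 * (dst G y - a) = t^-1 * (t * e 0 j - (dst G y - a)).
  by field; rewrite gt_eqF.
rewrite normrM gtr0_norm ?invr_gt0// mulrC ler_pdivrMr//.
apply: (@le_trans _ _ (t * C * t)); last by rewrite ler_wpM2r// ltW.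
have -> : t * C * t = K * t ^+ 2 + t ^+ 2 / (2 * a) by rewrite /C; field; rewrite gt_eqF.
have h1 : 0 <= K * t ^+ 2 by rewrite mulr_ge0 ?sqr_ge0// ltW.
have h2 : 0 <= t ^+ 2 / (2 * a) by rewrite divr_ge0 ?sqr_ge0// mulr_ge0// ltW.
by rewrite ler_norml; apply/andP; split; lra.
Qed.

(** The directions [e] can be chosen measurably, as limits of difference
    quotients of the distance. *)
Lemma two_sided_measurable (b : R) : exists rho K
    (E : 'rV[R]_N -> 'rV[R]_N), [/\ 0 < rho, 0 < K,
  forall j, measurable_fun [set x : borelV R N | enorm x <= b /\ 0 < dst G x < rho]
    ((fun x => E x 0 j) : borelV R N -> R) &
  forall x, enorm x <= b -> 0 < dst G x < rho -> enorm (E x) = 1 /\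
    forall y, `|dst G x + dotp (E x) (y - x)| - K * enorm (y - x) ^+ 2
      <= dst G y].
Proof.
have [rho [K [rho0 K0 h]]] := two_sided b.
pose D := [set x : borelV R N | enorm x <= b /\ 0 < dst G x < rho].
have hE x : exists e, D x -> [/\ enorm e = 1,
    exists2 p, G p & x = p + dst G x *: e
  & forall y, `|dst G x + dotp e (y - x)| - K * enorm (y - x) ^+ 2 <= dst G y].
  have [[xb dx]|nD] := pselect (D x); last by exists 0 => /nD.
  by have [e he] := h x xb dx; exists e.
have [E {}hE] := choice hE.
exists rho, K, E; split => // [j|x xb dx]; last first.
  by have [//|e1 _ he] := hE x.
apply: (@measurable_fun_cvg _ (borelV R N) R D (fun m (x : borelV R N) =>
  m.+1%:R * (dst G (x + m.+1%:R^-1 *: delta_mx 0 j) - dst G x))).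
  move=> m; apply: measurable_funTS; apply: continuous_borel_fun.
  apply: (@lipschitz_enorm_continuous _ _ _ (m.+1%:R * 2)) => x y.
  rewrite -mulrBr normrM ger0_norm// -mulrA ler_wpM2l//.
  have h1 := dst_lip cG G0 (x + m.+1%:R^-1 *: delta_mx 0 j)
    (y + m.+1%:R^-1 *: delta_mx 0 j).
  have h2 := dst_lip cG G0 x y.
  rewrite [X in enorm X](_ : _ = x - y) in h1; last first.
    by rewrite opprD addrACA subrr addr0.
  set d1 := dst G _ in h1 *; set d2 := dst G (y + _) in h1 *.
  have -> : d1 - dst G x - (d2 - dst G y) = (d1 - d2) - (dst G x - dst G y).
    by ring.
  rewrite (le_trans (ler_normB _ _))// mulr_natl mulr2n lerD//.
move=> x Dx; have [e1 ep he] := hE x Dx.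
by apply: (two_sided_gradient K0) => //; case: Dx => _ /andP[].
Qed.

End TwoSidedBalls.

(** * Test functions of the distance *)

Section Hinge.
Context (R : realType).
Implicit Types (a b del t : R).

Definition slope a del t : R := Num.min (Num.max (t - a) 0) del.

(** The convex function with second derivative the indicator of [[a, a + del]]
    that vanishes before [a]; [slope] is its derivative. *)
Definition hinge a del t : R := slope a del t * (t - a) - 2^-1 * slope a del t ^+ 2.

Lemma slopeP a del t : 0 <= del ->
  [\/ t <= a /\ slope a del t = 0,
      [/\ a <= t, t <= a + del & slope a del t = t - a] |
      a + del <= t /\ slope a del t = del].
Proof.
move=> d0; rewrite /slope; case: (leP (t - a) 0) => h1.
  by apply: Or31; split; [lra|rewrite min_l].
case: (leP (t - a) del) => h2.
  by apply: Or32; split => //; lra.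
by apply: Or33; split => //; lra.
Qed.

Lemma slope_itv a del t : 0 <= del -> 0 <= slope a del t <= del.
Proof.
by move=> d0; case: (slopeP a t d0) => [[h ->]|[h1 h2 ->]|[h ->]];
  apply/andP; split; lra.
Qed.

Lemma hinge_convex a del s t : 0 <= del ->
  hinge a del s + slope a del s * (t - s) <= hinge a del t.
Proof.
move=> d0; rewrite -subr_ge0.
rewrite (_ : _ - _ = (slope a del t - slope a del s) *
  ((t - a) - 2^-1 * (slope a del t + slope a del s))); last first.
  by rewrite /hinge; field.
have /andP[s0 s1] := slope_itv a s d0.
case: (slopeP a t d0) => [[h ->]|[h1 h2 ->]|[h ->]].
- by rewrite sub0r mulNr -mulrN mulr_ge0//; lra.
- have -> : (t - a - slope a del s) * (t - a - 2^-1 * (t - a + slope a del s)) =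
      2^-1 * (t - a - slope a del s) ^+ 2 by field.
  by rewrite mulr_ge0// sqr_ge0.
- by rewrite mulr_ge0//; lra.
Qed.

Lemma hinge_upper a del s t : 0 <= del ->
  hinge a del t <= hinge a del s + slope a del s * (t - s) + 2^-1 * (t - s) ^+ 2.
Proof.
move=> d0; rewrite -subr_ge0 /hinge.
have Q (x y z : R) : 0 <= z -> x = 2^-1 * y ^+ 2 + z -> 0 <= x.
  by move=> z0 ->; rewrite addr_ge0// mulr_ge0// sqr_ge0.
case: (slopeP a s d0) => [[h ->]|[h1 h2 ->]|[h ->]];
  case: (slopeP a t d0) => [[k ->]|[k1 k2 ->]|[k ->]].
- by apply: (Q _ (t - s) 0) => //; field.
- apply: (Q _ (s - a) ((t - a) * (a - s))); last by field.
  by rewrite mulr_ge0 ?subr_ge0.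
- have z0 : 0 <= (t - a) * (a - s) by rewrite mulr_ge0; lra.
  apply: (Q _ (t - a - del) (2^-1 * (s - a) ^+ 2 + (t - a) * (a - s))).
    by rewrite addr_ge0// mulr_ge0// sqr_ge0.
  by field.
- by apply: (Q _ (t - a) 0) => //; field.
- by apply: (Q _ 0 0) => //; field.
- by apply: (Q _ (t - a - del) 0) => //; field.
- apply: (Q _ (t - a) (2^-1 * ((s - a - del) * (s - a + del - 2 * (t - a))))).
    by rewrite !mulr_ge0//; lra.
  by field.
- apply: (Q _ 0 (2^-1 * ((s - a - del) * (s - a + del - 2 * (t - a))))).
    by rewrite !mulr_ge0//; lra.
  by field.
- by apply: (Q _ (t - s) 0) => //; field.
Qed.

Lemma hinge_quadratic a del s t : 0 <= del -> a <= s <= a + del ->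
  a <= t <= a + del ->
  hinge a del t = hinge a del s + slope a del s * (t - s) + 2^-1 * (t - s) ^+ 2.
Proof.
have E r : 0 <= del -> a <= r <= a + del -> slope a del r = r - a.
  move=> d0 /andP[h1 h2]; case: (slopeP a r d0) => [[h ->]|[_ _ ->]//|[h ->]]; lra.
by move=> d0 hs ht; rewrite /hinge !E//; field.
Qed.

Lemma hinge_before a del t : 0 <= del -> t <= a -> hinge a del t = 0.
Proof.
move=> d0 ta; rewrite /hinge; case: (slopeP a t d0) => [[h ->]|[h1 h2 ->]|[h ->]].
- by field.
- by rewrite (_ : t = a); [field|lra].
- have -> : del = 0 by lra.
  by field.
Qed.

Lemma hinge_after a del t : 0 <= del -> a + del <= t ->
  hinge a del t = del * (t - a) - 2^-1 * del ^+ 2.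
Proof.
move=> d0 ta; rewrite /hinge; case: (slopeP a t d0) => [[h ->]|[h1 h2 ->]|[h ->//]].
- have -> : del = 0 by lra.
  by field.
- by rewrite (_ : t = a + del); [field|lra].
Qed.

End Hinge.

Section Phi.
Context (R : realType).
Variables (al del r : R).
Hypotheses (r0 : 0 < r) (del0 : 0 <= del) (adr : al + del <= r).

(** Nondecreasing, constant outside [[al, 2 r]], with second derivative 1 on
    [[al, al + del]] and at least [- del / r] everywhere. *)
Definition phi (t : R) : R := hinge al del t - del / r * hinge r r t.

Definition dphi (t : R) : R := slope al del t - del / r * slope r r t.

Let r0' : 0 <= r. Proof. exact: ltW. Qed.
Let dr0 : 0 <= del / r. Proof. by rewrite divr_ge0. Qed.

Lemma dphi_itv t : 0 <= dphi t <= del.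
Proof.
have [r0_ del0_ adr_] : [/\ 0 < r, 0 <= del & al + del <= r] by [].
rewrite /dphi; have /andP[s0 s1] := slope_itv al t del0.
have /andP[s2 s3] := slope_itv r t r0'.
have h1 : 0 <= del / r * slope r r t by rewrite mulr_ge0.
apply/andP; split; last by rewrite lerBlDr (le_trans s1)// lerDl.
case: (slopeP r t r0') => [[h ->]|[h1' h2 ->]|[h ->]].
- by rewrite mulr0 subr0.
- case: (slopeP al t del0) => [[k _]|[k1 k2 _]|[k ->]].
  + have tr : t = r.
      apply/le_anti/andP; split => //.
      by rewrite (le_trans k)// (le_trans _ adr)// lerDl.
    by rewrite tr subrr mulr0 subr0 -tr.
  + have tr : t = r.
      apply/le_anti/andP; split => //.
      by rewrite (le_trans k2).
    by rewrite tr subrr mulr0 subr0 -tr.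
  + rewrite subr_ge0 mulrAC ler_pdivrMr// ler_wpM2l//; lra.
- rewrite divfK ?gt_eqF//.
  by case: (slopeP al t del0) => [[k _]|[k1 k2 _]|[k ->]]; lra.
Qed.

Lemma dphi_eq0 t : t <= al \/ 2 * r <= t -> dphi t = 0.
Proof.
have [r0_ del0_ adr_] : [/\ 0 < r, 0 <= del & al + del <= r] by [].
rewrite /dphi => -[h|h].
  have -> : slope al del t = 0.
    by case: (slopeP al t del0) => [[k ->]|[k1 k2 ->]|[k ->]]; lra.
  have -> : slope r r t = 0.
    by case: (slopeP r t r0') => [[k ->]|[k1 k2 ->]|[k ->]]; lra.
  by rewrite mulr0 subrr.
have -> : slope al del t = del.
  by case: (slopeP al t del0) => [[k ->]|[k1 k2 ->]|[k ->]]; lra.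
have -> : slope r r t = r.
  by case: (slopeP r t r0') => [[k ->]|[k1 k2 ->]|[k ->]]; lra.
by rewrite divfK ?gt_eqF// subrr.
Qed.

Lemma phi_lower s t : phi s + dphi s * (t - s) - 2^-1 * (del / r) * (t - s) ^+ 2
  <= phi t.
Proof.
have h1 := hinge_convex al s t del0.
have := ler_wpM2l dr0 (hinge_upper r s t r0').
rewrite /phi /dphi; set c := del / r; lra.
Qed.

Lemma phi_lower_in s t : al <= s <= al + del -> al <= t <= al + del ->
  phi s + dphi s * (t - s) + 2^-1 * (t - s) ^+ 2
   - 2^-1 * (del / r) * (t - s) ^+ 2 <= phi t.
Proof.
move=> hs ht; have h1 := hinge_quadratic del0 hs ht.
have := ler_wpM2l dr0 (hinge_upper r s t r0').
rewrite /phi /dphi h1; set c := del / r; lra.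
Qed.

Lemma phi_mono s t : s <= t -> phi s <= phi t.
Proof.
have [r0_ del0_ adr_] : [/\ 0 < r, 0 <= del & al + del <= r] by [].
have low a b : a <= b -> b <= r -> phi a <= phi b.
  move=> ab br; rewrite /phi !(hinge_before r0') ?(le_trans ab)//.
  rewrite mulr0 !subr0 (le_trans _ (hinge_convex al a b del0))// lerDl.
  rewrite mulr_ge0 ?subr_ge0//.
  by have /andP[] := slope_itv al a del0.
have high a b : a <= b -> r <= a -> phi a <= phi b.
  move=> ab ra; rewrite /phi.
  have := ler_wpM2l dr0 (hinge_convex r b a r0').
  rewrite !(hinge_after del0) ?(le_trans adr) ?(le_trans ra)//.
  have : del / r * slope r r b * (b - a) <= del * (b - a).
    rewrite ler_wpM2r ?subr_ge0// mulrAC ler_pdivrMr// ler_wpM2l//.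
    by have /andP[] := slope_itv r b r0'.
  set c := del / r; lra.
move=> st; have [tr|tr] := leP t r; first exact: low.
have [rs|rs] := leP r s; first exact: high.
by rewrite (le_trans (low _ _ (ltW rs) (lexx _)))// high// ltW.
Qed.

Lemma phi_itv t : 0 <= al -> 0 <= phi t <= 2 * del * r.
Proof.
have [r0_ del0_ adr_] : [/\ 0 < r, 0 <= del & al + del <= r] by [].
move=> al0; apply/andP; split.
  have -> : 0 = phi (Num.min al t).
    rewrite /phi !hinge_before ?mulr0 ?subr0// ge_min ?lexx//.
    by apply/orP; left; lra.
  by apply: phi_mono; rewrite ge_min lexx orbT.
apply: (@le_trans _ _ (phi (Num.max t (2 * r)))).
  by apply: phi_mono; rewrite le_max lexx.
set u := Num.max _ _; have u2 : 2 * r <= u by rewrite le_max lexx orbT.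
have [u3 u4] : r + r <= u /\ al + del <= u by split; lra.
rewrite /phi !hinge_after//.
have -> : del / r * (r * (u - r) - 2^-1 * r ^+ 2) = del * (u - r) - 2^-1 * del * r.
  by field; rewrite gt_eqF.
have h1 : 0 <= del * al by rewrite mulr_ge0.
have h2 : 0 <= del ^+ 2 by rewrite sqr_ge0.
have h3 : 0 <= del * r by rewrite mulr_ge0.
lra.
Qed.

End Phi.

Section PhiStep.
Context (R : realType).
Variables (al del r K eta a D ed d' : R).
Hypotheses (r0 : 0 < r) (del0 : 0 <= del) (adr : al + del <= r).
Hypotheses (K0 : 0 <= K) (D0 : 0 <= D) (Deta : D <= eta) (Keta : K * eta <= 1).

Local Notation phi := (phi al del r).
Local Notation dphi := (dphi al del r).

Lemma phi_step_flat : dphi a = 0 -> `|d' - a| <= D ->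
  phi a - 2^-1 * (del / r) * D ^+ 2 <= phi d'.
Proof.
move=> da dD; apply: (le_trans _ (phi_lower al r0 del0 a d')).
rewrite da mul0r addr0 lerD2l lerN2 ler_wpM2l//.
  by rewrite mulr_ge0// divr_ge0// ltW.
by rewrite -[leLHS]real_normK ?num_real// ler_sqr ?nnegrE.
Qed.

(** [a] is the distance at the present point, [ed] the component of the
    displacement along [e], [D] its norm and [d'] the new distance. *)
Hypothesis hed : `|ed| <= D.
Hypothesis hd' : `|a + ed| - K * D ^+ 2 <= d'.

Let KD : K * D <= 1.
Proof. by rewrite (le_trans _ Keta)// ler_wpM2l. Qed.

Let L := a + ed - K * D ^+ 2.

Let KD2 : 0 <= K * D ^+ 2 <= D.
Proof.
by rewrite mulr_ge0 ?sqr_ge0//= expr2 mulrA ler_piMl.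
Qed.

Let La : `|L - a| <= 2 * D.
Proof.
have D0_ := D0.
move: hed; rewrite !ler_norml => /andP[h1 h2]; have /andP[h3 h4] := KD2.
by rewrite /L; apply/andP; split; lra.
Qed.

Let Ld' : L <= d'.
Proof. by rewrite (le_trans _ hd')// /L lerD2r ler_norm. Qed.

Let La2 : (L - a) ^+ 2 <= 4 * D ^+ 2.
Proof.
have -> : 4 * D ^+ 2 = (2 * D) ^+ 2 by ring.
by rewrite -[leLHS]real_normK ?num_real// ler_sqr ?nnegrE ?mulr_ge0.
Qed.

Let dphiL : dphi a * ed - del * K * D ^+ 2 <= dphi a * (L - a).
Proof.
have /andP[h1 h2] := dphi_itv r0 del0 adr a.
have -> : L - a = ed - K * D ^+ 2 by rewrite /L; ring.
have /andP[h3 _] := KD2.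
rewrite mulrBr lerD2l lerN2 -mulrA; exact: ler_wpM2r.
Qed.

Let dr2 : 0 <= 2^-1 * (del / r).
Proof. by rewrite mulr_ge0// divr_ge0// ltW. Qed.

(** Since [phi] is nondecreasing, [d'] may be replaced by its lower bound [L]. *)
Lemma phi_step_convex :
  phi a + dphi a * ed - (del * K + 2 * (del / r)) * D ^+ 2 <= phi d'.
Proof.
apply: (le_trans _ (phi_mono r0 del0 adr Ld')).
apply: (le_trans _ (phi_lower al r0 del0 a L)).
have := ler_wpM2l dr2 La2; have := dphiL; set c := del / r; lra.
Qed.

(** Both [a] and [L] are in the interval where the second derivative is 1. *)
Lemma phi_step_in : al + 2 * eta <= a <= al + del - 2 * eta ->
  phi a + dphi a * ed + 2^-1 * ed ^+ 2
    - (del * K + 2 * (del / r) + K * eta) * D ^+ 2 <= phi d'.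
Proof.
have [D0_ Deta_] := (D0, Deta).
move=> /andP[a1 a2].
apply: (le_trans _ (phi_mono r0 del0 adr Ld')).
have := La; rewrite ler_norml => /andP[l1 l2].
apply: (le_trans _ (phi_lower_in r0 del0 (s := a) (t := L) _ _)); last 2 first.
- by apply/andP; split; lra.
- by apply/andP; split; lra.
have := ler_wpM2l dr2 La2; have := dphiL.
have : ed ^+ 2 - 2 * (K * eta * D ^+ 2) <= (L - a) ^+ 2.
  have -> : L - a = ed - K * D ^+ 2 by rewrite /L; ring.
  have h : ed * (K * D ^+ 2) <= K * eta * D ^+ 2.
    rewrite mulrCA -mulrA ler_wpM2l// ler_wpM2r ?sqr_ge0//.
    by rewrite (le_trans _ Deta)// (le_trans (ler_norm _)).
  have h2 := sqr_ge0 (K * D ^+ 2).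
  rewrite sqrrB; lra.
set c := del / r; lra.
Qed.

(** With [al = 0] the function [phi] is [t ^+ 2 / 2] near the origin and the
    estimate holds across [G], where [a + ed] changes sign. *)
Lemma phi_step_origin : al = 0 -> 0 <= a -> a + 2 * eta <= del ->
  d' <= a + eta ->
  phi a + dphi a * ed + 2^-1 * ed ^+ 2 - K * del * D ^+ 2 <= phi d'.
Proof.
have [[r0_ del0_ adr_] [D0_ Deta_]] :
  [/\ 0 < r, 0 <= del & al + del <= r] /\ 0 <= D /\ D <= eta by [].
move=> al0 a0 ad d'a.
have eta0 : 0 <= eta by exact: le_trans Deta.
have phiE t : 0 <= t <= del -> phi t = 2^-1 * t ^+ 2.
  move=> /andP[t0 t1]; rewrite /phi al0.
  rewrite (hinge_before (ltW r0)); last by lra.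
  have hz : 0 <= (0 : R) <= 0 + del by rewrite lexx add0r.
  have ht : 0 <= t <= 0 + del by rewrite t0 add0r.
  rewrite (hinge_quadratic del0 hz ht) hinge_before//.
  by case: (slopeP 0 0 del0) => [[_ ->]|[_ _ ->]|[d0' ->]]; [ring|ring|];
    rewrite (_ : del = 0); [ring|lra].
have dphiE : dphi a = a.
  rewrite /dphi al0.
  have -> : slope 0 del a = a.
    by case: (slopeP 0 a del0) => [[h ->]|[h1 h2 ->]|[h ->]]; lra.
  have -> : slope r r a = 0.
    by case: (slopeP r a (ltW r0)) => [[h ->]|[h1 h2 ->]|[h ->]]; lra.
  by rewrite mulr0 subr0.
have /andP[h1 h2] : - D <= ed <= D by rewrite -ler_norml.
pose m := `|a + ed|.
have m0 : 0 <= m by rewrite normr_ge0.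
have md : m <= del by rewrite ler_norml; apply/andP; split; lra.
have mm : m ^+ 2 = (a + ed) ^+ 2 by rewrite real_normK ?num_real.
have KD20 : 0 <= K * D ^+ 2 by case/andP: KD2.
have mK : m * (K * D ^+ 2) <= del * (K * D ^+ 2) by rewrite ler_wpM2r.
rewrite (phiE a) ?a0/=; last by lra.
rewrite dphiE (_ : 2^-1 * a ^+ 2 + a * ed + 2^-1 * ed ^+ 2 = 2^-1 * m ^+ 2);
  last by rewrite mm; field.
have [h|h] := leP (K * D ^+ 2) m; last first.
  apply: (@le_trans _ _ 0).
    have : m * m <= m * (K * D ^+ 2) by rewrite ler_wpM2l// ltW.
    have := mulr_ge0 m0 m0; rewrite expr2; lra.
  have h0 : 0 <= 2 * del * r by rewrite !mulr_ge0// ltW.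
  have al0' : 0 <= al by rewrite al0.
  by have /andP[h3 _] := phi_itv r0 del0 adr d' al0'; lra.
have d'0 : m - K * D ^+ 2 <= d' by exact: hd'.
rewrite (phiE d'); last by apply/andP; split; lra.
apply: (@le_trans _ _ (2^-1 * (m - K * D ^+ 2) ^+ 2)).
  have := sqr_ge0 (K * D ^+ 2).
  rewrite sqrrB; lra.
rewrite ler_wpM2l// ler_sqr ?nnegrE ?subr_ge0//; lra.
Qed.

End PhiStep.

(** * Occupation of tubes and of the hypersurface *)

Section SpaceOccupation.
Context (R : realType) (n : nat).
Local Notation N := n.+1.
Variable (G : set 'rV[R]_N).
Hypothesis cG : closed G.
Hypothesis hG : C2_hypersurface G.
Hypothesis G0 : G !=set0.
Variable mu : {measure set (borelV R N) -> \bar R}.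
Variables (b K0 : R) (hb : 0 <= b) (hK0 : 0 <= K0).
Hypothesis hmu : forall (S : set (borelV R N)) h p v (Bh Pm kap e0 : R),
  measurable S -> 0 <= Pm -> 0 <= kap -> 0 < e0 <= 1 ->
  occ_test b S h p v Bh Pm kap e0 ->
  (mu S <= (K0 * (Bh + Pm + kap + e0))%:E)%E.

Local Notation d := (dst G).

Lemma borel_dst : borel_fun d.
Proof. by apply: continuous_borel_fun; exact: dst_continuous. Qed.

Lemma measurable_dst_itv (i : interval R) :
  measurable ([set x | d x \in i] : set (borelV R N)).
Proof.
rewrite -[X in measurable X]setTI.
exact: (borel_dst measurableT (measurable_itv i)).
Qed.

Lemma measurable_enorm_ball (p : 'rV[R]_N) (s : R) :
  measurable ([set x | enorm (x - p) < s] : set (borelV R N)).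
Proof.
have cf : continuous (fun x : 'rV[R]_N => enorm (x - p)).
  apply: (@lipschitz_enorm_continuous _ _ _ 1) => x y; rewrite mul1r.
  by rewrite (le_trans (enorm_lip _ _))// opprB addrA subrK.
have := continuous_borel_fun cf measurableT (measurable_itv `]-oo, s[).
by rewrite setTI; congr measurable; apply/seteqP; split => x /=; rewrite in_itv.
Qed.

Lemma borel_funM (f g : 'rV[R]_N -> R) : borel_fun f -> borel_fun g ->
  borel_fun (fun x => f x * g x).
Proof. exact: (@measurable_funM _ (borelV R N)). Qed.

Lemma borel_funD (f g : 'rV[R]_N -> R) : borel_fun f -> borel_fun g ->
  borel_fun (fun x => f x + g x).
Proof. exact: (@measurable_funD _ (borelV R N)). Qed.

Lemma borel_indic (A : set (borelV R N)) : measurable A ->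
  borel_fun (\1_A : 'rV[R]_N -> R).
Proof. by move=> mA; exact: (@measurable_indic _ (borelV R N)). Qed.

Lemma borel_slope al del (f : 'rV[R]_N -> R) : borel_fun f ->
  borel_fun (fun x => slope al del (f x)).
Proof.
move=> mf; apply: (@measurable_minr _ (borelV R N)) => //.
apply: (@measurable_maxr _ (borelV R N)) => //.
by apply: (@measurable_funB _ (borelV R N)).
Qed.

Lemma borel_dphi al del r : borel_fun (fun x => dphi al del r (d x)).
Proof.
apply: (@measurable_funB _ (borelV R N)).
  by apply: borel_slope; exact: borel_dst.
apply: borel_funM; first exact: measurable_cst.
by apply: borel_slope; exact: borel_dst.
Qed.

Variables (rho K : R) (E : 'rV[R]_N -> 'rV[R]_N).
Hypotheses (rho0 : 0 < rho) (hK : 0 < K).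
Local Notation bN := (N%:R * b).
Let Dm := [set x : borelV R N | enorm x <= bN /\ 0 < d x < rho].
Hypothesis mE : forall j, measurable_fun Dm ((fun x => E x 0 j) : borelV R N -> R).
Hypothesis hE : forall x, enorm x <= bN -> 0 < d x < rho -> enorm (E x) = 1 /\
    forall y, `|d x + dotp (E x) (y - x)| - K * enorm (y - x) ^+ 2 <= d y.

Let r := rho / 3.
Let r0 : 0 < r. Proof. by rewrite divr_gt0. Qed.

Let Ep j : 'rV[R]_N -> R := (fun x => E x 0 j) \_ Dm.

Lemma measurable_Dm : measurable Dm.
Proof.
have -> : Dm = (@enorm R N @^-1` `]-oo, bN]%classic) `&`
    [set x | d x \in `]0, rho[].
  by apply/seteqP; split => x /=; rewrite !in_itv.
apply: measurableI; last exact: measurable_dst_itv.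
rewrite -[X in measurable X]setTI.
by apply: (continuous_borel_fun (@enorm_continuous R N)) => //; exact: measurable_itv.
Qed.

Lemma borel_Ep j : borel_fun (Ep j).
Proof.
have := mE j; rewrite (measurable_restrictT _ measurable_Dm).
exact.
Qed.

Lemma Ep_in x j : Dm x -> Ep j x = E x 0 j.
Proof. by move=> Dx; rewrite /Ep patchE mem_set. Qed.

Lemma Ep_out x j : ~ Dm x -> Ep j x = 0.
Proof. by move=> Dx; rewrite /Ep patchE memNset. Qed.

Lemma Ep_le1 x j : `|Ep j x| <= 1.
Proof.
have [Dx|Dx] := pselect (Dm x); last by rewrite Ep_out// normr0.
rewrite Ep_in//; have [xb dx] := Dx; have [<- _] := hE xb dx.
exact: coord_le_enorm.
Qed.

Lemma enorm_bN (x : 'rV[R]_N) : (forall j, `|x 0 j| <= b) -> enorm x <= bN.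
Proof. exact: enorm_le_coord. Qed.

Lemma enorm_step (x y : 'rV[R]_N) (eta : R) : 0 <= eta ->
  (forall j, `|y 0 j - x 0 j| <= eta / N%:R) -> enorm (y - x) <= eta.
Proof.
move=> eta0 h; rewrite -[leRHS](@divfK _ N%:R)// mulrC.
apply: enorm_le_coord => [|j]; first by rewrite divr_ge0.
by rewrite !mxE.
Qed.

Lemma sum_dotp (x y : 'rV[R]_N) (c : R) (e : 'I_N -> R) (u : 'rV[R]_N) :
  (forall j, e j = c * u 0 j) ->
  \sum_j e j * (y 0 j - x 0 j) = c * dotp u (y - x).
Proof.
by move=> eE; rewrite mulr_sumr; apply: eq_bigr => j _; rewrite eE !mxE mulrA.
Qed.

Lemma sum_sqr (x y : 'rV[R]_N) :
  \sum_j (y 0 j - x 0 j) ^+ 2 = enorm (y - x) ^+ 2.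
Proof. by rewrite enorm_sqr; apply: eq_bigr => j _; rewrite !mxE expr2. Qed.

Lemma dotp_unit_le (u D : 'rV[R]_N) : enorm u = 1 -> `|dotp u D| <= enorm D.
Proof. by move=> u1; rewrite (le_trans (dotp_le_norm _ _))// u1 mul1r. Qed.

(** Off the tube the distance is 0 or at least [2 r], where [phi] is flat. *)
Lemma dphi_off_tube al del x : 0 <= del -> 0 <= al -> al + del <= r ->
  enorm x <= bN -> ~ Dm x -> dphi al del r (d x) = 0.
Proof.
move=> del0 al0 adr xb nD; apply: dphi_eq0 => //.
have [dx|dx] := leP rho (d x); first by right; have rho_ := rho0; rewrite /r; lra.
left; have [//|dx'] := leP (d x) al; exfalso; apply: nD; split => //.
by rewrite dx (le_lt_trans al0).
Qed.

(** The test function is [phi (d x)] with [del = be - al] and steps of size at most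
    [eta].  One [eta] of the margin [3 eta] is for the step that leads to the set,
    the other two are those of [phi_step_in]. *)
Lemma tube_test (al be eta : R) : 0 <= al -> al <= be -> be <= r ->
  0 < eta -> eta <= 1 -> K * eta <= 1 ->
  (mu [set x | d x \in `[(al + 3 * eta)%R, (be - 3 * eta)%R]] <=
   (K0 * ((be - al) * (2 * r + 1 + K + 2 / r) + (K + 1) * eta))%:E)%E.
Proof.
move=> al0 albe ber eta0 eta1 Keta.
set del := be - al.
have del0 : 0 <= del by rewrite subr_ge0.
have adr : al + del <= r by rewrite /del addrC subrK.
pose J := [set x | d x \in `[(al + 2 * eta), (be - 2 * eta)]].
pose kap := del * K + 2 * (del / r) + K * eta.
have dr0 : 0 <= del / r by rewrite divr_ge0// ltW.
have kap1 : 0 <= del * K by rewrite mulr_ge0// ltW.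
have kap2 : 0 <= K * eta by rewrite mulr_ge0// ltW.
have kap0 : 0 <= kap by rewrite /kap; lra.
have N1 : 1 <= N%:R :> R by rewrite ler1n.
have e0N : eta / N%:R <= eta by rewrite ler_pdivrMr// ler_peMr// ltW.
apply: le_trans (@hmu [set x | d x \in `[(al + 3 * eta)%R, (be - 3 * eta)%R]]
  (fun x => phi al del r (d x))
  (fun j x => dphi al del r (d x) * Ep j x) (fun j x => \1_J x * Ep j x)
  (2 * del * r) del kap (eta / N%:R) (measurable_dst_itv _) del0 kap0 _ _) _.
- by rewrite divr_gt0//= (le_trans e0N).
- split.
  + by move=> x; exact: phi_itv.
  + move=> j; split; apply: borel_funM; try exact: borel_Ep.
      exact: borel_dphi.
    by apply: borel_indic; exact: measurable_dst_itv.
  + move=> j x; rewrite !normrM; split.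
      have /andP[h1 h2] := dphi_itv r0 del0 adr (d x).
      by rewrite (ger0_norm h1) -[leRHS]mulr1 ler_pM// Ep_le1.
    by rewrite -[leRHS]mulr1 ler_pM// ?Ep_le1// indicE; case: (_ \in _); rewrite ?normr1 ?normr0.
  + move=> x y /enorm_bN xb /(enorm_step (ltW eta0)) yx.
    rewrite sum_sqr; set D := enorm (y - x) in yx *.
    have D0 : 0 <= D by exact: enorm_ge0.
    have kapD : (2^-1 * (del / r)) * D ^+ 2 <= kap * D ^+ 2.
      by rewrite ler_wpM2r ?sqr_ge0// /kap; lra.
    have [Dx|nDx] := pselect (Dm x); last first.
      rewrite big1 ?addr0; last by move=> j _; rewrite Ep_out// mulr0 mul0r.
      rewrite big1; last by move=> j _; rewrite Ep_out// mulr0 mul0r.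
      rewrite expr0n mulr0 addr0.
      have da := dphi_off_tube del0 al0 adr xb nDx.
      have dd : `|d y - d x| <= D by exact: dst_lip.
      have := phi_step_flat r0 del0 D0 da dd; lra.
    have [_ dx] := Dx; have [e1 he] := hE xb dx.
    rewrite (@sum_dotp x y (dphi al del r (d x)) _ (E x)); last first.
      by move=> j; rewrite Ep_in.
    rewrite (@sum_dotp x y (\1_J x) _ (E x)); last by move=> j; rewrite Ep_in.
    have ed := dotp_unit_le (y - x) e1.
    have [Jx|nJx] := pselect (J x).
      rewrite indicE mem_set// mul1r.
      apply: (phi_step_in r0 del0 adr (ltW hK) D0 yx Keta ed (he y)).
      move: Jx; rewrite /J/= in_itv/= => /andP[j1 j2].
      by rewrite j1 /del addrCA subrr addr0.
    rewrite indicE memNset// mul0r expr0n mulr0 addr0.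
    have := phi_step_convex r0 del0 adr (ltW hK) D0 yx Keta ed (he y).
    have := mulr_ge0 kap2 (sqr_ge0 D); rewrite /kap; lra.
  + move=> x y /enorm_bN xb /(enorm_step (ltW eta0)) yx.
    rewrite /= in_itv/= => /andP[dy1 dy2].
    have := dst_lip cG G0 y x; rewrite ler_norml => /andP[l1 l2].
    have dx : 0 < d x < rho by apply/andP; split; rewrite /r in ber; lra.
    have Jx : J x by rewrite /J/= in_itv/=; apply/andP; split; lra.
    have Dx : Dm x by split.
    have [e1 _] := hE xb dx.
    rewrite (eq_bigr (fun j => E x 0 j ^+ 2)); last first.
      by move=> j _; rewrite Ep_in// indicE mem_set// mul1r.
    have := enorm_sqr (E x); rewrite e1 expr1n => ->.
    by rewrite le_eqVlt; apply/orP; left; apply/eqP; apply: eq_bigr => j _.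
rewrite lee_fin ler_wpM2l// /kap.
have -> : del * (2 * r + 1 + K + 2 / r) = 2 * del * r + del + del * K + 2 * (del / r).
  by field; rewrite gt_eqF.
by move: e0N; set q := eta / N%:R => e0N; lra.
Qed.

(** [tube_test] for a slightly larger interval, as [eta] tends to 0. *)
Lemma tube_estimate (al be : R) : 0 < al -> al <= be -> be < r ->
  (mu [set x | d x \in `[al, be]] <=
   (K0 * (2 * r + 1 + K + 2 / r) * (be - al))%:E)%E.
Proof.
move=> al0 albe ber; apply/lee_addgt0Pr => eps eps0.
set C := 2 * r + 1 + K + 2 / r.
have r_ := ltW r0; have K_ := ltW hK.
have C0 : 0 <= C.
  have : 0 <= 2 / r by rewrite divr_ge0.
  by rewrite /C; lra.
pose D := K0 * (6 * C + K + 1) + 1.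
have D0 : 0 < D.
  by rewrite ltr_wpDl// mulr_ge0//; lra.
pose eta := Num.min (Num.min 1 K^-1) (Num.min (Num.min (al / 3) ((r - be) / 3)) (eps / D)).
have rb : 0 < r - be by rewrite subr_gt0.
have eta0 : 0 < eta by rewrite !lt_min ltr01 invr_gt0 hK !divr_gt0.
have [e1 e2] : eta <= 1 /\ eta <= K^-1.
  by split; rewrite !ge_min lexx ?orbT.
have [e3 e4] : eta <= al / 3 /\ eta <= (r - be) / 3.
  by split; rewrite !ge_min lexx ?orbT.
have e5 : eta <= eps / D by rewrite !ge_min lexx ?orbT.
have Keta : K * eta <= 1 by rewrite mulrC -ler_pdivlMr// div1r.
have h := @tube_test (al - 3 * eta) (be + 3 * eta) eta _ _ _ eta0 e1 Keta.
apply: (@le_trans _ _ (mu [set x | d x \in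
  `[(al - 3 * eta + 3 * eta)%R, (be + 3 * eta - 3 * eta)%R]])).
  by rewrite subrK addrK.
apply: (le_trans (h _ _ _)); [lra..|].
rewrite -EFinD lee_fin -/C.
have : D * eta <= eps by rewrite mulrC -ler_pdivlMr.
have : K0 * ((6 * C + K + 1) * eta) <= D * eta.
  by rewrite mulrA ler_wpM2r ?(ltW eta0)// /D lerDl.
lra.
Qed.

Lemma continuous_on_borel (U : set 'rV[R]_N) (h : 'rV[R]_N -> R) : open U ->
  (forall x, U x -> {for x, continuous h}) ->
  measurable_fun (U : set (borelV R N)) h.
Proof.
move=> oU ch; apply: (measurability _ (@RGenOpens.measurableE R)).
move=> _ [_ [a [a' ->] <-]]; apply: sub_sigma_algebra.
rewrite openE => x [Ux hx]; apply: filterI; first exact: open_nbhs_nbhs.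
by apply: (ch x Ux); apply: open_nbhs_nbhs; split => //; exact: interval_open.
Qed.

(** Near a point of [G] the function [phi (d x)] with [al = 0] has second
    derivative 1 also across [G], in the direction of the unit normal. *)
Lemma surface_test (p0 : 'rV[R]_N) (nu : 'rV[R]_N -> 'rV[R]_N) (s Kl be : R) :
  0 < s -> 0 < Kl ->
  (forall p j, enorm (p - p0) < s -> {for p, continuous (fun x => nu x 0 j)}) ->
  (forall p, G p -> enorm (p - p0) < s -> enorm (nu p) = 1 /\
     forall z, G z -> `|dotp (nu p) (z - p)| <= Kl * enorm (z - p) ^+ 2) ->
  0 < be -> be < r -> be <= s -> (K + 2 * Kl) * be <= 1 -> be <= 1 ->
  (mu (G `&` [set x | (enorm (x - p0) < s / 2)%R]) <=
   (K0 * ((2 * r + 2 + K + 2 * Kl + 2 / r) * be))%:E)%E.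
Proof.
move=> s0 Kl0 cnu hnu be0 ber bes Kbe be1.
set K' := K + 2 * Kl in Kbe.
have [K_ Kl_ r_] := And3 (ltW hK) (ltW Kl0) (ltW r0).
have K'0 : 0 <= K' by rewrite /K'; lra.
pose eta := be / 4.
have eta0 : 0 < eta by rewrite divr_gt0.
have etab : 4 * eta = be by rewrite mulrC divfK.
have Keta : K' * eta <= 1.
  by have := mulr_ge0 K'0 (ltW eta0); rewrite -etab in Kbe; lra.
have del0 := ltW be0.
have adr : 0 + be <= r by rewrite add0r ltW.
pose B := [set x : 'rV[R]_N | enorm (x - p0) < s].
have oB : open B.
  rewrite openE => x xB; have xs : 0 < s - enorm (x - p0) by rewrite subr_gt0.
  apply: filterS (enorm_nbhs x xs) => y /= xy.
  rewrite /B/= (le_lt_trans (enorm_triangle y x p0))// enormB.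
  by move: xy; rewrite ltrBrDr.
have mG : measurable (G : set (borelV R N)).
  rewrite -[X in measurable X]setCK; apply: measurableC.
  by apply: sub_sigma_algebra; exact: closed_openC.
have mB : measurable (B : set (borelV R N)) by exact: measurable_enorm_ball.
pose nG j : 'rV[R]_N -> R := (fun x => nu x 0 j) \_ (G `&` B).
have mnG j : borel_fun (nG j).
  have mGB : measurable (G `&` B : set (borelV R N)) by exact: measurableI.
  have : measurable_fun (G `&` B : set (borelV R N)) (fun x => nu x 0 j).
    apply: (measurable_funS mB); first by move=> x [].
    by apply: continuous_on_borel => // x Bx; exact: cnu.
  by rewrite (measurable_restrictT _ mGB).
pose J := B `&` [set x | d x \in `]-oo, (be - 2 * eta)]].
have mJ : measurable (J : set (borelV R N)).
  by apply: measurableI => //; exact: measurable_dst_itv.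
have dr0 : 0 <= be / r by rewrite divr_ge0// ltW.
have kap1 : 0 <= be * K' by rewrite mulr_ge0.
pose kap := be * K' + 2 * (be / r).
have kap0 : 0 <= kap by rewrite /kap; lra.
have N1 : 1 <= N%:R :> R by rewrite ler1n.
have e0N : eta / N%:R <= eta by rewrite ler_pdivrMr// ler_peMr// ltW.
have GnD x : G x -> ~ Dm x by move=> Gx [_]; rewrite dst0// ltxx.
have nGx x j : (G `&` B) x -> nG j x = nu x 0 j.
  by move=> h; rewrite /nG patchE mem_set.
have nGnx x j : ~ (G `&` B) x -> nG j x = 0.
  by move=> h; rewrite /nG patchE memNset.
apply: le_trans (@hmu (G `&` [set x | (enorm (x - p0) < s / 2)%R])
  (fun x => phi 0 be r (d x))
  (fun j x => dphi 0 be r (d x) * Ep j x)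
  (fun j x => \1_J x * (Ep j x + nG j x))
  (2 * be * r) be kap (eta / N%:R) _ del0 kap0 _ _) _.
- by apply: measurableI => //; exact: measurable_enorm_ball.
- rewrite divr_gt0//= (le_trans e0N)//; lra.
- split.
  + by move=> x; exact: phi_itv.
  + move=> j; split; apply: borel_funM; first exact: borel_dphi.
    * exact: borel_Ep.
    * exact: borel_indic.
    * by apply: borel_funD; [exact: borel_Ep|exact: mnG].
  + move=> j x; rewrite !normrM; split.
      have /andP[h1 h2] := dphi_itv r0 del0 adr (d x).
      by rewrite (ger0_norm h1) -[leRHS]mulr1 ler_pM// Ep_le1.
    rewrite -[leRHS]mulr1 ler_pM//.
      by rewrite indicE; case: (_ \in _); rewrite ?normr1 ?normr0.
    have [GBx|nGBx] := pselect ((G `&` B) x).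
      rewrite nGx// Ep_out; last by apply: GnD; case: GBx.
      have [Gx Bx] := GBx; have [n1 _] := hnu _ Gx Bx.
      by rewrite add0r -n1 coord_le_enorm.
    by rewrite nGnx// addr0 Ep_le1.
  + move=> x y /enorm_bN xb /(enorm_step (ltW eta0)) yx.
    rewrite sum_sqr; set D := enorm (y - x) in yx *.
    have D0 : 0 <= D by exact: enorm_ge0.
    have D2 : 0 <= D ^+ 2 by exact: sqr_ge0.
    have kapD : (2^-1 * (be / r)) * D ^+ 2 <= kap * D ^+ 2.
      by rewrite ler_wpM2r// /kap; lra.
    have dd : `|d y - d x| <= D by exact: dst_lip.
    have dy : d y <= d x + eta.
      by move: dd; rewrite ler_norml => /andP[_]; lra.
    have K'D : K * D ^+ 2 <= K' * D ^+ 2 by rewrite ler_wpM2r// /K'; lra.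
    have flat : dphi 0 be r (d x) = 0 ->
        phi 0 be r (d x) - kap * D ^+ 2 <= phi 0 be r (d y).
      by move=> da; have := phi_step_flat r0 del0 D0 da dd; lra.
    have [Dx|nDx] := pselect (Dm x).
      have nGBx : ~ (G `&` B) x by move=> [/GnD].
      have [_ dx] := Dx; have [e1 he] := hE xb dx.
      rewrite (@sum_dotp x y (dphi 0 be r (d x)) _ (E x)); last first.
        by move=> j; rewrite Ep_in.
      rewrite (@sum_dotp x y (\1_J x) _ (E x)); last first.
        by move=> j; rewrite Ep_in// nGnx// addr0.
      have ed := dotp_unit_le (y - x) e1.
      have he' : `|d x + dotp (E x) (y - x)| - K' * D ^+ 2 <= d y.
        by rewrite (le_trans _ (he y))// lerD2l lerN2.
      have [Jx|nJx] := pselect (J x).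
        rewrite indicE mem_set// mul1r.
        have dx2 : d x + 2 * eta <= be.
          by case: Jx => _ /=; rewrite in_itv/=; lra.
        have := phi_step_origin r0 del0 adr K'0 D0 yx Keta ed he' erefl
          (dst_ge0 cG G0 x) dx2 dy.
        have : K' * be * D ^+ 2 <= kap * D ^+ 2.
          by rewrite ler_wpM2r// /kap (mulrC K'); lra.
        lra.
      rewrite indicE memNset// mul0r expr0n mulr0 addr0.
      by have := phi_step_convex r0 del0 adr K'0 D0 yx Keta ed he'.
    have dp0 := dphi_off_tube del0 (lexx 0) adr xb nDx.
    rewrite big1; last by move=> j _; rewrite Ep_out// mulr0 mul0r.
    rewrite addr0.
    have [[GBx Jx]|nGJ] := pselect ((G `&` B) x /\ J x); last first.
      rewrite big1 ?expr0n ?mulr0 ?addr0; first exact: flat.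
      move=> j _; rewrite Ep_out// add0r.
      have [GBx|nGBx] := pselect ((G `&` B) x); last first.
        by rewrite nGnx// mulr0 mul0r.
      by rewrite indicE memNset ?mul0r// => Jx; exact: nGJ.
    rewrite (@sum_dotp x y 1 _ (nu x)); last first.
      by move=> j; rewrite Ep_out// add0r nGx// indicE mem_set// mul1r.
    rewrite mul1r.
    have [Gx Bx] := GBx; have [n1 hn] := hnu _ Gx Bx.
    have ed := dotp_unit_le (y - x) n1.
    have dx0 : d x = 0 by exact: dst0.
    have hd : `|d x + dotp (nu x) (y - x)| - K' * D ^+ 2 <= d y.
      have := @dst_ge_balls _ _ _ cG G0 Kl 0 x (nu x) y Kl0 n1 hn (lexx 0).
      rewrite scale0r addr0 mul0r dx0 => /(_ ler01).
      apply: le_trans; rewrite lerD2l lerN2 ler_wpM2r// /K'; lra.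
    have dx2 : d x + 2 * eta <= be by rewrite dx0; lra.
    have := phi_step_origin r0 del0 adr K'0 D0 yx Keta ed hd erefl
      (dst_ge0 cG G0 x) dx2 dy.
    have : K' * be * D ^+ 2 <= kap * D ^+ 2.
      by rewrite ler_wpM2r// /kap (mulrC K'); lra.
    by rewrite dp0; lra.
  + move=> x y /enorm_bN xb /(enorm_step (ltW eta0)) yx [Gy /= ys].
    have := dst_lip cG G0 y x; rewrite ler_norml (dst0 cG G0 Gy) => /andP[l1 l2].
    have dx0 := dst_ge0 cG G0 x.
    have Bx : B x.
      rewrite /B/= (le_lt_trans (enorm_triangle x y p0))// enormB; lra.
    have Jx : J x by split => //=; rewrite in_itv/=; lra.
    have [Gx|nGx'] := pselect (G x).
      have [n1 _] := hnu _ Gx Bx.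
      rewrite (eq_bigr (fun j => nu x 0 j ^+ 2)); last first.
        move=> j _; rewrite Ep_out ?add0r ?nGx//; last exact: GnD.
        by rewrite indicE mem_set// mul1r.
      have := enorm_sqr (nu x); rewrite n1 expr1n => ->.
      by rewrite le_eqVlt; apply/orP; left; apply/eqP; apply: eq_bigr => j _.
    have dx : 0 < d x < rho.
      rewrite lt_neqAle dx0 andbT eq_sym; apply/andP; split.
        by apply/eqP => /(dst_eq0 cG G0).
      have rho_ := rho0; move: ber; rewrite /r; lra.
    have Dx : Dm x by split.
    have [e1 _] := hE xb dx.
    rewrite (eq_bigr (fun j => E x 0 j ^+ 2)); last first.
      move=> j _; rewrite Ep_in// nGnx; last by case.
      by rewrite indicE mem_set// mul1r addr0.
    have := enorm_sqr (E x); rewrite e1 expr1n => ->.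
    by rewrite le_eqVlt; apply/orP; left; apply/eqP; apply: eq_bigr => j _.
rewrite lee_fin ler_wpM2l// /kap.
have -> : (2 * r + 2 + K + 2 * Kl + 2 / r) * be =
    2 * be * r + be + be * K' + 2 * (be / r) + be.
  by rewrite /K'; field; rewrite gt_eqF.
by move: e0N; set q := eta / N%:R => e0N; lra.
Qed.

Lemma le_small_eq0 (x : \bar R) (C e : R) : (0 <= x)%E -> 0 < e ->
  (forall be : R, 0 < be -> be <= e -> (x <= (C * be)%:E)%E) -> x = 0%E.
Proof.
move=> x0 e0 hx; apply/le_anti; rewrite x0 andbT.
apply/lee_addgt0Pr => eps eps0; rewrite add0e.
have C0 : 0 < `|C| + 1 by rewrite ltr_wpDl.
pose be := Num.min e (eps / (`|C| + 1)).
have be0 : 0 < be by rewrite lt_min e0 divr_gt0.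
apply: le_trans (hx be be0 _) _; first by rewrite ge_min lexx.
rewrite lee_fin (le_trans (y := (`|C| + 1) * be))//.
  by rewrite ler_wpM2r ?(ltW be0)// (le_trans (ler_norm _))// lerDl.
by rewrite mulrC -ler_pdivlMr// ge_min lexx orbT.
Qed.

(** Let [be] tend to 0 in [surface_test]. *)
Lemma surface_locally_null (p0 : 'rV[R]_N) : G p0 ->
  exists2 s, 0 < s & mu (G `&` [set x | (enorm (x - p0) < s)%R]) = 0%E.
Proof.
move=> Gp0; have [k [sk dk]] := hG Gp0.
have [s [Kl [s0 Kl0 cnu hnu]]] := local_normal sk dk Gp0.
exists (s / 2); first by rewrite divr_gt0.
have K'0 : 0 < K + 2 * Kl by have hK_ := hK; lra.
pose e := Num.min (Num.min (r / 2) s) (Num.min (K + 2 * Kl)^-1 1).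
have e0 : 0 < e by rewrite !lt_min divr_gt0// s0 invr_gt0 K'0 ltr01.
apply: (@le_small_eq0 _ (K0 * (2 * r + 2 + K + 2 * Kl + 2 / r)) e) => //.
move=> be be0; rewrite !le_min => /andP[/andP[b1 b2] /andP[b3 b4]].
rewrite -mulrA; apply: (@surface_test p0 (unit_grad k) s) => //.
- by move=> p Gp ps; have [] := hnu p Gp ps.
- by rewrite (le_lt_trans b1)// ltr_pdivrMr// ltr_pMr// ltr1n.
- by rewrite mulrC -ler_pdivlMr// div1r.
Qed.

Lemma surface_null : mu G = 0%E.
Proof.
have mG : measurable (G : set (borelV R N)).
  rewrite -[X in measurable X]setCK; apply: measurableC.
  by apply: sub_sigma_algebra; exact: closed_openC.
pose Gc c := G `&` [set x | enorm x <= c].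
suff h (c : R) : mu.-negligible (Gc c : set (borelV R N)).
  apply: measure_negligible => //.
  apply: (@negligibleS _ _ _ mu (\bigcup_i (Gc i%:R : set (borelV R N)))).
    move=> x Gx; exists (Num.truncn (enorm x)).+1 => //; split => //=.
    by rewrite ltW// truncnS_gt.
  by apply: negligible_bigcup => i; exact: h.
have cGc : compact (Gc c).
  apply: (@compact_enorm_ball _ _ _ c) => [|x []//].
  apply: closedI => //.
  exact: (proj1 (continuous_closedP _) (@enorm_continuous R N) _ (@closed_le _ c)).
have /choice[s hs] : forall p, exists s, G p -> 0 < s /\
    mu (G `&` [set x | (enorm (x - p) < s)%R]) = 0%E.
  move=> p; have [Gp|nGp] := pselect (G p); last by exists 0.
  by have [s s0 ms] := surface_locally_null Gp; exists s.
move: cGc; rewrite compact_cover => /(_ _ G (fun p => [set x | enorm (x - p) < s p])).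
case.
- move=> p Gp; rewrite openE => x /= xp.
  have xs : 0 < s p - enorm (x - p) by rewrite subr_gt0.
  apply: filterS (enorm_nbhs x xs) => y /= xy.
  rewrite (le_lt_trans (enorm_triangle y x p))// enormB.
  by move: xy; rewrite ltrBrDr.
- move=> x [Gx _]; exists x => //=.
  by rewrite subrr enorm0; have [] := hs x Gx.
move=> D' DG cov.
apply: (@negligibleS _ _ _ mu (\big[setU/set0]_(p <- finmap.enum_fset D')
   (G `&` [set x | enorm (x - p) < s p] : set (borelV R N)) :
   set (borelV R N))).
  move=> x [Gx xc]; have [p pD xp] := cov x (conj Gx xc).
  by rewrite -bigcup_fset; exists p.
rewrite big_seq; apply: (big_ind (fun A => mu.-negligible A)).
- exact: negligible_set0.
- by move=> A B; exact: negligibleU.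
- move=> p /DG; rewrite inE => Gp; apply/negligibleP.
    by apply: measurableI => //; exact: measurable_enorm_ball.
  by have [] := hs p Gp.
Qed.

End SpaceOccupation.

(** * Measures on the line dominated by Lebesgue measure *)

Section MeasureComparison.
Import HBNNSimple.
Context (R : realType) (d : measure_display) (T : measurableType d).

(** Monotonicity for functions, such as [slice_sup], that may fail to be
    measurable: the integral is a supremum over simple minorants. *)
Lemma ge0_le_integral_ptwise (mu : {measure set T -> \bar R}) (D : set T)
    (f g : T -> \bar R) :
  (forall x, D x -> 0 <= f x)%E -> (forall x, D x -> f x <= g x)%E ->
  (\int[mu]_(x in D) f x <= \int[mu]_(x in D) g x)%E.
Proof.
move=> f0 fg; have g0 x : D x -> (0 <= g x)%E.
  by move=> Dx; exact: le_trans (f0 x Dx) (fg x Dx).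
rewrite !ge0_integralE//; apply: ge_ereal_sup => _ [h /= hf <-].
apply: ereal_sup_ubound; exists h => //= x.
by apply: (le_trans (hf x)); apply: lee_restrict.
Qed.

(** Term by term for the simple minorants of [f]; their level sets are contained in
    [D], except the level set of 0. *)
Lemma le_integral_measure (mu nu : {measure set T -> \bar R}) (D : set T)
    (f : T -> \bar R) :
  (forall A, measurable A -> A `<=` D -> mu A <= nu A)%E ->
  (forall x, D x -> 0 <= f x)%E ->
  (\int[mu]_(x in D) f x <= \int[nu]_(x in D) f x)%E.
Proof.
move=> munu f0; rewrite !ge0_integralE//; apply: ge_ereal_sup => _ [h /= hf <-].
apply: (@le_trans _ _ (sintegral nu h)); last first.
  by apply: ereal_sup_ubound; exists h.
rewrite !sintegralE; apply: lee_fsum => // y [x _ <-].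
have [->|hx] := eqVneq (h x) 0; first by rewrite !mul0e.
apply: lee_wpmul2l; rewrite ?lee_fin//; apply: munu => // z /= hz.
apply: contrapT => nDz; move: (hf z); rewrite patchE memNset// lee_fin hz.
by apply/negP; rewrite -ltNge lt_neqAle eq_sym hx/=.
Qed.

End MeasureComparison.

Section DensityBound.
Context (R : realType) (nu : {measure set (measurableTypeR R) -> \bar R}).
Variables (C e : R).
Hypothesis C0 : 0 < C.
Hypothesis hnu : forall s t : R, 0 < s -> s <= t -> t <= e ->
  (nu `[s, t]%classic <= (C * (t - s))%:E)%E.

Lemma density_bound_oc (s t : R) : 0 <= s -> s <= t -> t <= e ->
  (nu `]s, t]%classic <= (C * (t - s))%:E)%E.
Proof.
move=> s0 st te.
have -> : `]s, t]%classic = \bigcup_m `[s + m.+1%:R^-1, t]%classic.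
  apply/seteqP; split => x /=; rewrite !in_itv/=.
    move=> /andP[sx xt]; have [m hm] := ltr_add_invr sx.
    by exists m => //=; rewrite in_itv/= (ltW hm).
  move=> [m _] /=; rewrite in_itv/= => /andP[h ->]; rewrite andbT.
  by rewrite (lt_le_trans _ h)// ltrDl invr_gt0.
have nd : nondecreasing_seq (fun m => `[s + m.+1%:R^-1, t]%classic : set R).
  move=> i j ij; apply/subsetPset => x /=; rewrite !in_itv/= => /andP[h ->].
  rewrite andbT (le_trans _ h)// lerD2l lef_pV2 ?posrE// ler_nat ltnS//.
have := @nondecreasing_cvg_mu _ (measurableTypeR R) _ nu _
  (fun m => measurable_itv `[s + m.+1%:R^-1, t]) _ nd.
move=> /(_ _)/wrap[]; first by apply: bigcup_measurable => m _; exact: measurable_itv.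
move=> /cvg_lim <-//; apply: lime_le.
  by apply/cvg_ex; eexists; apply: nondecreasing_cvg_mu => //; 
    apply: bigcup_measurable => m _; exact: measurable_itv.
near=> m => /=; have m0 : 0 < m.+1%:R^-1 :> R by rewrite invr_gt0.
have [h|h] := leP (s + m.+1%:R^-1) t.
  apply: (le_trans (hnu _ h te)); first by rewrite ltr_wpDl.
  by rewrite lee_fin ler_wpM2l ?(ltW C0)// lerD2l lerN2 lerDl ltW.
rewrite set_itv_ge; last by rewrite bnd_simp -ltNge.
by rewrite measure0 lee_fin mulr_ge0 ?(ltW C0)// subr_ge0.
Unshelve. all: by end_near. Qed.

(** Lebesgue measure is an infimum over coverings by intervals open on the left. *)
Lemma density_bound (B : set (measurableTypeR R)) : measurable B ->
  (nu (B `&` `]0%R, e]%classic) <= C%:E * lebesgue_measure B)%E.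
Proof.
move=> mB; rewrite -lee_pdivrMl//.
apply: le_ereal_inf_tmp => _ [A [mA BA] <-].
rewrite lee_pdivrMl//.
have Aoc k : exists st : R * R, A k = `]st.1, st.2]%classic.
  by have [[s t] _ <-] := mA k; exists (s, t).
have mAk k : measurable (A k : set (measurableTypeR R)).
  by have [st ->] := Aoc k; exact: measurable_itv.
rewrite -nneseriesZl; last by move=> k _; exact: wlength_ge0.
apply: (@le_trans _ _ (\sum_(0 <= k <oo) nu (A k `&` `]0%R, e]%classic))%E).
  apply: (@measure_sigma_subadditive _ _ _ nu).
  - by move=> k; apply: measurableI => //; exact: measurable_itv.
  - by apply: measurableI => //; exact: measurable_itv.
  - by move=> x [/BA[k _ Akx] xe]; exists k.
apply: lee_nneseries => // k _.
have [[s t] /= ->] := Aoc k.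
have [ts|st] := leP t s.
  by rewrite set_itv_ge ?bnd_simp -?leNgt// set0I measure0 mule_ge0 ?wlength_ge0// lee_fin ltW.
rewrite wlength_itv_bnd ?(ltW st)// -EFinM.
pose s' := Num.max s 0; pose t' := Num.min t e.
have -> : `]s, t]%classic `&` `]0%R, e]%classic = `]s', t']%classic :> set R.
  apply/seteqP; split => x /=; rewrite !in_itv/= gt_max le_min.
    by move=> [/andP[-> ->] /andP[-> ->]].
  by move=> /andP[/andP[-> ->] /andP[-> ->]].
have [h|h] := leP t' s'.
  rewrite set_itv_ge ?bnd_simp -?leNgt// measure0 lee_fin mulr_ge0 ?(ltW C0)//.
  by rewrite subr_ge0 ltW.
apply: (le_trans (density_bound_oc _ (ltW h) _)).
- by rewrite le_max lexx orbT.
- by rewrite ge_min lexx orbT.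
rewrite lee_fin ler_wpM2l ?(ltW C0)// lerB//; first by rewrite ge_min lexx.
by rewrite le_max lexx.
Qed.

Lemma density_bound_integral (f : R -> \bar R) : e <= 1 ->
  (forall x, 0 <= f x)%E -> measurable_fun [set: measurableTypeR R] f ->
  (\int[nu]_(x in `]0%R, e]) f x <=
   C%:E * \int[lebesgue_measure]_(x in `]0%R, 1%R]) f x)%E.
Proof.
move=> e1 f0 mf.
pose k : {nonneg R} := NngNum (ltW C0).
apply: (@le_trans _ _ (\int[mscale k lebesgue_measure]_(x in `]0%R, e]) f x)%E).
  apply: (@le_integral_measure _ _ (measurableTypeR R)) => // A mA Ae.
  rewrite -[X in nu X](setIidl Ae); exact: density_bound.
rewrite ge0_integral_mscale//; last exact: measurable_funTS.
apply: lee_wpmul2l; first by rewrite lee_fin ltW.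
apply: ge0_subset_integral => //; first exact: measurable_funTS.
by move=> x /=; rewrite !in_itv/= => /andP[-> h]; exact: le_trans e1.
Qed.

End DensityBound.

(** * Inner regularity of finite Borel measures *)

Section Regularity.
Context (R : realType) (n : nat).
Local Notation N := n.+1.
Variable mu : {measure set (borelV R N) -> \bar R}.
Hypothesis fin_mu : (mu setT < +oo)%E.

Lemma open_borel (U : set 'rV[R]_N) : open U -> measurable (U : set (borelV R N)).
Proof. exact: sub_sigma_algebra. Qed.

Lemma closed_borel (K : set 'rV[R]_N) : closed K ->
  measurable (K : set (borelV R N)).
Proof.
move=> cK; rewrite -[X in measurable X]setCK; apply: measurableC.
by apply: open_borel; exact: closed_openC.
Qed.

Lemma finite_borel (A : set (borelV R N)) : measurable A -> (mu A < +oo)%E.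
Proof. by move=> mA; apply: le_lt_trans fin_mu; apply: le_measure; rewrite ?inE. Qed.

Lemma decreasing_small (A : nat -> set (borelV R N)) (a eps : R) :
  (forall m, measurable (A m)) -> nonincreasing_seq A ->
  (mu (\bigcap_m A m) <= a%:E)%E -> 0 < eps ->
  exists m, (mu (A m) <= (a + eps)%:E)%E.
Proof.
move=> mA dA hA eps0.
have mI : measurable (\bigcap_m A m) by apply: bigcapT_measurable.
have cv := @nonincreasing_cvg_mu _ _ _ mu A (finite_borel (mA 0%N)) mA mI dA.
have : (mu (\bigcap_m A m) < (a + eps)%:E)%E.
  by rewrite (le_lt_trans hA)// lte_fin ltrDl.
move=> lt; have : \forall m \near \oo, ((mu \o A) m < (a + eps)%:E)%E.
  have /cv : nbhs (mu (\bigcap_m A m)) [set y | (y < (a + eps)%:E)%E].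
    by apply: open_nbhs_nbhs; split => //; exact: open_ereal_lt_ereal.
  by [].
by move=> [m _ /(_ m (leqnn m))/= /ltW h]; exists m.
Qed.

(** Approximation from inside and from outside at once, so that the property
    passes to complements. *)
Definition approximable (A : set (borelV R N)) : Prop :=
  forall eps : R, 0 < eps -> exists F U, [/\ closed (F : set 'rV[R]_N),
    open (U : set 'rV[R]_N), F `<=` A, A `<=` U & (mu (U `\` F) <= eps%:E)%E].

(** An open set is exhausted by the points at distance at least [1 / (m + 1)] from
    its complement. *)
Lemma approximable_open (U : set 'rV[R]_N) : open U -> approximable U.
Proof.
move=> oU eps eps0.
have [U0|U0] := pselect ((~` U) !=set0); last first.
  exists U, U; split => //; last by rewrite setDv measure0 lee_fin ltW.
  have -> : U = setT by apply/seteqP; split => // x _; apply: contrapT => nUx; apply: U0; exists x.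
  exact: closedT.
have cU : closed (~` U) by exact: open_closedC.
pose F m := [set x : 'rV[R]_N | m.+1%:R^-1 <= dst (~` U) x].
have cF m : closed (F m).
  exact: (proj1 (continuous_closedP _) (dst_continuous cU U0) _ (@closed_ge _ _)).
have FU m : F m `<=` U.
  move=> x /= h; apply: contrapT => nUx; move: h; rewrite /F/= dst0//.
  by apply/negP; rewrite -ltNge invr_gt0.
have [|||m hm] := @decreasing_small (fun m => U `\` F m) 0 eps _ _ _ eps0.
- by move=> m; apply: measurableD; [exact: open_borel|exact: closed_borel].
- move=> i j ij; apply/subsetPset => x [Ux nF]; split => // Fx; apply: nF.
  by rewrite /F/= (le_trans _ Fx)// lef_pV2 ?posrE// ler_nat ltnS.
- rewrite (_ : \bigcap_m _ = set0) ?measure0// -subset0 => x h.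
  have [Ux _] := h 0%N I.
  have dx : 0 < dst (~` U) x.
    rewrite lt_neqAle dst_ge0// andbT eq_sym; apply/eqP => /(dst_eq0 cU U0).
    exact.
  have [m hm] := ltr_add_invr dx.
  by have [_ []] := h m I; rewrite /F/= ltW// -[ltLHS]add0r.
- by exists (F m), U; split => //; move: hm; rewrite add0r.
Qed.

(** Finitely many of the closed sets suffice, by continuity from above. *)
Lemma approximable_bigcup (A : nat -> set (borelV R N)) :
  (forall i, approximable (A i)) -> approximable (\bigcup_i A i).
Proof.
move=> hA eps eps0.
have h i := hA i (eps / 2 / (2 ^ i.+1)%:R).
have /choice[F /choice[U FU]] : forall i, exists F U, [/\ closed (F : set 'rV[R]_N),
    open (U : set 'rV[R]_N), F `<=` A i, A i `<=` U &
    (mu (U `\` F) <= (eps / 2 / (2 ^ i.+1)%:R)%:E)%E].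
  by move=> i; apply: h; rewrite !divr_gt0// ltr0n expn_gt0.
pose V := \bigcup_i U i.
have oV : open V by apply: bigcup_open => i _; have [] := FU i.
pose H m := \big[setU/set0]_(i < m) F i.
have cH m : closed (H m : set 'rV[R]_N).
  rewrite /H; elim/big_ind : _; [exact: closed0|exact: closedU|].
  by move=> i _; have [] := FU i.
have [||||m hm] := @decreasing_small (fun m => V `\` H m) (eps / 2) (eps / 2).
- by move=> m; apply: measurableD; [exact: open_borel|exact: closed_borel].
- move=> i j ij; apply/subsetPset => x [Vx nH]; split => // Hx; apply: nH.
  by move: Hx; rewrite /H -!bigcup_mkord => -[k /= ki Fx]; exists k => //=; exact: leq_trans ij.
- apply: (@le_trans _ _ (\sum_(0 <= i <oo) mu (U i `\` F i))%E); last first.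
    apply: le_trans (@epsilon_trick0 _ (eps / 2) xpredT _); last first.
      by rewrite divr_ge0// ltW.
    by apply: lee_nneseries => // i _; have [] := FU i.
  apply: (@measure_sigma_subadditive _ _ _ mu).
  + move=> i; have [cF oU _ _ _] := FU i.
    by apply: measurableD; [exact: open_borel|exact: closed_borel].
  + apply: bigcapT_measurable => m; apply: measurableD; [exact: open_borel|exact: closed_borel].
  + move=> x hx; have [[i _ Uix] _] := hx 0%N I; exists i => //; split => // Fx.
    have [_] := hx i.+1 I; apply; rewrite /H -bigcup_mkord; exists i => //=.
- by rewrite divr_gt0.
exists (H m), V; split => //.
- rewrite /H -bigcup_mkord => x [i _ Fx]; exists i => //.
  by have [_ _ FA _ _] := FU i; exact: FA.
- by move=> x [i _ Ax]; exists i => //; have [_ _ _ AU _] := FU i; exact: AU.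
- by move: hm; rewrite -splitr.
Qed.

Lemma borel_approximable (A : set (borelV R N)) : measurable A -> approximable A.
Proof.
apply: smallest_sub; last exact: approximable_open.
split.
- by apply: approximable_open; exact: open0.
- move=> B hB eps eps0; have [F [U [cF oU FB BU h]]] := hB _ eps0.
  exists (~` U), (~` F); split.
  + exact: open_closedC.
  + exact: closed_openC.
  + by rewrite setTD; exact: subsetC.
  + by rewrite setTD; exact: subsetC.
  + by rewrite (_ : _ `\` _ = U `\` F)// !setDE setCK setIC.
- exact: approximable_bigcup.
Qed.

Lemma sigma_closed_inner (A : set (borelV R N)) : measurable A ->
  exists K : nat -> set 'rV[R]_N, [/\ forall m, closed (K m),
    forall m, K m `<=` A & mu (A `\` \bigcup_m K m) = 0%E].
Proof.
move=> mA; have hA := borel_approximable mA.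
have /choice[K hK] : forall m : nat, exists F, [/\ closed (F : set 'rV[R]_N),
    F `<=` A & (mu (A `\` F) <= m.+1%:R^-1%:E)%E].
  move=> m; have [|F [U [cF oU FA AU h]]] := hA m.+1%:R^-1; first by rewrite invr_gt0.
  exists F; split => //; apply: le_trans h; apply: le_measure; rewrite ?inE.
  - by apply: measurableD => //; exact: closed_borel.
  - by apply: measurableD; [exact: open_borel|exact: closed_borel].
  - by move=> x [/AU].
exists K; split => [m|m|]; try by have [] := hK m.
have mK : measurable (\bigcup_m K m : set (borelV R N)).
  by apply: bigcupT_measurable => m; apply: closed_borel; have [] := hK m.
apply/le_anti; rewrite measure_ge0 andbT; apply/lee_addgt0Pr => eps eps0.
rewrite add0e; have [m hm] := ltr_add_invr eps0.
have [cK KA hm'] := hK m.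
apply: (@le_trans _ _ (mu (A `\` K m))); last first.
  by apply: (le_trans hm'); rewrite lee_fin ltW// -[ltLHS]add0r.
apply: le_measure; rewrite ?inE; try by apply: measurableD => //; exact: closed_borel.
by move=> x [Ax h]; split => // Kx; apply: h; exists m.
Qed.

End Regularity.

(** * Integration over a tube *)

Local Notation image_measure :=
  measure_function_pushforward__canonical__measure_function_Measure.

Section SliceIntegral.
Context (R : realType) (n : nat).
Local Notation N := n.+1.
Variable (G : set 'rV[R]_N).
Hypothesis cG : closed G.
Hypothesis G0 : G !=set0.
Variable mu : {measure set (borelV R N) -> \bar R}.
Hypothesis fin_mu : (mu setT < +oo)%E.
Variables (C e : R).
Hypotheses (C0 : 0 < C) (e1 : e <= 1).
Local Notation d := (dst G).
Hypothesis hmu : forall s t : R, 0 < s -> s <= t -> t <= e ->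
  (mu [set x | d x \in `[s, t]%R] <= (C * (t - s))%:E)%E.
Variables (f : 'rV[R]_N -> R) (b : R).
Hypothesis mf : borel_fun f.

Let D := [set x : borelV R N | enorm x < b /\ 0 < d x <= e].

Let mdst : measurable_fun [set: borelV R N] (d : borelV R N -> measurableTypeR R).
Proof. exact: borel_dst. Qed.

Lemma measurable_tube : measurable D.
Proof.
have -> : D = (@enorm R N @^-1` `]-oo, b[%classic) `&`
    [set x | d x \in `]0, e]].
  by apply/seteqP; split => x /=; rewrite !in_itv/=.
apply: measurableI; last exact: (measurable_dst_itv cG G0).
rewrite -[X in measurable X]setTI.
by apply: (continuous_borel_fun (@enorm_continuous R N)) => //; exact: measurable_itv.
Qed.

(** The supremum of [`|f|] over a slice dominates, at [mu]-almost every point, a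
    Borel function of the distance: the level sets [`|f| > q] are replaced by
    countable unions of compact sets, whose images by the distance are Borel. *)
Lemma slice_minorant : exists s : R -> \bar R,
  [/\ measurable_fun [set: measurableTypeR R] s, forall a, (0 <= s a)%E,
      forall a, (s a <= slice_sup G f a b)%E &
      {ae mu, forall x, D x -> (`|f x|%:E <= s (d x))%E}].
Proof.
pose q (k : nat) : R := if unpickle k is Some u then ratr (u : rat) else 0.
pose A k := D `&` [set x | q k < `|f x| ].
have mA k : measurable (A k : set (borelV R N)).
  apply: measurableI; first exact: measurable_tube.
  have mnf : borel_fun (fun x => `|f x|) by exact: measurableT_comp.
  have := mnf measurableT _ (measurable_itv `]q k, +oo[).
  by rewrite setTI; congr measurable; apply/seteqP; split => x /=;
    rewrite in_itv/= andbT.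
have /choice[K hK] : forall k, exists K : nat -> set 'rV[R]_N,
    [/\ forall m, closed (K m), forall m, K m `<=` A k &
        mu (A k `\` \bigcup_m K m) = 0%E].
  by move=> k; exact: sigma_closed_inner.
pose B k : set R := d @` (\bigcup_m K k m).
have mB k : measurable (B k : set (measurableTypeR R)).
  rewrite /B image_bigcup; apply: bigcupT_measurable => m.
  apply: compact_measurable; have [cK KA _] := hK k.
  apply: continuous_compact; last first.
    apply: (@compact_enorm_ball _ _ _ b) => // x /KA[[xb _] _]; exact: ltW.
  by apply: continuous_subspaceT; exact: dst_continuous.
pose s_ k a := (Num.max 0 (q k * \1_(B k) a))%:E.
pose s a := esups (fun k => s_ k a) 0%N.
have s_ge k a : (s_ k a <= s a)%E by apply: ereal_sup_ubound; exists k.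
exists s; split.
- apply: measurable_fun_esups => k; apply/measurable_EFinP.
  apply: measurable_maxr; first exact: measurable_cst.
  by apply: measurable_funM; [exact: measurable_cst|exact: measurable_indic].
- by move=> a; apply: le_trans (s_ge 0%N a); rewrite lee_fin le_max lexx.
- move=> a; apply: ge_ereal_sup => _ [k _ <-].
  have z0 : (0 <= slice_sup G f a b)%E by apply: ereal_sup_ubound; left.
  rewrite /s_ indicE; have [aB|naB] := boolP (a \in B k); last first.
    by rewrite mulr0 maxxx.
  move: aB; rewrite inE => -[x [m _ Kx] dx].
  have [_ KA _] := hK k; have [[xb _] /= qf] := KA m x Kx.
  rewrite mulr1 EFin_max ge_max z0/=.
  apply: (@le_trans _ _ `|f x|%:E); first by rewrite lee_fin ltW.
  apply: ereal_sup_ubound; right; exists x => //; split => //.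
  by rewrite edistE// dx.
- exists (\bigcup_k (A k `\` \bigcup_m K k m)); split.
  + apply: bigcupT_measurable => k; apply: measurableD => //.
    by apply: bigcupT_measurable => m; apply: closed_borel; have [] := hK k.
  + apply/negligibleP.
      apply: bigcupT_measurable => k; apply: measurableD => //.
      by apply: bigcupT_measurable => m; apply: closed_borel; have [] := hK k.
    apply: negligible_bigcup => k; apply/negligibleP.
      apply: measurableD => //.
      by apply: bigcupT_measurable => m; apply: closed_borel; have [] := hK k.
    by have [] := hK k.
  + move=> x /= nx; apply: contrapT => nU; apply: nx => Dx.
    rewrite leNgt; apply/negP => sf.
    have sx : (s (d x) \is a fin_num)%E.
      rewrite ge0_fin_numE; first exact: lt_trans sf (ltry _).
      by apply: le_trans (s_ge 0%N _); rewrite lee_fin le_max lexx.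
    move: (sf); rewrite -(fineK sx) lte_fin => /rat_in_itvoo[u].
    rewrite in_itv/= => /andP[u1 u2].
    have qu : q (pickle u) = ratr u by rewrite /q pickleK.
    have Ax : A (pickle u) x by split => //=; rewrite qu.
    have Kx : (\bigcup_m K (pickle u) m) x.
      by apply: contrapT => nK; apply: nU; exists (pickle u).
    have := s_ge (pickle u) (d x); rewrite /s_ qu indicE mem_set; last by exists x.
    rewrite mulr1 -(fineK sx) lee_fin ge_max => /andP[_].
    by rewrite leNgt u1.
Qed.

(** Integrate [slice_minorant]: the distance has a density bounded by [C]. *)
Lemma tube_integral :
  (\int[mu]_(x in D) `|f x|%:E <=
   C%:E * \int[lebesgue_measure]_(a in `]0%R, 1%R]) slice_sup G f a b)%E.
Proof.
have [s [ms s0 sle sf]] := slice_minorant.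
pose nu := image_measure mu mdst.
have hnu (u t : R) : 0 < u -> u <= t -> t <= e ->
    (nu `[u, t]%classic <= (C * (t - u))%:E)%E.
  by move=> u0 ut te; exact: hmu.
apply: (@le_trans _ _ (C%:E * \int[lebesgue_measure]_(a in `]0%R, 1%R]) s a)%E);
  last first.
  apply: lee_wpmul2l; first by rewrite lee_fin ltW.
  exact: (@ge0_le_integral_ptwise R _ (measurableTypeR R) lebesgue_measure).
apply: (le_trans _ (density_bound_integral C0 hnu e1 s0 ms)).
rewrite (ge0_integral_pushforward mdst)//; last first.
  exact: measurable_funTS.
apply: (@le_trans _ _ (\int[mu]_(x in D) s (d x))%E).
  have mD := measurable_tube.
  apply: ae_ge0_le_integral => //.
    apply/measurable_EFinP; apply: measurable_funTS.
    by apply: measurableT_comp.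
  by apply: measurable_funTS; exact: (measurableT_comp ms mdst).
apply: ge0_subset_integral => //.
- exact: measurable_tube.
- by rewrite -[X in measurable X]setTI; apply: mdst => //; exact: measurable_itv.
- by apply: measurable_funTS; exact: (measurableT_comp ms mdst).
- by move=> x [_ dx] /=; rewrite in_itv.
Qed.

(** [`|f|] is integrable over balls: near [G] by [tube_integral], on [G] because
    [mu G = 0], elsewhere because [f] is bounded there. *)
Lemma ball_integral_fin : mu G = 0%E -> 0 < b -> 0 < e -> L1loc_perp G f ->
  (\int[mu]_(x in [set x : borelV R N | (enorm x < b)%R]) `|f x|%:E < +oo)%E.
Proof.
move=> muG b0 e0 [hf1 hf2].
pose L := [set x : borelV R N | enorm x < b /\ e < d x].
have mball c : measurable [set x : borelV R N | enorm x < c].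
  have := measurable_enorm_ball (0 : 'rV[R]_N) c.
  by under eq_set do rewrite subr0.
have mL : measurable L.
  have -> : L = [set x : borelV R N | enorm x < b] `&` [set x | d x \in `]e, +oo[].
    by apply/seteqP; split => x /=; rewrite in_itv/= andbT.
  by apply: measurableI => //; exact: (measurable_dst_itv cG G0).
have mG : measurable (G : set (borelV R N)) by exact: closed_borel.
have mD := measurable_tube.
have mfD (A : set (borelV R N)) : measurable_fun A (fun x => `|f x|%:E).
  by apply/measurable_EFinP; apply: measurable_funTS; exact: measurableT_comp.
have f0 x : (0 <= `|f x|%:E)%E by rewrite lee_fin.
have cov : [set x : borelV R N | enorm x < b] `<=` (D `|` L) `|` G.
  move=> x /= xb; have [de|ed] := leP (d x) e; last by left; right.
  have [d0|d0] := eqVneq (d x) 0; first by right; exact: (dst_eq0 cG G0).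
  by left; left; split => //; rewrite de lt_neqAle eq_sym d0 dst_ge0.
have mU : measurable (D `|` L) by exact: measurableU.
apply: (@le_lt_trans _ _ (\int[mu]_(x in (D `|` L) `|` G) `|f x|%:E)%E).
  by apply: ge0_subset_integral => //; exact: measurableU.
rewrite ge0_integral_setU//; last first.
  apply/eqP; rewrite -subset0 => x [[[_ /andP[h _]]|[_ h]] Gx].
    by move: h; rewrite dst0// ltxx.
  by move: h; rewrite dst0// ltNge ltW.
rewrite ge0_integral_setU//; last first.
  by apply/eqP; rewrite -subset0 => x [[_ /andP[_ h]] [_]]; rewrite ltNge h.
rewrite (_ : (\int[mu]_(x in G) `|f x|%:E)%E = 0%E) ?adde0; last first.
  by rewrite null_set_integral.
apply: lte_add_pinfty.
  apply: (le_lt_trans tube_integral).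
  by rewrite lte_mul_pinfty ?lee_fin ?(ltW C0)//; exact: hf1.
have [||m hm] := hf2 [set x | enorm x <= b /\ e <= d x].
- apply: (@compact_enorm_ball _ _ _ b) => [|x []//].
  apply: closedI.
    exact: (proj1 (continuous_closedP _) (@enorm_continuous R N) _ (@closed_le _ b)).
  exact: (proj1 (continuous_closedP _) (dst_continuous cG G0) _ (@closed_ge _ e)).
- by move=> x [_ /= h] Gx; move: h; rewrite dst0// leNgt e0.
apply: (@le_lt_trans _ _ (\int[mu]_(x in L) `|m|%:E)%E).
  apply: ge0_le_integral_ptwise => // x [xb h].
  by rewrite lee_fin (le_trans (hm x _))// ?ler_norm//; split; exact: ltW.
by rewrite integral_cst// lte_mul_pinfty// (finite_borel fin_mu).
Qed.

End SliceIntegral.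

(** * The occupation measure *)

Local Notation restricted_measure :=
  measure_function_mrestr__canonical__measure_function_Measure.

Section SpaceMeasure.
Context (R : realType) (d : measure_display) (Omega : measurableType d)
  (P : probability Omega R) (T : R) (F : R -> set_system Omega) (N : nat).
Variables (X : R -> Omega -> 'rV[R]_N).
Hypothesis hT : 0 < T.
Hypothesis hF : filtration T F.
Hypothesis cX : forall i, continuous_paths T (coord X i).
Hypothesis aX : forall i, adapted T F (coord X i).
Variables (A : set Omega) (mA : measurable A).

Local Notation path_space := (measurableTypeR R * Omega)%type.

Let mPhi : measurable_fun [set: path_space]
  (fun p => clamped T X p.1 p.2 : borelV R N).
Proof. exact: (measurable_clamped hT hF cX aX). Qed.

Let Z : set path_space := `[0, T]%classic `*` A.

Let mZ : measurable Z.
Proof. by apply: measurableX => //; exact: measurable_itv. Qed.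

(** The expected time that [X] spends in a set, on the event [A]. *)
Definition space_measure : {measure set (borelV R N) -> \bar R} :=
  image_measure (restricted_measure (lebesgue_measure \x P)%E mZ) mPhi.

Lemma space_measureE (S : set (borelV R N)) : measurable S ->
  space_measure S = (Ex P (fun w => \1_A w * fine (occ T X S w)))%:E.
Proof.
move=> mS.
pose W : set path_space := ((fun p : path_space => clamped T X p.1 p.2) @^-1` S) `&` Z.
have mW : measurable W.
  apply: measurableI => //; rewrite -[X in measurable X]setTI.
  exact: (mPhi measurableT mS).
have -> : space_measure S = (lebesgue_measure \x P)%E W by [].
have := @indic_fubini_tonelli1 _ _ _ _ R lebesgue_measure P W mW.
rewrite integral_indic// setIT => ->.
rewrite (indic_fubini_tonelli lebesgue_measure P mW).
rewrite (indic_fubini_tonelli_GE lebesgue_measure mW).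
have yE w : lebesgue_measure (ysection W w) = (\1_A w * fine (occ T X S w))%:E.
  rewrite indicE; have [Aw|nAw] := boolP (w \in A).
    rewrite mul1r -(occ_fin hT hF cX aX w mS) /occ.
    congr (lebesgue_measure _); apply/seteqP; split => t /=.
      by rewrite /ysection/= inE => -[St [/= tT _]].
    by move=> [tT St]; rewrite /ysection/= inE; split => //; split => //=; exact: set_mem.
  rewrite mul0r (_ : ysection W w = set0) ?measure0//.
  apply/seteqP; split => t //=; rewrite /ysection/= inE => -[_ [_ /= Aw]].
  by move: nAw; rewrite mem_set.
rewrite (eq_integral (fun w => (\1_A w * fine (occ T X S w))%:E)); last first.
  by move=> w _; rewrite /= yE.
rewrite /Ex /Rintegral fineK//.
apply: integrable_fin_num => //.
apply: (@L1_bounded _ _ _ P _ T).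
  apply: measurable_funM; first exact: measurable_indic.
  apply: measurableT_comp => //.
  exact: (measurable_fun_occ hT hF cX aX mS).
move=> w; have o0 := occ_ge0 T X S w.
have oT := occ_leT hT hF cX aX w mS.
rewrite ger0_norm; last first.
  by rewrite mulr_ge0 ?fine_ge0// indicE; case: (_ \in _).
apply: (@le_trans _ _ (fine (occ T X S w))).
  by rewrite ler_piMl ?fine_ge0// indicE; case: (_ \in _).
by rewrite -lee_fin -(occ_fin hT hF cX aX w mS).
Qed.

Lemma space_measure_fin : (space_measure setT < +oo)%E.
Proof. by rewrite space_measureE// ltry. Qed.

(** Tonelli: an integral for [space_measure] is the expectation of the integral
    along the paths. *)
Lemma space_measure_paths (S : set (borelV R N)) (f : 'rV[R]_N -> R) :
  measurable S -> borel_fun f ->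
  (\int[space_measure]_(x in S) `|f x|%:E < +oo)%E ->
  {ae P, forall w, A w -> (\int[lebesgue_measure]_(t in `[0%R, T] `&`
     [set t | S (clamped T X t w)]) `|f (clamped T X t w)|%:E < +oo)%E}.
Proof.
move=> mS mf fin.
pose W : set path_space := ((fun p : path_space => clamped T X p.1 p.2) @^-1` S) `&` Z.
have mPS : measurable ((fun p : path_space => clamped T X p.1 p.2) @^-1` S).
  by rewrite -[X in measurable X]setTI; exact: (mPhi measurableT mS).
have mW : measurable W by exact: measurableI.
pose g (p : path_space) : \bar R := `|f (clamped T X p.1 p.2)|%:E.
have mg : measurable_fun setT g.
  apply/measurable_EFinP; apply: measurableT_comp => //.
  exact: (measurableT_comp mf mPhi).
have g0 p : (0 <= g p)%E by rewrite lee_fin.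
have finW : (\int[lebesgue_measure \x P]_(p in W) g p < +oo)%E.
  pose nu := restricted_measure (lebesgue_measure \x P)%E mZ.
  have mfS : measurable_fun S (fun x => `|f x|%:E).
    by apply/measurable_EFinP; apply: measurable_funTS; exact: measurableT_comp.
  have f0 : {in S, forall x, (0 <= `|f x|%:E)%E} by [].
  have pf := ge0_integral_pushforward mPhi nu mS mfS f0.
  apply: le_lt_trans fin; rewrite [leRHS]pf.
  apply: (@le_trans _ _ (\int[nu]_(p in W) g p)%E).
    apply: le_integral_measure => // B mB BW.
    rewrite /= /mrestr setIidl//; apply: (subset_trans BW).
    exact: subIsetr.
  apply: ge0_subset_integral => //.
    exact: measurable_funTS.
  exact: subIsetl.
pose gW := g \_ W.
have mgW : measurable_fun setT gW.
  by apply/(measurable_restrictT g mW); exact: measurable_funTS.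
have gW0 p : (0 <= gW p)%E by rewrite /gW patchE; case: ifP.
move: finW; rewrite integral_mkcond -/gW.
have -> : (\int[lebesgue_measure \x P]_p gW p)%E =
    (\int[P]_w fubini_G lebesgue_measure gW w)%E.
  rewrite (@fubini_tonelli1 _ _ _ _ R lebesgue_measure P)//.
  exact: (@fubini_tonelli _ _ _ _ R lebesgue_measure P).
move=> finG.
have mG := @measurable_fun_fubini_tonelli_G _ _ _ _ R lebesgue_measure gW mgW gW0.
have G0 w : (0 <= fubini_G lebesgue_measure gW w)%E by exact: integral_ge0.
have iG : P.-integrable setT (fubini_G lebesgue_measure gW).
  apply/integrableP; split => //.
  by under eq_integral do rewrite gee0_abs//.
have := integrable_ae measurableT iG.
apply: filterS => w /(_ I) finw Aw.
rewrite integral_mkcond; move: finw; rewrite ge0_fin_numE// /fubini_G.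
congr (_ < _)%E; apply: eq_integral => t _.
rewrite /gW !patchE; congr (if _ then _ else _).
apply/idP/idP; rewrite !inE.
  by move=> [St [tT _]].
by move=> [tT St].
Qed.

End SpaceMeasure.

(** * Integrals along the paths *)

Section PathIntegral.
Context (R : realType) (d : measure_display) (Omega : measurableType d)
  (P : probability Omega R) (T : R) (F : R -> set_system Omega) (N : nat).
Variables (X : R -> Omega -> 'rV[R]_N) (f : 'rV[R]_N -> R).
Hypothesis hT : 0 < T.
Hypothesis hF : filtration T F.
Hypothesis cX : forall i, continuous_paths T (coord X i).
Hypothesis aX : forall i, adapted T F (coord X i).
Hypothesis mf : borel_fun f.

Definition path_integral (w : Omega) : \bar R :=
  (\int[lebesgue_measure]_(t in `[0%R, T]) `|f (X t w)|%:E)%E.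

Lemma path_integralE w : path_integral w =
  (\int[lebesgue_measure]_(t in `[0%R, T]) `|f (clamped T X t w)|%:E)%E.
Proof.
apply: eq_integral => t; rewrite inE/= in_itv/= => tT.
by rewrite /clamped clamp_id.
Qed.

Lemma measurable_path_integral : measurable_fun setT path_integral.
Proof.
pose g (p : measurableTypeR R * Omega) : \bar R :=
  ((fun p => `|f (clamped T X p.1 p.2)|%:E) \_ (`[0, T]%classic `*` setT)) p.
have mZ : measurable (`[0, T]%classic `*` setT : set (measurableTypeR R * Omega)).
  by apply: measurableX => //; exact: measurable_itv.
have mPhi : measurable_fun [set: measurableTypeR R * Omega]
  (fun p => clamped T X p.1 p.2 : borelV R N).
  exact: (measurable_clamped hT hF cX aX).
have mg : measurable_fun setT g.
  apply/(measurable_restrictT _ mZ)/measurable_EFinP; apply: measurable_funTS.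
  apply: measurableT_comp => //; exact: (measurableT_comp mf mPhi).
have g0 p : (0 <= g p)%E by rewrite /g patchE; case: ifP; rewrite ?lee_fin.
have := @measurable_fun_fubini_tonelli_G _ _ _ _ R lebesgue_measure g mg g0.
congr (measurable_fun _ _); apply/funext => w.
rewrite path_integralE integral_mkcond /fubini_G; apply: eq_integral => t _.
rewrite /g !patchE; congr (if _ then _ else _).
by apply/idP/idP; rewrite !inE; [case|split].
Qed.

Lemma path_bounded w : exists B, forall t, 0 <= t <= T -> enorm (X t w) <= B.
Proof.
have /choice[B hB] : forall i, exists B, forall t, 0 <= t <= T -> `|X t w 0 i| <= B.
  move=> i; apply: (@within_continuous_bounded R T (fun t => X t w 0 i)).
    exact: ltW.
  exact: cX.
exists (N%:R * \sum_i `|B i|) => t tT; apply: enorm_le_coord => [|i].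
  by rewrite sumr_ge0.
rewrite (le_trans (hB i t tT))// (le_trans (ler_norm _))//.
by rewrite (bigD1 i)//= lerDl sumr_ge0.
Qed.

Lemma ae_path_integral : {ae P, forall w, (path_integral w < +oo)%E} ->
  P [set w | (path_integral w < +oo)%E] = 1%E.
Proof.
move=> h.
have mE : measurable [set w | (path_integral w < +oo)%E].
  have := measurable_path_integral measurableT
    (emeasurable_itv (Interval -oo%O (BLeft +oo%E))).
  by rewrite setTI; congr measurable; apply/seteqP; split => w /=; rewrite in_itv.
have E0 : P (~` [set w | (path_integral w < +oo)%E]) = 0%E.
  by apply: measure_negligible => //; exact: measurableC.
by rewrite -[X in P X]setCK probability_setC ?E0 ?sube0//; exact: measurableC.
Qed.

End PathIntegral.

Theorem theorem2 (R : realType) (n : nat) (T : R) (hT : 0 < T)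
    (d : measure_display) (Omega : measurableType d) (P : probability Omega R)
    (F : R -> set_system Omega) (hF : filtration T F)
    (X : R -> Omega -> 'rV[R]_n.+1)
    (hX : continuous_semimartingale P T F X)
    (g : R -> Omega -> 'M[R]_n.+1) (hg : density_matrix P T F X g)
    (c C : R) (hc : 0 < c) (hcC : c < C)
    (hcg : {ae (lebesgue_measure \x P)%E, forall p : R * Omega,
       0 <= p.1 <= T ->
       loewner_le c%:M (g p.1 p.2) /\ loewner_le (g p.1 p.2) C%:M})
    (G : set 'rV[R]_n.+1) (hG : C2_hypersurface G) (hGo : orientable G)
    (hGc : closed G)
    (f : 'rV[R]_n.+1 -> R) (hfm : borel_fun f) (hf : L1loc_perp G f) :
  P [set w | (\int[lebesgue_measure]_(t in `[0%R, T]) `|f (X t w)|%:E < +oo)%E]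
    = 1%E.
Proof.
have [M [A hcan]] := hX.
have cX i : continuous_paths T (coord X i) by exact: (X_paths hcan).
have aX i : adapted T F (coord X i) by exact: (adaptedX hcan).
apply: (@ae_path_integral R d Omega P T F n.+1 X f hT hF cX aX hfm).
have mint : measurable (`[0, T]%classic : set R) by exact: measurable_itv.
(* every compact set avoids an empty [G], so [f] is bounded along each path *)
have [G0|/set0P G0] := eqVneq G set0.
  apply: aeW => w; have [B hB] := path_bounded hT cX w.
  have cB : compact [set x : 'rV[R]_n.+1 | enorm x <= B].
    apply: (@compact_enorm_ball _ _ _ B) => //.
    exact: (proj1 (continuous_closedP _) (@enorm_continuous R _) _ (@closed_le _ B)).
  have [|m hm] := hf.2 _ cB; first by rewrite G0 setC0.
  apply: (@le_lt_trans _ _ (\int[lebesgue_measure]_(t in `[0%R, T]) `|m|%:E)%E).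
    apply: (@ge0_le_integral_ptwise R _ (measurableTypeR R) lebesgue_measure) => // t.
    rewrite /= in_itv/= => tT; rewrite lee_fin (le_trans (hm _ _))// ?ler_norm//.
    exact: hB.
  have lT : (lebesgue_measure (`[0%R, T]%classic : set R) < +oo)%E.
    by rewrite lebesgue_measure_itv/= lte_fin hT sube0 ltry.
  by rewrite integral_cst// lte_mul_pinfty.
have [Good [K [mGood aeGood K0 est]]] := occupation_estimate hT hF hg hc hcC hcg.
pose mu k := space_measure P hT hF cX aX (mGood k).
have hmu k (S : set (borelV R n.+1)) h p v (Bh Pm kap e0 : R) :
    measurable S -> 0 <= Pm -> 0 <= kap -> 0 < e0 <= 1 ->
    occ_test k%:R S h p v Bh Pm kap e0 ->
    (mu k S <= (K k * (Bh + Pm + kap + e0))%:E)%E.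
  move=> mS Pm0 kap0 e00 ht; rewrite /mu space_measureE// lee_fin.
  exact: est ht.
pose ball k := [set x : borelV R n.+1 | enorm x < k.+1%:R].
have mball k : measurable (ball k).
  have := measurable_enorm_ball (0 : 'rV[R]_n.+1) k.+1%:R.
  by under eq_set do rewrite subr0.
have fin k : (\int[mu k]_(x in ball k) `|f x|%:E < +oo)%E.
  have [rho [K' [E [rho0 K'0 mE hE]]]] :=
    two_sided_measurable hGc hG G0 (n.+1%:R * k%:R).
  have k0 : 0 <= k%:R :> R by [].
  pose C1 := K k * (2 * (rho / 3) + 1 + K' + 2 / (rho / 3)).
  have tube := tube_estimate hGc G0 k0 (K0 k) (@hmu k) rho0 K'0 mE hE.
  have null := surface_null hGc hG G0 k0 (K0 k) (@hmu k) rho0 K'0 mE hE.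
  pose e := Num.min 1 (rho / 6).
  have e0 : 0 < e by rewrite lt_min ltr01 divr_gt0.
  have e1 : e <= 1 by rewrite ge_min lexx.
  have er : e < rho / 3.
    rewrite gt_min; apply/orP; right; lra.
  have C10 : 0 <= C1.
    rewrite mulr_ge0//; have r3 : 0 < rho / 3 by rewrite divr_gt0.
    by have := divr_ge0 (ler0n R 2) (ltW r3); set q := _ / _; lra.
  have C1p : 0 < C1 + 1 by rewrite ltr_wpDl.
  apply: (ball_integral_fin hGc G0 (space_measure_fin P hT hF cX aX (mGood k))
    C1p e1 _ hfm null _ e0 hf) => //.
  move=> s t s0 st te; apply: (le_trans (tube _ _ s0 st (le_lt_trans te er))).
  by rewrite lee_fin ler_wpM2r ?subr_ge0// lerDl.
have paths := fun k => space_measure_paths (mball k) hfm (fin k).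
have {}paths : {ae P, forall w, forall k, Good k w ->
    (\int[lebesgue_measure]_(t in `[0%R, T] `&`
     [set t | ball k (clamped T X t w)]) `|f (clamped T X t w)|%:E < +oo)%E}.
  exact/ae_foralln.
(* the path stays in [ball k] for the large [k] with [Good k w] *)
apply: filterS2 aeGood paths => w gw pw.
have [B hB] := path_bounded hT cX w.
have hk : \forall k \near \oo, B <= k%:R by exact: nbhs_infty_ger.
have [k [gk Bk]] := filter_ex (filterI gw hk).
have := pw k gk; rewrite path_integralE.
rewrite (_ : _ `&` _ = `[0, T]%classic)//.
apply/seteqP; split => [t []//|t tT]; split => //.
rewrite /ball/= (le_lt_trans (hB _ (clamp_itv t (ltW hT))))//.
by rewrite (le_lt_trans Bk)// ltr_nat.
Qed.
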